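(* Let $n_1,n_2$ be positive integers, let $A^1,A^2\in\mathbb{R}^{n_1\times n_2}$ and $b_1,b_2\in\mathbb{R}$, and suppose that the set $$\mathcal{U}:=\left\{W\in\mathbb{R}^{n_1\times n_2}_{+}\ \middle|\ \langle A^k,W\rangle\le b_k\ \text{ for }k=1,2,\ \operatorname{rank}(W)\le 1\right\}$$ is bounded. Then $\operatorname{conv}(\mathcal{U})$ is second-order cone representable. Moreover, a linear function can be optimized in polynomial time over $\mathcal{U}$.
   Context: $\mathbb{R}^{n_1\times n_2}_+$ is the set of entrywise nonnegative matrices; $\langle U,V\rangle=\sum_{i,j}U_{ij}V_{ij}$; $\operatorname{conv}(S)$ is the convex hull of $S$. A set is second-order cone representable (SOCr) if it is the projection of a set defined by finitely many linear and second-order cone constraints $\|Bz+c\|_2\le d^{\top}z+e$ in the original and possibly finitely many additional variables. ''Polynomial time'' is in the size of the data $(A^1,A^2,b_1,b_2)$ and of the linear objective, in the usual sense for second-order cone programming (rational data, optimization to prescribed accuracy). *)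

(* Defs.v *)
From HB Require Import structures.
From mathcomp Require Import all_boot all_order all_algebra.
From mathcomp Require Import boolp classical_sets reals topology normedtype convex.

Set Implicit Arguments.
Unset Strict Implicit.
Unset Printing Implicit Defensive.

Import Order.TTheory GRing.Theory Num.Theory.
Import numFieldNormedType.Exports.

Local Open Scope classical_set_scope.
Local Open Scope ring_scope.

(** * The set U and its convex hull *)

Definition mxdot (K : pzRingType) (m n : nat) (U V : 'M[K]_(m, n)) : K :=
  \sum_i \sum_j U i j * V i j.

Definition rank1_set (K : realFieldType) (m n : nat)
    (A1 A2 : 'M[K]_(m, n)) (b1 b2 : K) : set 'M[K]_(m, n) :=
  [set W : 'M[K]_(m, n) | [/\ (forall i j, 0 <= W i j),
               mxdot A1 W <= b1, mxdot A2 W <= b2 & (\rank W <= 1)%N]].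

Definition conv_hull (R : realType) (E : lmodType R) (S : set E) : set E :=
  smallest (@convex_set R E) S.

(** * Second-order cone representability *)

(* The library norm on matrices is the sup norm. *)
Definition l2norm (R : realType) (n : nat) (v : 'cV[R]_n) : R :=
  Num.sqrt (\sum_i v i 0 ^+ 2).

(* a^T z <= e and ||B z + c|| <= d^T z + e; a linear equation is a pair of
   inequalities. *)
Inductive cone_constraint (R : realType) (N : nat) :=
| LinConstraint (a : 'cV[R]_N) (e : R)
| SocConstraint (r : nat) (B : 'M[R]_(r, N)) (c : 'cV[R]_r)
                (d : 'cV[R]_N) (e : R).

Definition holds (R : realType) (N : nat) (z : 'cV[R]_N)
    (k : cone_constraint R N) : Prop :=
  match k with
  | LinConstraint a e => (a^T *m z) 0 0 <= e
  | SocConstraint r B c d e => l2norm (B *m z + c) <= (d^T *m z) 0 0 + e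
  end.

Definition socr (R : realType) (n : nat) (S : set 'cV[R]_n) : Prop :=
  exists (p q : nat) (ks : 'I_q -> cone_constraint R (n + p)),
    S = [set x | exists u : 'cV[R]_p,
                   forall i, holds (col_mx x u) (ks i)].

Definition socr_mx (R : realType) (m n : nat) (S : set 'M[R]_(m, n)) : Prop :=
  socr [set (mxvec W)^T | W in S].

(** * Polynomial time: random access machine with logarithmic cost

   Programs are structured (assignment, sequence, test, loop) and act on
   finitely many banks of integer registers with indirect addressing.  Every
   arithmetic step costs the bit length of the integers it handles, addresses
   included, so that polynomial time here is polynomial time on Turing
   machines. *)

Definition bits (z : int) : nat := (trunc_log 2 `|z|%N).+1.

Definition memory := nat -> nat -> int.

Inductive binop := Add | Sub | Mul | Div.

Definition binop_val (o : binop) (x y : int) : int :=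
  match o with
  | Add => x + y
  | Sub => x - y
  | Mul => x * y
  | Div => (x %/ y)%Z
  end.

Inductive expr :=
| Cst of int
| Get of nat & expr          (* register [|e|] of the given bank *)
| Op of binop & expr & expr.

Fixpoint val_of (s : memory) (e : expr) : int :=
  match e with
  | Cst z => z
  | Get a i => s a `|val_of s i|%N
  | Op o e1 e2 => binop_val o (val_of s e1) (val_of s e2)
  end.

(* Each node pays for its value, hence for the operands of its parent. *)
Fixpoint cost_of (s : memory) (e : expr) : nat :=
  (match e with
   | Cst _ => 0
   | Get _ i => cost_of s i
   | Op _ e1 e2 => cost_of s e1 + cost_of s e2
   end + bits (val_of s e))%N.

Inductive cmd :=
| Skip
| Assign of nat & expr & expr  (* [Assign a i e]: bank a, register |i| := e *)
| Seq of cmd & cmd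
| If of expr & cmd & cmd       (* tests are [0 < e] *)
| While of expr & cmd.

Definition update (s : memory) (a i : nat) (z : int) : memory :=
  fun a' i' => if (a' == a) && (i' == i) then z else s a' i'.

(* [exec c s s' t]: from s, c halts in s' at total cost t. *)
Inductive exec : cmd -> memory -> memory -> nat -> Prop :=
| ExecSkip s : exec Skip s s 1
| ExecAssign a i e s :
    exec (Assign a i e) s (update s a `|val_of s i|%N (val_of s e))
         (cost_of s i + cost_of s e)%N
| ExecSeq c1 c2 s s1 s2 t1 t2 :
    exec c1 s s1 t1 -> exec c2 s1 s2 t2 -> exec (Seq c1 c2) s s2 (t1 + t2)%N
| ExecIf e c1 c2 s s' t :
    exec (if 0 < val_of s e then c1 else c2) s s' t ->
    exec (If e c1 c2) s s' (cost_of s e + t)%N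
| ExecStop e c s : ~~ (0 < val_of s e) -> exec (While e c) s s (cost_of s e)
| ExecLoop e c s s1 s2 t1 t2 :
    0 < val_of s e -> exec c s s1 t1 -> exec (While e c) s1 s2 t2 ->
    exec (While e c) s s2 (cost_of s e + t1 + t2)%N.

(* The k-th word of the input is written in bank k; all other registers are 0. *)
Definition load (w : seq (seq int)) : memory :=
  fun a i => nth 0 (nth [::] w a) i.

Definition input_size (w : seq (seq int)) : nat :=
  (\sum_(v <- w) \sum_(z <- v) bits z)%N.

Definition poly_time_solvable (I : Type) (encode : I -> seq (seq int))
    (valid : I -> Prop) (correct : I -> memory -> Prop) : Prop :=
  exists (P : cmd) (c d : nat), forall x : I, valid x ->
    exists (s : memory) (t : nat),
      [/\ exec P (load (encode x)) s t,
          (t <= c * input_size (encode x) ^ d + c)%N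
        & correct x s].

(** * Linear optimization over U to prescribed accuracy *)

Record instance := Instance {
  nrows : nat;
  ncols : nat;
  A1_of : 'M[rat]_(nrows, ncols);
  A2_of : 'M[rat]_(nrows, ncols);
  b1_of : rat;
  b2_of : rat;
  obj_of : 'M[rat]_(nrows, ncols);
  acc_of : rat }.

Definition mx_entries (m n : nat) (A : 'M[rat]_(m, n)) : seq rat :=
  [seq A i j | i <- enum 'I_m, j <- enum 'I_n].

(* Bank 0: dimensions.  Banks 1-2, 3-4, 5-6, 7-8: numerators and denominators
   of the scalars, of A1, of A2 and of the objective, row by row. *)
Definition encode_instance (x : instance) : seq (seq int) :=
  [:: (nrows x)%:Z; (ncols x)%:Z] ::
  flatten [seq [:: map numq w; map denq w]
          | w <- [:: [:: b1_of x; b2_of x; acc_of x];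
                     mx_entries (A1_of x); mx_entries (A2_of x);
                     mx_entries (obj_of x)]].

(* Bank 9: status; banks 10-11: numerators and denominators of the answer. *)
Definition status (s : memory) : int := s 9%N 0%N.

Definition answer (m n : nat) (s : memory) : 'M[rat]_(m, n) :=
  \matrix_(i, j) ((s 10%N (i * n + j)%N)%:~R / (s 11%N (i * n + j)%N)%:~R).

Section Optimization.
Variable R : realType.

Definition mx_ratr (m n : nat) (A : 'M[rat]_(m, n)) : 'M[R]_(m, n) :=
  map_mx ratr A.

Definition feasible (x : instance) : set 'M[R]_(nrows x, ncols x) :=
  rank1_set (mx_ratr (A1_of x)) (mx_ratr (A2_of x))
            (ratr (b1_of x)) (ratr (b2_of x)).
Arguments feasible : clear implicits.

Definition objective (x : instance) (W : 'M[R]_(nrows x, ncols x)) : R :=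
  mxdot (mx_ratr (obj_of x)) W.

Definition valid_instance (x : instance) : Prop :=
  [/\ (0 < nrows x)%N, (0 < ncols x)%N, 0 < acc_of x
    & bounded_set (feasible x)].

(* An optimal solution need not be rational: the answer is a rational matrix
   within the accuracy of the feasible set, whose objective value is within the
   accuracy of the maximum.  Minimization is the case of the opposite
   objective. *)
Definition optimized (x : instance) (s : memory) : Prop :=
  (status s = 0 /\ feasible x = set0) \/
  (status s = 1 /\
   let W := mx_ratr (answer (nrows x) (ncols x) s) in
   let eps : R := ratr (acc_of x) in
   (exists2 V, feasible x V & forall i j, `|W i j - V i j| <= eps) /\
   (exists2 V, feasible x V &
      (forall V', feasible x V' -> objective V' <= objective V) /\
      `|objective W - objective V| <= eps)).

Definition linear_optimization_poly_time : Prop :=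
  poly_time_solvable encode_instance valid_instance optimized.

End Optimization.

(* Main.v *)
(** Write a rank-one point of U as x y^T. It can be moved inside U along any
   direction of x supported where x is and orthogonal to the tight rows A^k y,
   until a coordinate of x or a slack vanishes; likewise for y. So a convex set
   contains U as soon as it contains the points of U supported on a block of at
   most two rows and two columns with few nonzero entries, or with both
   constraints tight. On a tight block p q^T, b_2 <A^1, p q^T> = b_1 <A^2, p q^T>
   determines q up to scaling as a linear function of p, so the points form an
   arc of a conic, with coordinates quadratic in p. Boundedness keeps the
   denominator of this parametrization away from 0, so the cone over the arc is
   a linear image of a section of the moment cone xz >= y^2. The hull of U is
   the slice at height 1 of a finite Minkowski sum of such cones.

   For the optimization, whether some point of U has objective at least j is
   decided block by block on finitely many candidates: the ends of the arc, and
   the vertex of the quadratic form "objective - j * denominator" on it. These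
   are polynomials in the data and j. After scaling the data by a common
   denominator D they are integers and |max| <= D^54, because the maximum over
   an arc is either attained at an end or a root of a discriminant, to which
   the Cauchy bound applies. A binary search over integers j then locates the
   scaled maximum within 1, that is the maximum within 1/D. *)

From HB Require Import structures.
Require Import Defs.
From mathcomp Require Import all_boot all_order all_algebra.
From mathcomp Require Import boolp classical_sets reals topology normedtype convex.
From mathcomp Require Import interval_inference derive.
From mathcomp Require Import ring lra zify.

Set Implicit Arguments.
Unset Strict Implicit.
Unset Printing Implicit Defensive.

Import Order.TTheory GRing.Theory Num.Theory.
Import numFieldNormedType.Exports.

Local Open Scope classical_set_scope.
Local Open Scope ring_scope.

(** One reduction serves both halves. For the hull it is applied to any convex set that contains the
    pieces; for the optimization, to the open half space where the objective is less than j. Slicing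
    a sum of cones at height 1 gives the hull only if no summand has a nonzero vector at height 0,
    since such a vector could be added freely. Boundedness excludes it: on a single row or column as
    a recession direction, on an arc through the positivity of [den]. The maximum over an arc can be
    irrational, so it is never computed; for a given j, a quadratic form that is negative at both
    ends of the arc is tested at its vertex, which is polynomial in the data and j. Every candidate
    is checked exactly before it is recorded, so the analysis of arcs bears on the existence of
    candidates and on the range of the search. The exponent 54 is 2 * 27: the scaled data are
    integers of size at most N = D^2, and the Cauchy bound for the discriminant is at most 2^17 N^10
    <= N^27. *)

Lemma convex_setP (R : realType) (E : lmodType R) (S : set E) :
  @convex_set R E S <->
  forall x y t, 0 <= t <= 1 -> S x -> S y -> S (t *: x + (1 - t) *: y).
Proof.
split=> [cS x y t /andP[t0 t1] Sx Sy|cS x y k].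
  have := cS x y (Itv01 t0 t1); rewrite !inE => /(_ Sx Sy).
  by [].
rewrite !inE => Sx Sy; apply: cS => //.
by rewrite ge0 le1.
Qed.

(** The ratio test of the simplex method: [t] is the least quotient [al a / - be a] over the
    decreasing entries. By the second hypothesis a decreasing entry starts above 0, so [t] is
    positive. *)
Lemma ratio_test (R : realFieldType) (I : finType) (al be : I -> R) :
  (forall a, 0 <= al a) -> (forall a, al a = 0 -> be a = 0) ->
  (exists a, be a < 0) ->
  exists2 t, 0 < t & (forall a, 0 <= al a + t * be a) /\
    exists2 a, al a != 0 & al a + t * be a = 0.
Proof.
move=> al0 albe [a0 be0].
have [a bea amin] := @arg_minP _ R I a0 (fun a => be a < 0)
  (fun a => al a / - be a) be0.
have ala : 0 < al a.
  rewrite lt_neqAle al0 andbT; apply/eqP => h.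
  by move: bea; rewrite albe // ltxx.
exists (al a / - be a); first by rewrite divr_gt0 // oppr_gt0.
split=> [c|]; last first.
  exists a; first by rewrite gt_eqF.
  by rewrite invrN mulrN mulNr divfK ?subrr // lt_eqF.
have [bec|bec] := ltP (be c) 0; last first.
  by rewrite addr_ge0 // mulr_ge0 // divr_ge0 // oppr_ge0 ltW.
have := amin _ bec; rewrite ler_pdivlMr ?oppr_gt0 // => h.
lra.
Qed.

(** * Rigid points of a polyhedron with two constraints *)

Section Simplex.
Variables (R : realFieldType) (I : finType) (u : bool -> I -> R) (b : bool -> R).

Definition feas (x : I -> R) :=
  (forall i, 0 <= x i) /\ (forall k, \sum_i x i * u k i <= b k).

(** Every split below lowers this count, which makes it the measure of the induction. *)
Definition slack_count (x : I -> R) : nat :=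
  #|[pred i | x i != 0]| + #|[pred k | \sum_i x i * u k i != b k]|.

Definition movable (x d : I -> R) :=
  (forall i, x i = 0 -> d i = 0) /\
  (forall k, \sum_i x i * u k i = b k -> \sum_i d i * u k i = 0).

(** For feasible [x] this says that [x] is a vertex of the polyhedron [feas]: the movable directions
    are those of its minimal face. *)
Definition rigid (x : I -> R) :=
  forall d, movable x d -> forall i, d i = 0.

Lemma sum_step (x d : I -> R) t k :
  \sum_i (x i + t * d i) * u k i =
  \sum_i x i * u k i + t * \sum_i d i * u k i.
Proof.
by rewrite mulr_sumr -big_split /=; apply: eq_bigr => i _; rewrite mulrDl mulrA.
Qed.

(** Coordinates and slacks enter the ratio test on an equal footing, as one family indexed by
    [I + bool]. If no member decreases along [d], the whole ray is feasible, which the last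
    hypothesis excludes. *)
Lemma feas_step (x d : I -> R) :
  feas x -> movable x d -> ~ (forall t, 0 <= t -> feas (fun i => x i + t * d i)) ->
  exists2 t, 0 < t & feas (fun i => x i + t * d i) /\
     (slack_count (fun i => x i + t * d i)%R < slack_count x)%N.
Proof.
move=> [x0 xb] [dx du] nray.
pose al (a : I + bool) := match a with inl i => x i
  | inr k => b k - \sum_i x i * u k i end.
pose be (a : I + bool) := match a with inl i => d i
  | inr k => - \sum_i d i * u k i end.
have alge a : 0 <= al a by case: a => [i|k] //=; rewrite subr_ge0.
have albe a : al a = 0 -> be a = 0.
  case: a => [i|k] /=; first exact: dx.
  by move/eqP; rewrite subr_eq0 => /eqP/esym/du ->; rewrite oppr0.
have feasE t : (forall a, 0 <= al a + t * be a) ->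
    feas (fun i => x i + t * d i).
  move=> h; split=> [i|k]; first exact: (h (inl i)).
  by have := h (inr k); rewrite /= sum_step; lra.
have [[a bea]|] := pselect (exists a, be a < 0); last first.
  move=> nb; case: nray => t t0; apply: feasE => a.
  rewrite addr_ge0 // mulr_ge0 // leNgt; apply/negP => h.
  by apply: nb; exists a.
have [t t0 [tge [c alc tc]]] := ratio_test alge albe (ex_intro _ a bea).
exists t => //; split; first exact: feasE.
rewrite /slack_count.
have s1 : [pred i | x i + t * d i != 0] \subset [pred i | x i != 0].
  apply/fintype.subsetP => i; rewrite !inE; apply: contra_neq => xi.
  by rewrite xi dx // mulr0 addr0.
have s2 : [pred k | \sum_i (x i + t * d i) * u k i != b k] \subset
          [pred k | \sum_i x i * u k i != b k].
  apply/fintype.subsetP => k; rewrite !inE; apply: contra_neq => xk.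
  by rewrite sum_step xk du // mulr0 addr0.
case: c alc tc => [i|k] /= alc tc.
- rewrite -addSn leq_add ?subset_leq_card // proper_card //.
  apply/properP; split=> //; exists i; rewrite inE ?alc //.
  by rewrite tc eqxx.
- rewrite -addnS leq_add ?subset_leq_card // proper_card //.
  apply/properP; split=> //; exists k; rewrite inE.
    by move: alc; rewrite subr_eq0 eq_sym.
  by rewrite negbK sum_step; apply/eqP; lra.
Qed.

Lemma movableN x d : movable x d -> movable x (fun i => - d i).
Proof.
move=> [h1 h2]; split=> [i /h1 ->|k /h2 h]; first by rewrite oppr0.
transitivity (- \sum_i d i * u k i); last by rewrite h oppr0.
by rewrite -sumrN; apply: eq_bigr => i _; rewrite mulNr.
Qed.

Lemma feas_split (x : I -> R) :
  feas x -> ~ rigid x ->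
  (forall d, (exists i, d i != 0) ->
     ~ (forall t, 0 <= t -> feas (fun i => x i + t * d i))) ->
  exists x1 x2 t, [/\ feas x1 /\ (slack_count x1 < slack_count x)%N,
     feas x2 /\ (slack_count x2 < slack_count x)%N, 0 <= t <= 1 &
     forall i, x i = t * x1 i + (1 - t) * x2 i].
Proof.
move=> fx nr nray.
have [d [md [i di]]] : exists d, movable x d /\ exists i, d i != 0.
  apply: contrapT => h; apply: nr => d md i; apply/eqP; apply: contraT => di.
  by case: h; exists d; split=> //; exists i.
have [|s s0 [f1 p1]] := feas_step fx md; first by apply: nray; exists i.
have [|t t0 [f2 p2]] := feas_step fx (movableN md).
  by apply: nray; exists i; rewrite oppr_eq0.
(* [x] lies between a step [s] along [d] and a step [t] along [- d], so the first end point has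
   weight [t / (s + t)]. *)
exists (fun i => x i + s * d i), (fun i => x i + t * - d i), (t / (s + t)).
have st : 0 < s + t by rewrite addr_gt0.
have st0 : s + t != 0 by rewrite gt_eqF.
split=> //.
  apply/andP; split; first by rewrite divr_ge0 // ltW.
  by rewrite ler_pdivrMr // mul1r lerDr ltW.
by move=> j; field.
Qed.

(** The cross product serves unless the two vectors are parallel; then it is enough to be orthogonal
    to one of them that is nonzero. *)
Lemma orthogonal3 (a1 a2 a3 c1 c2 c3 : R) : exists d1 d2 d3,
  [/\ [|| d1 != 0, d2 != 0 | d3 != 0], d1 * a1 + d2 * a2 + d3 * a3 = 0
    & d1 * c1 + d2 * c2 + d3 * c3 = 0].
Proof.
have [/and3P[/eqP-> /eqP-> /eqP->]|na] := boolP [&& a1 == 0, a2 == 0 & a3 == 0].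
  have [c10|c10] := eqVneq c1 0.
    by exists 1, 0, 0; rewrite oner_eq0 c10; split=> //; ring.
  exists (- c2), c1, 0; rewrite c10 orbT; split=> //; ring.
have [|] := boolP [|| a2 * c3 - a3 * c2 != 0, a3 * c1 - a1 * c3 != 0
                   | a1 * c2 - a2 * c1 != 0].
  move=> h; exists (a2 * c3 - a3 * c2), (a3 * c1 - a1 * c3), (a1 * c2 - a2 * c1).
  split=> //; ring.
rewrite !negb_or !negbK => /and3P[/eqP e1 /eqP e2 /eqP e3].
have [a10|a10] := eqVneq a1 0.
  have [a20|a20] := eqVneq a2 0.
    have a30 : a3 != 0 by move: na; rewrite a10 a20 !eqxx.
    have c10 : c1 = 0.
      by apply/eqP; rewrite -(mulrI_eq0 _ (mulfI a30)); apply/eqP; move: e2; rewrite a10; lra.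
    by exists 1, 0, 0; rewrite oner_eq0 a10 c10; split=> //; ring.
  exists a2, (- a1), 0; rewrite a20; split=> //; first ring.
  by rewrite mul0r; lra.
exists a2, (- a1), 0; rewrite oppr_eq0 a10 orbT; split=> //; first ring.
by rewrite mul0r; lra.
Qed.

Lemma sum_supp1 (d : I -> R) (w : I -> R) i :
  (forall l, l != i -> d l = 0) -> \sum_l d l * w l = d i * w i.
Proof.
by move=> h; rewrite (bigD1 i) //= big1 ?addr0 // => l /h ->; rewrite mul0r.
Qed.

Lemma sum_supp2 (d : I -> R) (w : I -> R) i j : i != j ->
  (forall l, l != i -> l != j -> d l = 0) ->
  \sum_l d l * w l = d i * w i + d j * w j.
Proof.
move=> ij h; rewrite (bigD1 i) //= (bigD1 j) ?(eq_sym j) //=.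
rewrite big1 ?addr0 // => l /andP[li lj].
by rewrite h // mul0r.
Qed.

(** A vertex has no more nonzero coordinates than independent tight constraints, hence at most two;
    the determinant records the independence. *)
Lemma rigid_cases (x : I -> R) : rigid x -> (exists i, x i != 0) ->
  (exists i k, [/\ x i != 0, forall l, l != i -> x l = 0,
     \sum_l x l * u k l = b k & u k i != 0]) \/
  (exists i j, [/\ i != j /\ (x i != 0 /\ x j != 0),
     forall l, l != i -> l != j -> x l = 0,
     forall k, \sum_l x l * u k l = b k &
     u true i * u false j - u true j * u false i != 0]).
Proof.
move=> rx [i xi].
(* Rows of slack constraints are replaced by 0, so the movable directions are those supported where
   [x] is and orthogonal to both rows of [w]. *)
pose w k l := if \sum_l x l * u k l == b k then u k l else 0.
have wr d : (forall l, x l = 0 -> d l = 0) ->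
    (forall k, \sum_l d l * w k l = 0) -> forall l, d l = 0.
  move=> dx dw; apply: rx; split=> // k e; rewrite -[RHS](dw k).
  by apply: eq_bigr => l _; rewrite /w e eqxx.
have [[j ij xj]|nj] := pselect (exists2 j, i != j & x j != 0); last first.
  left.
  have xl l : l != i -> x l = 0.
    move=> li; apply/eqP; apply: contraT => xl; case: nj; exists l => //.
    by rewrite eq_sym.
  have [k wk] : exists k, w k i != 0.
    apply: contrapT => nk.
    move/eqP: xi; apply; apply: (wr x) => // k.
    rewrite (sum_supp1 _ xl).
    have [->|h] := eqVneq (w k i) 0; first by rewrite mulr0.
    by case: nk; exists k.
  exists i, k; move: wk; rewrite /w; case: ifP => [/eqP e ui|_]; first by split.
  by rewrite eqxx.
right; exists i, j.
have xl l : l != i -> l != j -> x l = 0.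
  move=> li lj; apply/eqP; apply: contraT => xl.
  (* A third nonzero coordinate would leave room for a movable direction on [i], [j], [l]. *)
  have [d1 [d2 [d3 [dn e1 e2]]]] :=
    orthogonal3 (w true i) (w true j) (w true l)
                (w false i) (w false j) (w false l).
  pose d m := if m == i then d1 else if m == j then d2
              else if m == l then d3 else 0.
  have dE m : d m = 0.
    apply: wr => [r xr|k].
      rewrite /d; case: eqP => [e|_]; first by rewrite -e xr eqxx in xi.
      case: eqP => [e|_]; first by rewrite -e xr eqxx in xj.
      by case: eqP => [e|//]; rewrite -e xr eqxx in xl.
    rewrite (bigD1 i) //= (bigD1 j) ?(eq_sym j) //= (bigD1 l) ?li ?lj //=.
    rewrite big1 ?addr0 => [|r /andP[/andP[ri rj] rl]]; last first.
      by rewrite /d (negPf ri) (negPf rj) (negPf rl) mul0r.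
    rewrite /d !eqxx (negPf li) (negPf lj) eq_sym (negPf ij) addrA.
    by case: k.
  have := dE i; rewrite /d eqxx => d10.
  have := dE j; rewrite /d eqxx eq_sym (negPf ij) => d20.
  have := dE l; rewrite /d eqxx (negPf li) (negPf lj) => d30.
  by move: dn; rewrite d10 d20 d30 eqxx.
have ji : (j == i) = false by rewrite eq_sym; exact: negbTE.
have w2 d1 d2 : (forall k, d1 * w k i + d2 * w k j = 0) -> d1 = 0 /\ d2 = 0.
  move=> h; pose d m := if m == i then d1 else if m == j then d2 else 0.
  have dE m : d m = 0.
    apply: wr => [r xr|k].
      rewrite /d; case: eqP => [e|_]; first by rewrite -e xr eqxx in xi.
      by case: eqP => [e|//]; rewrite -e xr eqxx in xj.
    rewrite (sum_supp2 _ ij) => [|r ri rj].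
      by rewrite /d !eqxx ji.
    by rewrite /d (negPf ri) (negPf rj).
  by move: (dE i) (dE j); rewrite /d !eqxx ji.
(* If the determinant vanished, [(w k j, - w k i)] would be movable for both [k]; so [w] would
   vanish at [i] and [j], and then [(1, 0)] would be movable. *)
have wdet : w true i * w false j - w true j * w false i != 0.
  apply/eqP => h.
  have [|a1 a2] := w2 (w true j) (- w true i).
    by case; [ring | lra].
  have [|c1 c2] := w2 (w false j) (- w false i).
    by case; [lra | ring].
  have [|/eqP] := w2 1 0; last by rewrite oner_eq0.
  by case; lra.
have tight k : \sum_l x l * u k l = b k.
  apply/eqP; apply: contraNT wdet => /negPf nk.
  by apply/eqP; case: k nk => nk; rewrite /w nk !(mulr0, mul0r) subrr.
split=> //.
by move: wdet; rewrite /w !tight !eqxx.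
Qed.

End Simplex.

(** * Reduction to two-by-two blocks *)

Record blk (T : Type) := Blk { e11 : T; e12 : T; e21 : T; e22 : T }.

(** Transports decidable equality to blocks, as membership in the lists of candidates requires. *)
Definition blk_tuple T (v : blk T) := (e11 v, e12 v, e21 v, e22 v).
Definition tuple_blk T (t : T * T * T * T) := Blk t.1.1.1 t.1.1.2 t.1.2 t.2.
Lemma blk_tupleK T : cancel (@blk_tuple T) (@tuple_blk T). Proof. by case. Qed.
HB.instance Definition _ (T : eqType) := Equality.copy (blk T) (can_type (@blk_tupleK T)).

Section Blocks.
Variable K : comNzRingType.
Implicit Types (a v : blk K).

Definition dot2 a v := e11 a * e11 v + e12 a * e12 v + e21 a * e21 v + e22 a * e22 v.

Definition ten (p1 p2 q1 q2 : K) := Blk (p1 * q1) (p1 * q2) (p2 * q1) (p2 * q2).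

Definition subblk m n (A : 'M[K]_(m, n)) i i' j j' :=
  Blk (A i j) (A i j') (A i' j) (A i' j').

(* Coinciding indices are allowed: the entries of the block then add up. *)
Definition embed m n (i i' : 'I_m) (j j' : 'I_n) v : 'M[K]_(m, n) :=
  e11 v *: delta_mx i j + e12 v *: delta_mx i j' +
  e21 v *: delta_mx i' j + e22 v *: delta_mx i' j'.

Definition outer m n (x : 'I_m -> K) (y : 'I_n -> K) : 'M[K]_(m, n) :=
  \matrix_(i, j) (x i * y j).

Lemma mxdotD m n (A U V : 'M[K]_(m, n)) : mxdot A (U + V) = mxdot A U + mxdot A V.
Proof.
rewrite /mxdot -big_split; apply: eq_bigr => i _; rewrite -big_split.
by apply: eq_bigr => j _; rewrite mxE mulrDr.
Qed.

Lemma mxdotZ m n (A U : 'M[K]_(m, n)) t : mxdot A (t *: U) = t * mxdot A U.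
Proof.
rewrite /mxdot mulr_sumr; apply: eq_bigr => i _; rewrite mulr_sumr.
by apply: eq_bigr => j _; rewrite mxE mulrCA.
Qed.

Lemma mxdot0 m n (A : 'M[K]_(m, n)) : mxdot A 0 = 0.
Proof. by have := mxdotZ A 0 0; rewrite scale0r mul0r. Qed.

Lemma mxdot_delta m n (A : 'M[K]_(m, n)) i j : mxdot A (delta_mx i j) = A i j.
Proof.
rewrite /mxdot (bigD1 i) //= (bigD1 j) //= mxE !eqxx mulr1 !big1 ?addr0 //.
- move=> r /negPf ri; rewrite big1 // => c _.
  by rewrite mxE ri mulr0.
- by move=> c /negPf cj; rewrite mxE cj andbF mulr0.
Qed.

Lemma mxdot_embed m n (A : 'M[K]_(m, n)) i i' j j' v :
  mxdot A (embed i i' j j' v) = dot2 (subblk A i i' j j') v.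
Proof. by rewrite !mxdotD !mxdotZ !mxdot_delta /dot2 /=; ring. Qed.

Lemma mxdot_outer m n (A : 'M[K]_(m, n)) x y :
  mxdot A (outer x y) = \sum_i x i * \sum_j A i j * y j.
Proof.
apply: eq_bigr => i _; rewrite mulr_sumr; apply: eq_bigr => j _.
by rewrite mxE mulrCA.
Qed.

Lemma mxdot_outerC m n (A : 'M[K]_(m, n)) x y :
  mxdot A (outer x y) = \sum_j y j * \sum_i A i j * x i.
Proof.
rewrite /mxdot exchange_big; apply: eq_bigr => j _; rewrite mulr_sumr.
by apply: eq_bigr => i _; rewrite mxE; ring.
Qed.

(** The product structure survives coinciding indices: if [i = i'], the two multiples add up to
    [p1 + p2] in that row, just as the entries of the block add up. *)
Lemma embed_ten m n (i i' : 'I_m) (j j' : 'I_n) p1 p2 q1 q2 :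
  embed i i' j j' (ten p1 p2 q1 q2) =
  outer (fun r => p1 *+ (r == i) + p2 *+ (r == i'))
        (fun c => q1 *+ (c == j) + q2 *+ (c == j')).
Proof.
apply/matrixP => r c; rewrite !mxE /=.
by case: (r == i); case: (c == j); case: (r == i'); case: (c == j');
  rewrite /= ?mulr1n ?mulr0n; ring.
Qed.

End Blocks.

Lemma outer_rank (K : fieldType) m n (x : 'I_m -> K) (y : 'I_n -> K) :
  (\rank (outer x y) <= 1)%N.
Proof.
have -> : outer x y = (\col_i x i) *m (\row_j y j).
  by apply/matrixP => i j; rewrite !mxE big_ord1 !mxE.
exact: leq_trans (mxrankM_maxl _ _) (rank_leq_col _).
Qed.

Lemma rank1_minor (K : fieldType) m n (W : 'M[K]_(m, n)) : (\rank W <= 1)%N ->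
  forall i i' j j', W i j * W i' j' = W i j' * W i' j.
Proof.
move=> rW i i' j j'; rewrite -(mulmx_base W).
move: (col_base W) (row_base W); case: (\rank W) rW => [|[|//]] _ P Q.
  by rewrite !mxE !big_ord0 !mul0r.
by rewrite !mxE !big_ord1; ring.
Qed.

(** Indexing the two constraints by [bool] lets one quantifier treat both. *)
Definition r1set (R : realType) m n (A : bool -> 'M[R]_(m, n)) (b : bool -> R) :=
  rank1_set (A true) (A false) (b true) (b false).

Definition entry_bound (R : realType) m n (A : bool -> 'M[R]_(m, n)) (b : bool -> R) M :=
  forall W, r1set A b W -> forall i j, W i j <= M.

Lemma r1setP (R : realType) m n (A : bool -> 'M[R]_(m, n)) (b : bool -> R) W :
  r1set A b W <-> exists x y, [/\ forall i, 0 <= x i, forall j, 0 <= y j,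
  W = outer x y & forall k, mxdot (A k) W <= b k].
Proof.
split=> [[W0 Wt Wf rW]|[x [y [x0 y0 -> Wb]]]]; last first.
  split; [|exact: Wb|exact: Wb|exact: outer_rank].
  by move=> i j; rewrite mxE mulr_ge0.
have [[i0 [j0 w0]]|nw] := pselect (exists i j, W i j != 0); last first.
  exists (fun _ => 0), (fun _ => 0); split=> //; last by case.
  apply/matrixP => i j; rewrite mxE mulr0; apply/eqP; apply: contraT => h.
  by case: nw; exists i, j.
(* The column through a nonzero entry, and the row through it divided by that entry. *)
exists (fun i => W i j0), (fun j => W i0 j / W i0 j0); split=> //; last by case.
  by move=> j; rewrite divr_ge0.
apply/matrixP => i j; rewrite mxE.
by have := rank1_minor rW i i0 j j0 => h; field: h.
Qed.

Lemma r1set_tr (R : realType) m n (A : bool -> 'M[R]_(m, n)) (b : bool -> R) W :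
  r1set (fun k => (A k)^T) b W^T <-> r1set A b W.
Proof.
have dT k : mxdot (A k)^T W^T = mxdot (A k) W.
  rewrite /mxdot exchange_big; apply: eq_bigr => i _; apply: eq_bigr => j _.
  by rewrite !mxE.
split=> -[W0 Wt Wf rW].
  split; [|by rewrite -dT|by rewrite -dT|by rewrite -mxrank_tr] => i j.
  by have := W0 j i; rewrite mxE.
by split; [|by rewrite dT|by rewrite dT|by rewrite mxrank_tr] => i j; rewrite mxE.
Qed.

(** A direction that moves some coordinate must increase it, since a decreasing coordinate turns
    negative; an entry in that row then exceeds every bound. *)
Lemma no_ray (R : realType) m n (A : bool -> 'M[R]_(m, n)) (b : bool -> R) M y :
  entry_bound A b M -> (forall j, 0 <= y j) -> (exists j, y j != 0) ->
  forall x d, (exists i, d i != 0) -> ~ (forall t, 0 <= t ->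
    feas (fun k i => \sum_j A k i j * y j) b (fun i => x i + t * d i)).
Proof.
move=> hM y0 [j yj] x d [i di] h.
have hU t : 0 <= t -> (x i + t * d i) * y j <= M.
  move=> t0; have [h1 h2] := h t t0.
  suff /hM /(_ i j) : r1set A b (outer (fun i => x i + t * d i) y) by rewrite mxE.
  apply/r1setP; exists (fun i => x i + t * d i), y; split=> // k.
  by rewrite mxdot_outer.
have yj0 : 0 < y j by rewrite lt_neqAle eq_sym yj y0.
have x0 : 0 <= x i by have [|/(_ i)] := h 0; rewrite // mul0r addr0.
have di0 : 0 < d i.
  rewrite lt_neqAle eq_sym di /= leNgt; apply/negP => d0.
  have [|/(_ i) + _] := h ((x i + 1) / - d i).
    by rewrite divr_ge0 ?oppr_ge0 ?(ltW d0) // addr_ge0.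
  have -> : (x i + 1) / - d i * d i = - (x i + 1) by field; rewrite di.
  lra.
have M0 : 0 <= M by apply: le_trans (hU 0 (lexx _)); rewrite mul0r addr0 mulr_ge0.
have pd : 0 < d i * y j by rewrite mulr_gt0.
(* This parameter raises the entry by exactly [M + 1]. *)
have : (x i + (M + 1) / (d i * y j) * d i) * y j <= M.
  by apply: hU; rewrite divr_ge0 ?(ltW pd) // addr_ge0.
have -> : (x i + (M + 1) / (d i * y j) * d i) * y j = x i * y j + (M + 1).
  by field; rewrite yj di.
have : 0 <= x i * y j by rewrite mulr_ge0.
lra.
Qed.

(** The four shapes of a block p q^T in which both factors are vertices: one nonzero entry, two in a
    row, two in a column, four. [rowdet] is the determinant of the two constraints as linear forms
    in q for fixed p, [coldet] that in p for fixed q. *)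
Definition term2 (R : realFieldType) (a : bool -> blk R) (b : bool -> R)
    (p1 p2 q1 q2 : R) :=
  let tight := forall k, dot2 (a k) (ten p1 p2 q1 q2) = b k in
  let rowdet p1 p2 := (p1 * e11 (a true) + p2 * e21 (a true)) *
      (p1 * e12 (a false) + p2 * e22 (a false)) -
      (p1 * e12 (a true) + p2 * e22 (a true)) *
      (p1 * e11 (a false) + p2 * e21 (a false)) != 0 in
  let coldet q1 q2 := (q1 * e11 (a true) + q2 * e12 (a true)) *
      (q1 * e21 (a false) + q2 * e22 (a false)) -
      (q1 * e21 (a true) + q2 * e22 (a true)) *
      (q1 * e11 (a false) + q2 * e12 (a false)) != 0 in
  [\/ [/\ p1 = 1, p2 = 0, 0 < q1 & q2 = 0 /\
         exists k, e11 (a k) != 0 /\ dot2 (a k) (ten p1 p2 q1 q2) = b k],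
      [/\ p1 = 1 /\ p2 = 0, 0 < q1 /\ 0 < q2, tight & rowdet p1 p2],
      [/\ 0 < p1 /\ 0 < p2, q1 = 1 /\ q2 = 0, tight & coldet q1 q2] |
      [/\ 0 < p1 /\ 0 < p2, 0 < q1 /\ 0 < q2, tight,
          rowdet p1 p2 & coldet q1 q2]].

Section Reduction.
Variables (R : realType) (m n : nat) (A : bool -> 'M[R]_(m, n)) (b : bool -> R).
Variable M : R.
Hypothesis bdU : entry_bound A b M.
Local Notation U := (r1set A b).

Let uu y k i := \sum_j A k i j * y j.
Let vv x k j := \sum_i A k i j * x i.

Lemma entry_bound_tr : entry_bound (fun k => (A k)^T) b M.
Proof.
by move=> W; rewrite -[W]trmxK => /r1set_tr /bdU h i j; rewrite mxE.
Qed.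

Lemma mxdot_tight x y k : mxdot (A k) (outer x y) = \sum_i x i * uu y k i.
Proof. exact: mxdot_outer. Qed.

Lemma mxdot_tightC x y k : mxdot (A k) (outer x y) = \sum_j y j * vv x k j.
Proof. exact: mxdot_outerC. Qed.

(** Each rigid factor has one or two nonzero coordinates, which gives the four shapes. When a factor
    has a single one, it is normalized to 1 and its value is moved into the other factor; this
    changes the determinant by a square. *)
Lemma terminal_term2 x y : U (outer x y) ->
  (forall i, 0 <= x i) -> (forall j, 0 <= y j) ->
  (exists i, x i != 0) -> (exists j, y j != 0) ->
  rigid (uu y) b x -> rigid (vv x) b y ->
  exists i i' j j' p1 p2 q1 q2,
    outer x y = embed i i' j j' (ten p1 p2 q1 q2) /\
    term2 (fun k => subblk (A k) i i' j j') b p1 p2 q1 q2.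
Proof.
move=> Uxy x0 y0 xn yn rx ry.
have pos (I : Type) (z : I -> R) i : (forall i, 0 <= z i) -> z i != 0 -> 0 < z i.
  by move=> z0 zi; rewrite lt_neqAle eq_sym zi z0.
case: (rigid_cases rx xn) => [[i [k [xi xs tk uk]]]|[i [i' [[ii' [xi xi']] xs tx ux]]]];
case: (rigid_cases ry yn) => [[j [l [yj ys tl vl]]]|[j [j' [[jj' [yj yj']] ys ty vy]]]].
- have W1 : outer x y = embed i i j j (ten 1 0 (x i * y j) 0).
    rewrite /embed /=; apply/matrixP => r c; rewrite !mxE.
    have [->|ri] := eqVneq r i; last by rewrite xs // !(mulr0, mul0r, addr0).
    have [->|cj] := eqVneq c j; last by rewrite ys // !(mulr0, mul0r, addr0).
    by rewrite !(mulr0, mul0r, addr0) mulr1 mul1r.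
  exists i, i, j, j, 1, 0, (x i * y j), 0; split=> //.
  constructor 1; split=> //; first by rewrite mulr_gt0 // pos.
  split=> //; exists k; split=> /=; last first.
    by rewrite -tk -mxdot_tight W1 mxdot_embed.
  apply: contraNneq uk => aij; rewrite /uu (bigD1 j) //= aij mul0r add0r.
  by rewrite big1 // => c cj; rewrite ys // mulr0.
- have W1 : outer x y = embed i i j j' (ten 1 0 (x i * y j) (x i * y j')).
    rewrite /embed /=; apply/matrixP => r c; rewrite !mxE.
    have [->|ri] := eqVneq r i; last by rewrite xs // !(mulr0, mul0r, addr0).
    have [->|cj] := eqVneq c j; first by rewrite (negPf jj') !(mulr0, mul0r, addr0) mulr1 mul1r.
    have [->|cj'] := eqVneq c j'; first by rewrite !(mulr0, mul0r, addr0, add0r) mulr1 mul1r.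
    by rewrite ys // !(mulr0, mul0r, addr0).
  exists i, i, j, j', 1, 0, (x i * y j), (x i * y j'); split=> //.
  have vE k' c : vv x k' c = A k' i c * x i.
    by rewrite /vv (bigD1 i) //= big1 ?addr0 // => r ri; rewrite xs // mulr0.
  constructor 2; split=> //; first by rewrite !mulr_gt0 // pos.
    by move=> k'; rewrite -mxdot_embed -W1 mxdot_tightC ty.
  apply: contraNneq vy => /= h; rewrite !vE.
  apply/eqP; transitivity ((x i) ^+ 2 * 0); last by rewrite mulr0.
  by rewrite -h; ring.
- have W1 : outer x y = embed i i' j j (ten (x i * y j) (x i' * y j) 1 0).
    rewrite /embed /=; apply/matrixP => r c; rewrite !mxE.
    have [->|cj] := eqVneq c j; last by rewrite ys // !(andbF, mulr0, mul0r, addr0).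
    have [->|ri] := eqVneq r i; first by rewrite (negPf ii') !(mulr0, mul0r, addr0) !mulr1.
    have [->|ri'] := eqVneq r i'; first by rewrite !(mulr0, mul0r, addr0, add0r) !mulr1.
    by rewrite xs // !(mulr0, mul0r, addr0).
  exists i, i', j, j, (x i * y j), (x i' * y j), 1, 0; split=> //.
  have uE k' r : uu y k' r = A k' r j * y j.
    by rewrite /uu (bigD1 j) //= big1 ?addr0 // => c cj; rewrite ys // mulr0.
  constructor 3; split=> //; first by rewrite !mulr_gt0 // pos.
    by move=> k'; rewrite -mxdot_embed -W1 mxdot_tight tx.
  apply: contraNneq ux => /= h; rewrite !uE.
  apply/eqP; transitivity ((y j) ^+ 2 * 0); last by rewrite mulr0.
  by rewrite -h; ring.
have W1 : outer x y = embed i i' j j' (ten (x i) (x i') (y j) (y j')).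
  rewrite embed_ten; apply/matrixP => r c; rewrite !mxE; congr (_ * _).
    have [->|ri] := eqVneq r i; first by rewrite (negPf ii') mulr1n mulr0n addr0.
    have [->|ri'] := eqVneq r i'; first by rewrite mulr1n mulr0n add0r.
    by rewrite xs // !mulr0n addr0.
  have [->|ri] := eqVneq c j; first by rewrite (negPf jj') mulr1n mulr0n addr0.
  have [->|ri'] := eqVneq c j'; first by rewrite mulr1n mulr0n add0r.
  by rewrite ys // !mulr0n addr0.
exists i, i', j, j', (x i), (x i'), (y j), (y j'); split=> //.
have uE k r : uu y k r = A k r j * y j + A k r j' * y j'.
  rewrite /uu (bigD1 j) //= (bigD1 j') ?(eq_sym j') //= big1 ?addr0 //.
  by move=> c /andP[cj cj']; rewrite ys // mulr0.
have vE k c : vv x k c = A k i c * x i + A k i' c * x i'.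
  rewrite /vv (bigD1 i) //= (bigD1 i') ?(eq_sym i') //= big1 ?addr0 //.
  by move=> r /andP[ri ri']; rewrite xs // mulr0.
constructor 4; split; rewrite ?pos //.
- by move=> k; rewrite -mxdot_embed -W1 mxdot_tight tx.
- by apply: contraNneq vy => /= h; rewrite !vE -h; apply/eqP; ring.
- by apply: contraNneq ux => /= h; rewrite !uE -h; apply/eqP; ring.
Qed.

(** Induction on the number of nonzero coordinates of both factors plus the number of slack
    constraints: this single count decreases whichever factor is split. Splitting the second factor
    rests on the bound for the transposed data. *)
Theorem reduction (S : set 'M[R]_(m, n)) :
  (forall V W t, 0 <= t <= 1 -> S V -> S W -> S (t *: V + (1 - t) *: W)) ->
  (U 0 -> S 0) ->
  (forall i i' j j' p1 p2 q1 q2,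
     term2 (fun k => subblk (A k) i i' j j') b p1 p2 q1 q2 ->
     U (embed i i' j j' (ten p1 p2 q1 q2)) ->
     S (embed i i' j j' (ten p1 p2 q1 q2))) ->
  U `<=` S.
Proof.
move=> cS S0 St W /r1setP[x [y [x0 y0 -> Wb]]].
have [N leN] := ubnP (#|[pred i | x i != 0%R]| + #|[pred j | y j != 0%R]| +
  #|[pred k | mxdot (A k) (outer x y) != b k]|)%N.
elim: N x y x0 y0 Wb leN => // N IH x y x0 y0 Wb leN.
have Uxy : U (outer x y) by apply/r1setP; exists x, y.
have Uz : outer x y = 0 -> S (outer x y).
  by move=> h; move: Uxy; rewrite h => /S0.
have [xn|nx] := pselect (exists i, x i != 0); last first.
  apply: Uz; apply/matrixP => i j; rewrite !mxE; have [->|h] := eqVneq (x i) 0.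
    by rewrite mul0r.
  by case: nx; exists i.
have [yn|ny] := pselect (exists j, y j != 0); last first.
  apply: Uz; apply/matrixP => i j; rewrite !mxE; have [->|h] := eqVneq (y j) 0.
    by rewrite mulr0.
  by case: ny; exists j.
have fx : feas (uu y) b x by split=> // k; rewrite -mxdot_tight.
have fy : feas (vv x) b y by split=> // k; rewrite -mxdot_tightC.
have vpx z : slack_count (uu y) b z = (#|[pred i | z i != 0%R]| +
    #|[pred k | mxdot (A k) (outer z y) != b k]|)%N.
  by congr addn; apply: eq_card => k; rewrite !inE mxdot_tight.
have vpy z : slack_count (vv x) b z = (#|[pred j | z j != 0%R]| +
    #|[pred k | mxdot (A k) (outer x z) != b k]|)%N.
  by congr addn; apply: eq_card => k; rewrite !inE mxdot_tightC.
have [rx|nrx] := pselect (rigid (uu y) b x); last first.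
  have [|x1 [x2 [t [[f1 p1] [f2 p2] t01 xE]]]] := feas_split fx nrx.
    exact: (no_ray bdU y0 yn).
  have step z : feas (uu y) b z -> (slack_count (uu y) b z < slack_count (uu y) b x)%N ->
      S (outer z y).
    move=> [z0 fz] pz; apply: IH => // [k|]; first by rewrite mxdot_tight.
    rewrite ltnS in leN; apply: leq_trans leN.
    by rewrite addnAC [ltnRHS]addnAC ltn_add2r -!vpx.
  have -> : outer x y = t *: outer x1 y + (1 - t) *: outer x2 y.
    by apply/matrixP => i j; rewrite !mxE xE; ring.
  by apply: cS => //; apply: step.
have [ry|nry] := pselect (rigid (vv x) b y); last first.
  have [|y1 [y2 [t [[f1 p1] [f2 p2] t01 yE]]]] := feas_split fy nry.
    move=> d dn h; apply: (no_ray entry_bound_tr x0 xn dn) => t t0.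
    have [h1 h2] := h t t0; split=> // k; rewrite -[leRHS]/(b k).
    apply: le_trans (h2 k); rewrite le_eqVlt; apply/orP; left; apply/eqP.
    apply: eq_bigr => j _; congr (_ * _); apply: eq_bigr => i _.
    by rewrite mxE.
  have step z : feas (vv x) b z -> (slack_count (vv x) b z < slack_count (vv x) b y)%N ->
      S (outer x z).
    move=> [z0 fz] pz; apply: IH => // [k|]; first by rewrite mxdot_tightC.
    rewrite ltnS in leN; apply: leq_trans leN.
    by rewrite -!addnA ltn_add2l -!vpy.
  have -> : outer x y = t *: outer x y1 + (1 - t) *: outer x y2.
    by apply/matrixP => i j; rewrite !mxE yE; ring.
  by apply: cS => //; apply: step.
have [i [i' [j [j' [p1 [p2 [q1 [q2 [E T]]]]]]]]] :=
  terminal_term2 Uxy x0 y0 xn yn rx ry.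
by rewrite E; apply: St => //; rewrite -E.
Qed.

End Reduction.

(** * Arcs of blocks on which both constraints are tight *)

Section ArcDefs.
Variables (K : comNzRingType) (a : bool -> blk K) (b : bool -> K).

(* [cross] annihilates every block on which both constraints are tight. *)
Definition cross := Blk
  (b false * e11 (a true) - b true * e11 (a false))
  (b false * e12 (a true) - b true * e12 (a false))
  (b false * e21 (a true) - b true * e21 (a false))
  (b false * e22 (a true) - b true * e22 (a false)).

(** [cross] pairs with p q^T to [g1 p * q1 + g2 p * q2]. If this vanishes and the two forms do not
    both vanish at p, then q is a multiple of [(g2 p, - g1 p)], whence [arcdir]. *)
Definition g1 p1 p2 := e11 cross * p1 + e21 cross * p2.
Definition g2 p1 p2 := e12 cross * p1 + e22 cross * p2.

Definition arcdir p1 p2 := ten p1 p2 (g2 p1 p2) (- g1 p1 p2).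

Definition sqnorm := b true ^+ 2 + b false ^+ 2.

(** The values of the two constraints on [arcdir] are proportional to [b]. Pairing them with [b]
    gives a scale, [sqnorm / den], that makes both tight, without distinguishing which [b k] is
    nonzero. *)
Definition den p1 p2 := b true * dot2 (a true) (arcdir p1 p2) +
  b false * dot2 (a false) (arcdir p1 p2).

(** If it is nonzero, the linear map from p to [(g1 p, g2 p)] is injective. *)
Definition detc := e11 cross * e22 cross - e12 cross * e21 cross.

Lemma arcdir_dot k p1 p2 : sqnorm * dot2 (a k) (arcdir p1 p2) = b k * den p1 p2.
Proof.
case: k; rewrite /sqnorm /den /arcdir /g1 /g2 /cross /dot2 /ten /=; ring.
Qed.

Lemma den_line p1 p2 d1 d2 t : den (p1 + t * d1) (p2 + t * d2) =
  den p1 p2 + t * (den (p1 + d1) (p2 + d2) - den p1 p2 - den d1 d2)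
  + t ^+ 2 * den d1 d2.
Proof. rewrite /den /arcdir /g1 /g2 /dot2 /ten /=; ring. Qed.

End ArcDefs.

Lemma horner_quad (K : comNzRingType) (c0 c1 c2 t : K) :
  (c0%:P + c1%:P * 'X + c2%:P * 'X^2).[t] = c0 + c1 * t + c2 * t ^+ 2.
Proof. by rewrite !hornerE; ring. Qed.

Section Arc.
Variables (R : rcfType) (a : bool -> blk R) (b : bool -> R).
Local Notation g1 := (g1 a b).
Local Notation g2 := (g2 a b).
Local Notation den := (den a b).
Local Notation sqnorm := (sqnorm b).
Local Notation detc := (detc a b).

Definition feas2 p1 p2 q1 q2 := [/\ 0 <= p1 /\ 0 <= p2, 0 <= q1 /\ 0 <= q2 &
  forall k, dot2 (a k) (ten p1 p2 q1 q2) <= b k].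

Definition arcpoint p1 p2 q1 q2 rho :=
  [/\ 0 < p1 /\ 0 < p2, 0 < q1 /\ 0 < q2, q1 = rho * g2 p1 p2,
      q2 = - (rho * g1 p1 p2) & [/\ rho * den p1 p2 = sqnorm, 0 < sqnorm & detc != 0]].

(** Cramer's rule: with [r] the row determinant, [r * q1 = - g2] and [r * q2 = g1], so the scale is
    [- r^-1]. Likewise [c * p2] is a multiple of [detc], so [detc = 0] would contradict the nonzero
    column determinant [c]. *)
Lemma term4_arcpoint p1 p2 q1 q2 :
  0 < p1 /\ 0 < p2 -> 0 < q1 /\ 0 < q2 ->
  (forall k, dot2 (a k) (ten p1 p2 q1 q2) = b k) ->
  (p1 * e11 (a true) + p2 * e21 (a true)) *
      (p1 * e12 (a false) + p2 * e22 (a false)) -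
      (p1 * e12 (a true) + p2 * e22 (a true)) *
      (p1 * e11 (a false) + p2 * e21 (a false)) != 0 ->
  (q1 * e11 (a true) + q2 * e12 (a true)) *
      (q1 * e21 (a false) + q2 * e22 (a false)) -
      (q1 * e21 (a true) + q2 * e22 (a true)) *
      (q1 * e11 (a false) + q2 * e12 (a false)) != 0 ->
  exists rho, arcpoint p1 p2 q1 q2 rho.
Proof.
move=> pp qq tight rd cd.
set r := (X in X != 0) in rd; set c := (X in X != 0) in cd.
have bt := tight true; have bf := tight false.
rewrite /dot2 /= in bt bf.
have q1E : r * q1 = - g2 p1 p2 by rewrite /r /g2 /= -bt -bf; ring.
have q2E : r * q2 = g1 p1 p2 by rewrite /r /g1 /= -bt -bf; ring.
have p2E : c * p2 = e11 (cross a b) * q1 + e12 (cross a b) * q2.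
  by rewrite /c /= -bt -bf; ring.
have q1R : q1 = - r^-1 * g2 p1 p2 by rewrite -[LHS](mulKf rd) q1E; ring.
have q2R : q2 = - (- r^-1 * g1 p1 p2) by rewrite -[LHS](mulKf rd) q2E; ring.
exists (- r^-1); split=> //; split.
- transitivity (b true * dot2 (a true) (ten p1 p2 q1 q2) +
                b false * dot2 (a false) (ten p1 p2 q1 q2)).
    by rewrite q1R q2R /den /arcdir /dot2 /ten /=; ring.
  by rewrite !tight /sqnorm; ring.
- rewrite lt_neqAle /sqnorm addr_ge0 ?sqr_ge0 // andbT eq_sym.
  rewrite paddr_eq0 ?sqr_ge0 // !sqrf_eq0; apply/negP => /andP[/eqP b1 /eqP b2].
  have : r * q1 = 0 by rewrite q1E /g2 /= b1 b2; ring.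
  by move/eqP; rewrite mulf_eq0 (negPf rd) /= gt_eqF //; case: qq.
apply/eqP => dc.
have : c * p2 = - r^-1 * p2 * detc.
  by rewrite p2E q1R q2R /g1 /g2 /detc; ring.
rewrite dc mulr0 => /eqP; rewrite mulf_eq0 (negPf cd) /= gt_eqF //.
by case: pp.
Qed.

(** The nonnegative p for which q, taken with a scale of sign [s], is nonnegative too. *)
Definition cone s p1 p2 :=
  [/\ 0 <= p1, 0 <= p2, 0 <= s * g2 p1 p2 & 0 <= - (s * g1 p1 p2)].

Definition sgn1 (s : R) := s = 1 \/ s = -1.

Lemma feas2_arc s p1 p2 : sgn1 s -> 0 < sqnorm -> cone s p1 p2 -> 0 < s * den p1 p2 ->
  let t := sqnorm / den p1 p2 in
  feas2 p1 p2 (t * g2 p1 p2) (- (t * g1 p1 p2)) /\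
  forall k, dot2 (a k) (ten p1 p2 (t * g2 p1 p2) (- (t * g1 p1 p2))) = b k.
Proof.
move=> s1 bb0 [p10 p20 g20 g10] sd t.
have ss : s * s = 1 by case: s1 => ->; ring.
have d0 : den p1 p2 != 0.
  by apply/eqP => d0; rewrite d0 mulr0 ltxx in sd.
have tE : t = sqnorm / (s * den p1 p2) * s.
  rewrite /t; have sn : s != 0 by apply/eqP => h; rewrite h mul0r ltxx in sd.
  by field; rewrite d0.
have t0 : 0 <= sqnorm / (s * den p1 p2) by rewrite divr_ge0 // ltW.
have tight k : dot2 (a k) (ten p1 p2 (t * g2 p1 p2) (- (t * g1 p1 p2))) = b k.
  have -> : dot2 (a k) (ten p1 p2 (t * g2 p1 p2) (- (t * g1 p1 p2))) =
    (sqnorm * dot2 (a k) (arcdir a b p1 p2)) / den p1 p2.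
    by rewrite /dot2 /arcdir /ten /t /=; ring.
  by rewrite arcdir_dot; field; rewrite d0.
split=> //; split=> //; last by move=> k; rewrite tight.
rewrite tE; split; first by rewrite -mulrA; apply: mulr_ge0.
by rewrite -mulrA -mulrN; apply: mulr_ge0.
Qed.

Definition bound2 M := forall p1 p2 q1 q2, feas2 p1 p2 q1 q2 ->
  (p1 + p2) * (q1 + q2) <= M.

(** By injectivity of p => [(g1 p, g2 p)], a nonzero p in the cone has a nonzero companion q. *)
Lemma mass_gt0 s p1 p2 : sgn1 s -> detc != 0 -> cone s p1 p2 -> 0 < p1 + p2 ->
  0 < s * g2 p1 p2 - s * g1 p1 p2.
Proof.
move=> s1 dc [p10 p20 g20 g10] pp; rewrite lt_neqAle eq_sym addr_ge0 // andbT.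
rewrite paddr_eq0 //; apply/negP => /andP[/eqP h2 /eqP h1].
have sn : s != 0 by case: s1 => ->; rewrite ?oppr_eq0 oner_eq0.
move/eqP: h2; rewrite mulf_eq0 (negPf sn) /= => /eqP h2.
move/eqP: h1; rewrite oppr_eq0 mulf_eq0 (negPf sn) /= => /eqP h1.
have p1E : detc * p1 = 0.
  have -> : detc * p1 = e22 (cross a b) * g1 p1 p2 - e21 (cross a b) * g2 p1 p2.
    by rewrite /detc /g1 /g2; ring.
  by rewrite h1 h2; ring.
have p2E : detc * p2 = 0.
  have -> : detc * p2 = e11 (cross a b) * g2 p1 p2 - e12 (cross a b) * g1 p1 p2.
    by rewrite /detc /g1 /g2; ring.
  by rewrite h1 h2; ring.
move/eqP: p1E; rewrite mulf_eq0 (negPf dc) /= => /eqP p1E.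
move/eqP: p2E; rewrite mulf_eq0 (negPf dc) /= => /eqP p2E.
by rewrite p1E p2E addr0 ltxx in pp.
Qed.

Lemma cone_comb s p1 p2 r1 r2 x y : cone s p1 p2 -> cone s r1 r2 ->
  0 <= x -> 0 <= y -> cone s (x * p1 + y * r1) (x * p2 + y * r2).
Proof.
move=> [h1 h2 h3 h4] [k1 k2 k3 k4] x0 y0.
split; first by rewrite addr_ge0 // mulr_ge0.
- by rewrite addr_ge0 // mulr_ge0.
- have -> : s * g2 (x * p1 + y * r1) (x * p2 + y * r2) =
    x * (s * g2 p1 p2) + y * (s * g2 r1 r2) by rewrite /g2; ring.
  by rewrite addr_ge0 // mulr_ge0.
have -> : - (s * g1 (x * p1 + y * r1) (x * p2 + y * r2)) =
    x * - (s * g1 p1 p2) + y * - (s * g1 r1 r2) by rewrite /g1; ring.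
by rewrite addr_ge0 // mulr_ge0.
Qed.

(* While [den] is positive on the arc it stays away from 0, because the
   matrices [sqnorm / den *: arcdir] are bounded. *)
Lemma den_gt0 M s p1 p2 r1 r2 : bound2 M -> sgn1 s -> detc != 0 -> 0 < sqnorm ->
  cone s p1 p2 -> cone s r1 r2 -> 0 < p1 + p2 -> 0 < r1 + r2 ->
  0 < s * den p1 p2 -> 0 < s * den r1 r2.
Proof.
move=> bM s1 dc bb0 cp cr pp rr dp.
rewrite ltNge; apply/negP => dr.
pose x t := p1 + t * (r1 - p1); pose y t := p2 + t * (r2 - p2).
pose L z1 z2 := s * g2 z1 z2 - s * g1 z1 z2.
have Lp : 0 < L p1 p2 by apply: mass_gt0.
have Lr : 0 < L r1 r2 by apply: mass_gt0.
(* Both factors of the mass are affine along the segment, hence bounded below by their values at its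
   ends. *)
pose mu := Num.min (p1 + p2) (r1 + r2) * Num.min (L p1 p2) (L r1 r2).
have mu0 : 0 < mu by rewrite mulr_gt0 // lt_min ?pp ?Lp.
have conet t : 0 <= t -> t <= 1 -> cone s (x t) (y t).
  move=> t0 t1.
  have -> : x t = (1 - t) * p1 + t * r1 by rewrite /x; ring.
  have -> : y t = (1 - t) * p2 + t * r2 by rewrite /y; ring.
  by apply: cone_comb => //; lra.
have mint (u v t : R) : 0 <= t -> t <= 1 -> Num.min u v <= u + t * (v - u).
  move=> t0 t1; rewrite ge_min; case: (leP u v) => uv.
    by rewrite lerDl mulr_ge0 // subr_ge0.
  by apply/orP; right; nra.
(* The mass of the tight block is [sqnorm / den] times the product of the two factors; bounding it
   by [M] bounds [den] below. *)
have low t : 0 <= t -> t <= 1 -> 0 < s * den (x t) (y t) ->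
    sqnorm * mu <= M * (s * den (x t) (y t)).
  move=> t0 t1 dt.
  have [/bM h _] := feas2_arc s1 bb0 (conet t t0 t1) dt.
  have ss : s * s = 1 by case: s1 => ->; ring.
  have sn : s != 0 by apply/eqP => e; rewrite e mul0r ltxx in dt.
  have d0 : den (x t) (y t) != 0 by apply/eqP => e; rewrite e mulr0 ltxx in dt.
  have e : M * (s * den (x t) (y t)) >= sqnorm * ((x t + y t) * L (x t) (y t)).
    rewrite -ler_pdivrMr //; apply: le_trans h.
    rewrite le_eqVlt; apply/orP; left; apply/eqP.
    rewrite /L; transitivity ((x t + y t) * (sqnorm / den (x t) (y t) *
      (g2 (x t) (y t) - g1 (x t) (y t)))); last by ring.
    by field; rewrite d0.
  apply: le_trans e; rewrite ler_wpM2l ?(ltW bb0) //.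
  apply: ler_pM; rewrite ?le_min ?(ltW pp) ?(ltW rr) ?(ltW Lp) ?(ltW Lr) //.
    have -> : x t + y t = (p1 + p2) + t * ((r1 + r2) - (p1 + p2)).
      by rewrite /x /y; ring.
    exact: mint.
  have -> : L (x t) (y t) = L p1 p2 + t * (L r1 r2 - L p1 p2).
    by rewrite /L /g1 /g2 /x /y; ring.
  exact: mint.
have x0 : x 0 = p1 by rewrite /x; ring.
have y0 : y 0 = p2 by rewrite /y; ring.
have x1 : x 1 = r1 by rewrite /x; ring.
have y1 : y 1 = r2 by rewrite /y; ring.
have M0 : 0 < M.
  have := low 0 (lexx _) ler01; rewrite x0 y0 => /(_ dp) h.
  have : 0 < M * (s * den p1 p2) by apply: lt_le_trans h; rewrite mulr_gt0.
  by rewrite pmulr_lgt0.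
pose dl := sqnorm * mu / M.
have dl0 : 0 < dl by rewrite !divr_gt0 // mulr_gt0.
have lowd t : 0 <= t -> t <= 1 -> 0 < s * den (x t) (y t) ->
    dl <= s * den (x t) (y t).
  by move=> t0 t1 /(low t t0 t1); rewrite /dl ler_pdivrMr // [_ * M]mulrC.
(* If [s * den] were nonpositive at the far end, it would take the value [dl / 2] on the segment,
   below its lower bound [dl] where positive. *)
pose F : {poly R} := (dl / 2 - s * den p1 p2)%:P
  + (- (s * (den (p1 + (r1 - p1)) (p2 + (r2 - p2)) - den p1 p2
             - den (r1 - p1) (r2 - p2))))%:P * 'X
  + (- (s * den (r1 - p1) (r2 - p2)))%:P * 'X^2.
have FE t : F.[t] = dl / 2 - s * den (x t) (y t).
  by rewrite /F horner_quad /x /y den_line; ring.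
have [|t /andP[t0 t1]] := @poly_ivt R F 0 1 ler01.
  rewrite !FE x0 y0 x1 y1; apply/andP; split.
    have := lowd 0 (lexx _) ler01; rewrite x0 y0 => /(_ dp); lra.
  lra.
rewrite /root FE => /eqP e.
have h : s * den (x t) (y t) = dl / 2 by lra.
have := lowd t t0 t1; rewrite h; lra.
Qed.

Definition arc_span s e1 e2 f1 f2 :=
  [/\ cone s e1 e2, cone s f1 f2, 0 < e1 * f2 - e2 * f1,
   (forall l m, 0 <= l -> 0 <= m -> 0 < l + m ->
     0 < s * den (l * e1 + m * f1) (l * e2 + m * f2)) &
   (forall z1 z2, cone s z1 z2 -> exists l m,
     [/\ 0 <= l, 0 <= m, z1 = l * e1 + m * f1 & z2 = l * e2 + m * f2])].

(** In terms of the block: a coordinate of p or of q vanishes. *)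
Definition bdry z1 z2 := [\/ z1 = 0, z2 = 0, g2 z1 z2 = 0 | g1 z1 z2 = 0].

(** From the interior point p, walking along [(p1, - p2)] and along [(- p1, p2)] until one of the
    four linear forms of the cone vanishes reaches its two extreme rays. *)
Lemma arc_exists M p1 p2 q1 q2 rho : bound2 M -> arcpoint p1 p2 q1 q2 rho ->
  exists s e1 e2 f1 f2, [/\ sgn1 s, 0 < s * rho, arc_span s e1 e2 f1 f2,
    bdry e1 e2 /\ bdry f1 f2 &
    exists l m, [/\ 0 < l, 0 < m, p1 = l * e1 + m * f1 & p2 = l * e2 + m * f2]].
Proof.
move=> bM [[p10 p20] [q10 q20] q1E q2E [rd bb0 dc]].
have rho0 : rho != 0 by apply: contraTneq q10 => r0; rewrite q1E r0 mul0r ltxx.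
pose s := Num.sg rho.
have s1 : sgn1 s.
  rewrite /s; case: (ltrgtP rho 0) rho0 => // r _; [right|left].
    by rewrite ltr0_sg.
  by rewrite gtr0_sg.
have srho : 0 < s * rho by rewrite /s -normrEsg normr_gt0.
have ss : s * s = 1 by case: s1 => ->; ring.
(* The four forms that define the cone, as one family for the ratio test. *)
pose l (i : bool * bool) z1 z2 := match i with
  | (true, true) => z1 | (true, false) => z2
  | (false, true) => s * g2 z1 z2 | (false, false) => - (s * g1 z1 z2) end.
have llin i x y u1 u2 v1 v2 : l i (x * u1 + y * v1) (x * u2 + y * v2) =
    x * l i u1 u2 + y * l i v1 v2.
  by case: i => [[] []] //=; rewrite /g1 /g2; ring.
have lp i : 0 < l i p1 p2.
  case: i => [[] []] //=.
    by rewrite -(pmulr_rgt0 _ srho) mulrACA ss mul1r -q1E.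
  by rewrite -(pmulr_rgt0 _ srho) mulrN mulrACA ss mul1r -q2E.
have coneE z1 z2 : (forall i, 0 <= l i z1 z2) -> cone s z1 z2.
  by move=> h; split; [exact: (h (true, true)) | exact: (h (true, false))
    | exact: (h (false, true)) | exact: (h (false, false))].
have coneI z1 z2 : cone s z1 z2 -> forall i, 0 <= l i z1 z2.
  by case=> h1 h2 h3 h4 [[] []].
have cp : cone s p1 p2 by apply: coneE => i; apply: ltW.
have sn : s != 0 by apply: contraTneq srho => r0; rewrite r0 mul0r ltxx.
have bdryE i z1 z2 : l i z1 z2 = 0 -> bdry z1 z2.
  case: i => [[] []] /= h; [by constructor 1|by constructor 2| |].
    by constructor 3; apply/eqP; move/eqP: h; rewrite mulf_eq0 (negPf sn).
  constructor 4; apply/eqP; move/eqP: h.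
  by rewrite oppr_eq0 mulf_eq0 (negPf sn).
have dp : 0 < s * den p1 p2.
  by rewrite -(pmulr_rgt0 _ srho) mulrACA ss mul1r rd.
have stepl i t : l i (p1 + t * p1) (p2 + t * - p2) = l i p1 p2 + t * l i p1 (- p2).
  by have := llin i 1 t p1 p2 p1 (- p2); rewrite !mul1r.
have stepr i t : l i (p1 + t * - p1) (p2 + t * p2) = l i p1 p2 + t * l i (- p1) p2.
  by have := llin i 1 t p1 p2 (- p1) p2; rewrite !mul1r.
have [|||t t0 [te [i1 _ tz]]] := @ratio_test R (bool * bool)%type
    (fun i => l i p1 p2) (fun i => l i p1 (- p2)).
- by move=> i; apply: ltW.
- by move=> i h; have := lp i; rewrite h ltxx.
- by exists (true, false); rewrite /= oppr_lt0.
have [|||r r0 [re [i2 _ rz]]] := @ratio_test R (bool * bool)%type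
    (fun i => l i p1 p2) (fun i => l i (- p1) p2).
- by move=> i; apply: ltW.
- by move=> i h; have := lp i; rewrite h ltxx.
- by exists (true, true); rewrite /= oppr_lt0.
pose e1 := p1 + t * p1; pose e2 := p2 + t * - p2.
pose f1 := p1 + r * - p1; pose f2 := p2 + r * p2.
have le i' : 0 <= l i' e1 e2 by rewrite stepl.
have lf i' : 0 <= l i' f1 f2 by rewrite stepr.
have le1 : l i1 e1 e2 = 0 by rewrite stepl.
have lf2 : l i2 f1 f2 = 0 by rewrite stepr.
have ce : cone s e1 e2 by apply: coneE.
have cf : cone s f1 f2 by apply: coneE.
have tr : 0 < t + r by rewrite addr_gt0.
have trn : t + r != 0 by rewrite gt_eqF.
have p1E : p1 = r / (t + r) * e1 + t / (t + r) * f1.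
  by rewrite /e1 /f1; field.
have p2E : p2 = r / (t + r) * e2 + t / (t + r) * f2.
  by rewrite /e2 /f2; field.
have r0' : 0 < r / (t + r) by rewrite divr_gt0.
have t0' : 0 < t / (t + r) by rewrite divr_gt0.
have lfi : 0 < l i1 f1 f2.
  have := lp i1; rewrite p1E p2E llin le1 mulr0 add0r => h.
  by rewrite -(pmulr_rgt0 _ t0').
have lei : 0 < l i2 e1 e2.
  have := lp i2; rewrite p1E p2E llin lf2 mulr0 addr0 => h.
  by rewrite -(pmulr_rgt0 _ r0').
have dlt : 0 < e1 * f2 - e2 * f1.
  have -> : e1 * f2 - e2 * f1 = (t + r) *+ 2 * (p1 * p2).
    by rewrite /e1 /e2 /f1 /f2; ring.
  by rewrite mulr_gt0 ?pmulrn_lgt0 // mulr_gt0.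
exists s, e1, e2, f1, f2; split=> //; last first.
- by exists (r / (t + r)), (t / (t + r)).
- by split; [apply: (bdryE i1) | apply: (bdryE i2)].
have sume : 0 < e1 + e2.
  have [h1 h2] : 0 < e1 /\ 0 <= e2.
    by split; [rewrite /e1 addr_gt0 // mulr_gt0|exact: (le (true, false))].
  by rewrite ltr_wpDr.
have sumf : 0 < f1 + f2.
  have [h1 h2] : 0 <= f1 /\ 0 < f2.
    by split; [exact: (lf (true, true))|rewrite /f2 addr_gt0 // mulr_gt0].
  by rewrite ltr_wpDl.
split=> //.
  move=> x y x0 y0 xy.
  apply: (den_gt0 bM s1 dc bb0 cp) => //; last 2 first.
  - by rewrite addr_gt0.
  - have -> : x * e1 + y * f1 + (x * e2 + y * f2) =
      x * (e1 + e2) + y * (f1 + f2) by ring.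
    have [xz|xn] := eqVneq x 0.
      by move: xy; rewrite xz add0r mul0r add0r => y0'; apply: mulr_gt0.
    rewrite ltr_wpDr //; first by rewrite mulr_ge0 // ltW.
    by rewrite mulr_gt0 // lt_neqAle eq_sym xn.
  exact: cone_comb.
move=> z1 z2 cz.
pose dd := e1 * f2 - e2 * f1.
(* Coordinates in the basis e, f. The form that vanishes at f is positive at e, so its sign at z is
   that of the e-coordinate; likewise for f. *)
have dn : dd != 0 by rewrite gt_eqF.
pose x := (z1 * f2 - z2 * f1) / dd; pose y := (e1 * z2 - e2 * z1) / dd.
have z1E : z1 = x * e1 + y * f1 by rewrite /x /y /dd; field.
have z2E : z2 = x * e2 + y * f2 by rewrite /x /y /dd; field.
exists x, y; split=> //.
  by have := coneI _ _ cz i2; rewrite z1E z2E llin lf2 mulr0 addr0 pmulr_lge0.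
by have := coneI _ _ cz i1; rewrite z1E z2E llin le1 mulr0 add0r pmulr_lge0.
Qed.

End Arc.

(** * Second-order cone representability of the hull *)

Section Representability.
Variable R : realType.

(** Linearity as a predicate on plain functions applies directly to the anonymous functions used
    below. *)
Definition linf (E : lmodType R) (f : E -> R) :=
  forall t x y, f (t *: x + y) = t * f x + f y.

Definition linm (E F : lmodType R) (f : E -> F) :=
  forall t x y, f (t *: x + y) = t *: f x + f y.

Lemma linf_sum (E : lmodType R) (f : E -> R) : linf f ->
  forall (I : finType) (t : I -> R) (x : I -> E),
    f (\sum_i t i *: x i) = \sum_i t i * f (x i).
Proof.
move=> fl I t x.
have f0 : f 0 = 0.
  by have := fl 1 0 0; rewrite scaler0 add0r mul1r => h; lra.
by apply: (big_ind2 (fun u v => f u = v)) => // [u _ v _ <- <-|i _];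
  [have := fl 1 u v; rewrite scale1r mul1r|have := fl (t i) (x i) 0; rewrite !addr0 f0 addr0].
Qed.

Lemma linf_row n (f : 'cV[R]_n -> R) : linf f ->
  exists a : 'cV_n, forall z, f z = (a^T *m z) 0 0.
Proof.
move=> fl; exists (\col_i f (delta_mx i 0)) => z.
have {1}-> : z = \sum_i z i 0 *: delta_mx i 0.
  apply/colP => i; rewrite summxE (bigD1 i) //= !mxE !eqxx mulr1 big1 ?addr0 //.
  by move=> j ji; rewrite !mxE eq_sym (negPf ji) mulr0.
rewrite linf_sum // mxE; apply: eq_bigr => i _.
by rewrite !mxE mulrC.
Qed.

Lemma linm_mx n p (L : 'cV[R]_n -> 'cV[R]_p) : linm L ->
  exists M : 'M_(p, n), forall z, L z = M *m z.
Proof.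
move=> Ll.
have h i : linf (fun z => L z i 0) by move=> t x y; rewrite Ll !mxE.
pose a i := sval (cid (linf_row (h i))).
exists (\matrix_(i, j) a i j 0) => z; apply/colP => i.
rewrite (svalP (cid (linf_row (h i))) z) !mxE; apply: eq_bigr => j _.
by rewrite !mxE.
Qed.

(** The pullback of a constraint along the affine map z => M z + c. *)
Definition csubst n p (M : 'M[R]_(p, n)) (c : 'cV[R]_p) (k : cone_constraint R p) :
    cone_constraint R n :=
  match k with
  | LinConstraint a e => LinConstraint (M^T *m a) (e - (a^T *m c) 0 0)
  | SocConstraint r B c0 d e => SocConstraint (B *m M) (B *m c + c0) (M^T *m d)
      ((d^T *m c) 0 0 + e)
  end.

Lemma holds_csubst n p (M : 'M[R]_(p, n)) c k z :
  holds z (csubst M c k) <-> holds (M *m z + c) k.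
Proof.
case: k => [a e|r B c0 d e] /=.
  rewrite trmx_mul trmxK mulmxDr mulmxA [X in _ <-> X <= _]mxE.
  by rewrite lerBrDr.
by rewrite trmx_mul trmxK !mulmxDr !mulmxA -!addrA [X in _ <-> _ <= X + _]mxE -!addrA.
Qed.

Lemma socr_preim n p (S : set 'cV[R]_p) (L : 'cV[R]_n -> 'cV[R]_p) c :
  linm L -> socr S -> socr [set x | S (L x + c)].
Proof.
move=> /linm_mx[M LM] [r [q [ks ->]]].
exists r, q, (fun i => csubst (block_mx M 0 0 1%:M) (col_mx c 0) (ks i)).
apply/seteqP; split=> x /= [u h]; exists u => i; have := h i;
  rewrite holds_csubst mul_block_col !mul0mx addr0 add0r mul1mx add_col_mx addr0 LM //.
Qed.

Lemma socr_I n (S T : set 'cV[R]_n) : socr S -> socr T -> socr (S `&` T).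
Proof.
move=> [p1 [q1 [k1 ->]]] [p2 [q2 [k2 ->]]].
pose M1 : 'M[R]_(n + p1, n + (p1 + p2)) :=
  col_mx (row_mx 1%:M 0) (row_mx 0 (row_mx 1%:M 0)).
pose M2 : 'M[R]_(n + p2, n + (p1 + p2)) :=
  col_mx (row_mx 1%:M 0) (row_mx 0 (row_mx 0 1%:M)).
have M1E x u1 u2 : M1 *m col_mx x (col_mx u1 u2) + 0 = col_mx x u1.
  by rewrite !(mul_col_mx, mul_row_col, mul1mx, mul0mx, addr0, add0r).
have M2E x u1 u2 : M2 *m col_mx x (col_mx u1 u2) + 0 = col_mx x u2.
  by rewrite !(mul_col_mx, mul_row_col, mul1mx, mul0mx, addr0, add0r).
exists (p1 + p2)%N, (q1 + q2)%N, (fun i => match fintype.split i with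
  | inl i => csubst M1 0 (k1 i) | inr i => csubst M2 0 (k2 i) end).
apply/seteqP; split=> x /=.
  move=> [[u1 h1] [u2 h2]]; exists (col_mx u1 u2) => i.
  by case: fintype.split => j; rewrite holds_csubst ?M1E ?M2E.
move=> [u]; rewrite -(vsubmxK u) => h; split.
  exists (usubmx u) => i; have := h (lshift q2 i).
  by rewrite (unsplitK (inl i)) holds_csubst M1E.
exists (dsubmx u) => i; have := h (rshift q1 i).
by rewrite (unsplitK (inr i)) holds_csubst M2E.
Qed.

Lemma socr_proj n p (S : set 'cV[R]_(n + p)) : socr S ->
  socr [set x | exists u : 'cV_p, S (col_mx x u)].
Proof.
move=> [r [q [ks ->]]].
pose M : 'M[R]_(n + p + r, n + (p + r)) :=
  col_mx (col_mx (row_mx 1%:M 0) (row_mx 0 (row_mx 1%:M 0)))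
         (row_mx 0 (row_mx 0 1%:M)).
have ME x u1 u2 : M *m col_mx x (col_mx u1 u2) + 0 = col_mx (col_mx x u1) u2.
  by rewrite !(mul_col_mx, mul_row_col, mul1mx, mul0mx, addr0, add0r).
exists (p + r)%N, q, (fun i => csubst M 0 (ks i)).
apply/seteqP; split=> x /=.
  move=> [u [v h]]; exists (col_mx u v) => i.
  by rewrite holds_csubst ME.
move=> [u]; rewrite -(vsubmxK u) => h; exists (usubmx u), (dsubmx u) => i.
by have := h i; rewrite holds_csubst ME.
Qed.

Lemma socr_holds n (k : cone_constraint R n) : socr [set x | holds x k].
Proof.
exists 0%N, 1%N, (fun _ => csubst (row_mx 1%:M 0) 0 k).
apply/seteqP; split=> x /=.
  by exists 0 => _; rewrite holds_csubst mul_row_col mul1mx mul0mx !addr0.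
by move=> [u /(_ 0)]; rewrite holds_csubst mul_row_col mul1mx mul0mx !addr0.
Qed.

Lemma socr_setT n : socr [set: 'cV[R]_n].
Proof.
exists 0%N, 0%N, (fun i => match i with @Ordinal _ _ h => LinConstraint 0 0 end).
by apply/seteqP; split=> // x _; exists 0; case.
Qed.

Lemma socr_halfspace n (f : 'cV[R]_n -> R) e : linf f -> socr [set x | f x <= e].
Proof.
move=> /linf_row[a fE].
have -> : [set x | f x <= e] = [set x | holds x (LinConstraint a e)].
  by apply/seteqP; split=> x /=; rewrite fE.
exact: socr_holds.
Qed.

Lemma linfN (E : lmodType R) (f : E -> R) : linf f -> linf (fun x => - f x).
Proof. by move=> fl t x y; rewrite fl; ring. Qed.

Lemma linfB (E : lmodType R) (f g : E -> R) : linf f -> linf g ->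
  linf (fun x => f x - g x).
Proof. by move=> fl gl t x y; rewrite fl gl; ring. Qed.

Lemma socr_ge0 n (f : 'cV[R]_n -> R) : linf f -> socr [set x | 0 <= f x].
Proof.
move=> /linfN/(socr_halfspace 0) h.
rewrite (_ : [set _ | _] = [set x | - f x <= 0]) //.
by apply/seteqP; split=> x /=; rewrite oppr_le0.
Qed.

Lemma socr_eq0 n (f : 'cV[R]_n -> R) : linf f -> socr [set x | f x = 0].
Proof.
move=> fl; rewrite (_ : [set _ | _] = [set x | f x <= 0] `&` [set x | 0 <= f x]).
  by apply: socr_I; [apply: socr_halfspace | apply: socr_ge0].
apply/seteqP; split=> x /=; first by move=> ->.
by move=> [h1 h2]; apply/eqP; rewrite eq_le h1 h2.
Qed.

Lemma socr_forall n (I : finType) (S : I -> set 'cV[R]_n) :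
  (forall i, socr (S i)) -> socr [set x | forall i, S i x].
Proof.
move=> hS.
have h (s : seq I) : socr [set x | forall i, i \in s -> S i x].
  elim: s => [|i s IH].
    rewrite (_ : [set _ | _] = [set: _]); first exact: socr_setT.
    by apply/seteqP; split.
  rewrite (_ : [set _ | _] = S i `&` [set x | forall i, i \in s -> S i x]).
    exact: socr_I.
  apply/seteqP; split=> x /=.
    move=> hx; split; first by apply: hx; rewrite inE eqxx.
    by move=> j js; apply: hx; rewrite inE js orbT.
  by move=> [h1 h2] j; rewrite inE => /orP[/eqP->|/h2].
have := h (enum I); rewrite (_ : [set x | forall i, i \in enum I -> _] =
  [set x | forall i, S i x]) //.
apply/seteqP; split=> x /= hx i; last by move=> _; apply: hx.
by apply: hx; rewrite mem_enum.
Qed.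

(** The rotated cone: [h ^+ 2 <= f * g] with [f] and [g] nonnegative is the norm constraint on the
    vector [(2 h, f - g)] with right-hand side [f + g], by [(f + g)^2 - (f - g)^2 = 4 f g]. *)
Lemma socr_rotated n (f g h : 'cV[R]_n -> R) : linf f -> linf g -> linf h ->
  socr [set x | [/\ 0 <= f x, 0 <= g x & h x ^+ 2 <= f x * g x]].
Proof.
move=> /linf_row[a fE] /linf_row[c gE] /linf_row[d hE].
pose B : 'M[R]_(2, n) := \matrix_(i, j) (if i == 0 then 2 * d j 0 else a j 0 - c j 0).
rewrite (_ : [set _ | _] = [set x | holds x (SocConstraint B 0 (a + c) 0)]).
  exact: socr_holds.
apply/seteqP.
have BE x : \sum_i (B *m x + 0) i 0 ^+ 2 = (2 * h x) ^+ 2 + (f x - g x) ^+ 2.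
  rewrite big_ord_recl big_ord1 addr0; congr (_ ^+ 2 + _ ^+ 2); rewrite !mxE.
    rewrite hE mxE mulr_sumr; apply: eq_bigr => j _.
    by rewrite !mxE eqxx mulrA.
  rewrite fE gE !mxE -sumrB; apply: eq_bigr => j _.
  by rewrite !mxE /= mulrBl.
have sE x : ((a + c)^T *m x) 0 0 + 0 = f x + g x.
  by rewrite linearD mulmxDl mxE addr0 fE gE.
split=> x /=; rewrite /l2norm BE sE.
  move=> [f0 g0 hfg].
  rewrite -[leRHS]ger0_norm ?addr_ge0 // -sqrtr_sqr ler_sqrt ?sqr_ge0 //.
  by rewrite -subr_ge0; move: hfg; rewrite -subr_ge0; nra.
move=> hs.
have s0 : 0 <= f x + g x by apply: le_trans hs; exact: sqrtr_ge0.
have : (2 * h x) ^+ 2 + (f x - g x) ^+ 2 <= (f x + g x) ^+ 2.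
  move: hs; rewrite -[leRHS]ger0_norm // -sqrtr_sqr ler_sqrt ?sqr_ge0 //.
move=> hs2; have hfg : h x ^+ 2 <= f x * g x by nra.
(* A nonnegative product together with a nonnegative sum forces both factors to be nonnegative. *)
have : 0 <= f x * g x by apply: le_trans hfg; exact: sqr_ge0.
by split=> //; nra.
Qed.

Lemma linm_usub n p : linm (fun z : 'cV[R]_(n + p) => usubmx z).
Proof. by move=> t x y; rewrite linearP. Qed.

Lemma linm_dsub n p : linm (fun z : 'cV[R]_(n + p) => dsubmx z).
Proof. by move=> t x y; rewrite linearP. Qed.

(** The image is a projection of the graph, which linear equations cut out. *)
Lemma socr_image n p (S : set 'cV[R]_p) (L : 'cV[R]_p -> 'cV[R]_n) :
  linm L -> socr S -> socr [set x | exists2 u, S u & x = L u].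
Proof.
move=> Ll hS.
rewrite (_ : [set _ | _] = [set x | exists u : 'cV_p,
  ([set z : 'cV_(n + p) | S (dsubmx z + 0)] `&`
   [set z : 'cV_(n + p) | forall i, usubmx z i 0 - L (dsubmx z) i 0 = 0]) (col_mx x u)]).
  apply: socr_proj; apply: socr_I.
    exact: (socr_preim _ (@linm_dsub n p)).
  apply: socr_forall => i; apply: socr_eq0; apply: linfB => t x y.
    by rewrite linm_usub !mxE.
  by rewrite linm_dsub Ll !mxE.
apply/seteqP; split=> x /= [u].
  move=> Su ->; exists u; rewrite col_mxKd col_mxKu addr0; split=> // i.
  by rewrite subrr.
rewrite col_mxKd col_mxKu addr0 => -[Su h]; exists u => //.
by apply/colP => i; apply/eqP; rewrite -subr_eq0 h.
Qed.

End Representability.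

(** * The cone over the hull *)

Section Hull.
Variables (R : realType) (m n : nat) (A : bool -> 'M[R]_(m, n)) (b : bool -> R).
Variable M : R.
Hypothesis bdU : entry_bound A b M.
Local Notation U := (r1set A b).
Local Notation cvU := (conv_hull U).
Local Notation pairs := ('M[R]_(m, n) * R)%type.

Lemma cvU_convex V W t : 0 <= t <= 1 -> cvU V -> cvU W ->
  cvU (t *: V + (1 - t) *: W).
Proof.
move=> t01 hV hW S [cS US]; move/convex_setP: (cS) => cS'.
by apply: cS' => //; [apply: hV|apply: hW]; split.
Qed.

Lemma sub_cvU : U `<=` cvU.
Proof. by move=> W UW S [_]; apply. Qed.

(** The homogenization of the hull, with the origin as its only vector at height 0. *)
Definition hcone (z : pairs) :=
  z = 0 \/ 0 < z.2 /\ cvU (z.2^-1 *: z.1).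

Lemma hconeD z w : hcone z -> hcone w -> hcone (z + w).
Proof.
move=> [->|[z0 hz]]; first by rewrite add0r.
move=> [->|[w0 hw]]; first by rewrite addr0; right.
right; split; first by rewrite addr_gt0.
have zw : 0 < z.2 + w.2 by rewrite addr_gt0.
rewrite (_ : _ *: _ = z.2 / (z.2 + w.2) *: (z.2^-1 *: z.1) +
   (1 - z.2 / (z.2 + w.2)) *: (w.2^-1 *: w.1)).
  apply: cvU_convex => //; apply/andP; split; first by rewrite divr_ge0 // ltW.
  by rewrite ler_pdivrMr // mul1r lerDl ltW.
rewrite !scalerA scalerDr; congr (_ *: _ + _ *: _) => /=.
  by field; rewrite !gt_eqF.
by field; rewrite !gt_eqF.
Qed.

Definition pair_of (z : 'cV[R]_(m * n + 1)) : pairs :=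
  (vec_mx (usubmx z)^T, dsubmx z 0 0).

Definition of_pair (z : pairs) : 'cV[R]_(m * n + 1) :=
  col_mx (mxvec z.1)^T z.2%:M.

Lemma of_pairK : cancel of_pair pair_of.
Proof.
move=> [V t]; rewrite /pair_of /of_pair col_mxKu col_mxKd trmxK mxvecK.
by rewrite mxE eqxx mulr1n.
Qed.

Lemma pair_ofK : cancel pair_of of_pair.
Proof.
move=> z; rewrite /of_pair /pair_of /= vec_mxK trmxK -[RHS]vsubmxK; congr col_mx.
by apply/colP => i; rewrite ord1 mxE eqxx mulr1n.
Qed.

Lemma pair_of_lin : linm pair_of.
Proof.
by move=> t x y; apply/pair_equal_spec; split; rewrite ?linearP //= !mxE.
Qed.

Lemma of_pair_lin : linm of_pair.
Proof.
move=> t x y; rewrite /of_pair /= !linearP /= scale_col_mx add_col_mx.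
by congr col_mx; apply/matrixP => i j; rewrite !mxE !ord1 !eqxx !mulr1n.
Qed.

Lemma linf_entry i j : linf (fun z : 'cV_(m * n + 1) => (pair_of z).1 i j).
Proof. by move=> t x y; rewrite pair_of_lin !mxE. Qed.

Lemma linf_height : linf (fun z : 'cV_(m * n + 1) => (pair_of z).2).
Proof. by move=> t x y; rewrite pair_of_lin. Qed.

Lemma linf_dot k : linf (fun z : 'cV_(m * n + 1) => mxdot (A k) (pair_of z).1).
Proof. by move=> t x y; rewrite pair_of_lin /= mxdotD mxdotZ. Qed.

(** [K] is a representable convex cone that contains [T] at height 1 and lies in the cone over the
    hull of U rather than of [T]. This asymmetry makes the notion stable under unions, by adding
    cones. *)
Definition hullable (T : set 'M[R]_(m, n)) := exists K : set pairs,
  [/\ socr [set z | K (pair_of z)],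
      forall z w, K z -> K w -> K (z + w),
      forall t z, 0 <= t -> K z -> K (t *: z),
      K 0 /\ K `<=` hcone &
      forall W, T W -> K (W, 1)].

Lemma hullable0 (T : set 'M[R]_(m, n)) : (forall W, ~ T W) -> hullable T.
Proof.
move=> nT; exists [set 0]; split=> [|z w -> ->|t z _ ->| |W /nT//].
- suff -> : [set z | [set 0 : pairs] (pair_of z)] = [set z | forall i, z i 0 = 0].
    by apply: socr_forall => i; apply: socr_eq0 => t x y; rewrite !mxE.
  apply/seteqP; split=> z /=.
    move=> h; have -> : z = 0.
      rewrite -(pair_ofK z) h /of_pair /= linear0 trmx0.
      by rewrite raddf0 col_mx0.
    by move=> i; rewrite mxE.
  move=> h; have -> : z = 0 by apply/colP => i; rewrite h mxE.
  by rewrite /pair_of linear0 trmx0 linear0 linear0 mxE.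
- by rewrite addr0.
- by rewrite scaler0.
- by split=> // z ->; left.
Qed.

Lemma hullableU S T : hullable S -> hullable T -> hullable (S `|` T).
Proof.
move=> [K [sK aK zK [K0 hK] SK]] [L [sL aL zL [L0 hL] TL]].
exists [set z | exists x y, [/\ K x, L y & z = x + y]]; split.
- suff -> : [set z | exists x y, [/\ K x, L y & pair_of z = x + y]] =
    [set z | exists2 u : 'cV_(_ + _),
     ([set u | K (pair_of (usubmx u))] `&` [set u | L (pair_of (dsubmx u))]) u
     & z = usubmx u + dsubmx u].
    apply: socr_image.
      by move=> t x y; rewrite linm_usub linm_dsub scalerDr addrACA.
    apply: socr_I.
      have := socr_preim 0 (@linm_usub R (m * n + 1) (m * n + 1)) sK.
      rewrite (_ : [set x | _] = [set u | K (pair_of (usubmx u))]) //.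
      by apply/seteqP; split=> x /=; rewrite addr0.
    have := socr_preim 0 (@linm_dsub R (m * n + 1) (m * n + 1)) sL.
    rewrite (_ : [set x | _] = [set u | L (pair_of (dsubmx u))]) //.
    by apply/seteqP; split=> x /=; rewrite addr0.
  apply/seteqP; split=> z /=.
    move=> [x [y [Kx Ly e]]]; exists (col_mx (of_pair x) (of_pair y)).
      by rewrite col_mxKu col_mxKd !of_pairK.
    rewrite col_mxKu col_mxKd -[LHS]pair_ofK e.
    by have := of_pair_lin 1 x y; rewrite !scale1r.
  move=> [u [Ku Lu] ->]; exists (pair_of (usubmx u)), (pair_of (dsubmx u)).
  split=> //; have := pair_of_lin 1 (usubmx u) (dsubmx u).
  by rewrite !scale1r.
- move=> _ _ [x [y [Kx Ly ->]]] [x' [y' [Kx' Ly' ->]]].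
  exists (x + x'), (y + y'); split; [exact: aK|exact: aL|exact: addrACA].
- move=> t _ t0 [x [y [Kx Ly ->]]]; exists (t *: x), (t *: y).
  by split; [exact: zK|exact: zL|rewrite scalerDr].
- split; first by exists 0, 0; rewrite addr0.
  by move=> _ [x [y [/hK hx /hL hy ->]]]; apply: hconeD.
move=> W [/SK KW|/TL LW]; first by exists (W, 1), 0; rewrite addr0.
by exists 0, (W, 1); rewrite add0r.
Qed.

Lemma hullable_bigcup (I : finType) (T : I -> set 'M[R]_(m, n)) :
  (forall i, hullable (T i)) -> hullable [set W | exists i, T i W].
Proof.
move=> hT.
have h (s : seq I) : hullable [set W | exists2 i, i \in s & T i W].
  elim: s => [|i s IH]; first by apply: hullable0 => W [].
  rewrite (_ : [set _ | _] = T i `|` [set W | exists2 i, i \in s & T i W]).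
    exact: hullableU.
  apply/seteqP; split=> W /=.
    by move=> [j]; rewrite inE => /orP[/eqP->|js] TW; [left|right; exists j].
  move=> [TW|[j js TW]]; first by exists i; rewrite ?inE ?eqxx.
  by exists j; rewrite ?inE ?js ?orbT.
rewrite (_ : [set _ | _] = [set W | exists2 i, i \in enum I & T i W]) //.
apply/seteqP; split=> W /= [i]; last by exists i.
by exists i; rewrite ?mem_enum.
Qed.

Lemma hullable_subset S T : S `<=` T -> hullable T -> hullable S.
Proof.
move=> ST [K [h1 h2 h3 h4 TK]]; exists K; split=> // W /ST; exact: TK.
Qed.

(** The slice of [K] at height 1 is convex and contains [T], hence U and its hull; the inclusion
    [K <= hcone] gives the converse. *)
Lemma hullable_socr T : T `<=` U ->
  (forall S, (forall V W t, 0 <= t <= 1 -> S V -> S W -> S (t *: V + (1 - t) *: W)) ->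
     T `<=` S -> U `<=` S) ->
  hullable T -> socr_mx cvU.
Proof.
move=> TU cT [K [sK aK zK [K0 hK] TK]].
have cvE W : cvU W <-> K (W, 1).
  split=> [|/hK[/(congr1 snd)/= /eqP|[_]]]; last 2 first.
  - by rewrite oner_eq0.
  - by rewrite /= invr1 scale1r.
  move=> h; apply: (h [set W | K (W, 1)]); split.
    apply/convex_setP => V W' t /andP[t0 t1] KV KW.
    rewrite /= (_ : (_, 1) = t *: (V, 1 : R) + (1 - t) *: (W', 1 : R)).
      by apply: aK; apply: zK => //; rewrite subr_ge0.
    apply/pair_equal_spec; split=> //=.
    by rewrite /GRing.scale /=; ring.
  apply: cT => // V W' t /andP[t0 t1] KV KW.
  rewrite /= (_ : (_, 1) = t *: (V, 1 : R) + (1 - t) *: (W', 1 : R)).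
    by apply: aK; apply: zK => //; rewrite subr_ge0.
  apply/pair_equal_spec; split=> //=.
  by rewrite /GRing.scale /=; ring.
have Ll : linm (fun v : 'cV[R]_(m * n) => (col_mx v 0 : 'cV_(m * n + 1))).
  by move=> t x y; rewrite scale_col_mx add_col_mx scaler0 addr0.
have := socr_preim (col_mx 0 1%:M) Ll sK.
rewrite /socr_mx (_ : [set x | _] = [set (mxvec W)^T | W in cvU]) //.
apply/seteqP; split=> v /=.
  rewrite add_col_mx addr0 add0r => Kv.
  exists (vec_mx v^T); last by rewrite vec_mxK trmxK.
  apply/cvE; move: Kv; rewrite /pair_of col_mxKu col_mxKd.
  by rewrite mxE eqxx mulr1n.
move=> [W /cvE KW <-]; rewrite add_col_mx addr0 add0r.
by rewrite (_ : col_mx _ _ = of_pair (W, 1)) // of_pairK.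
Qed.

Lemma U_of_feas2 i i' j j' p1 p2 q1 q2 :
  feas2 (fun k => subblk (A k) i i' j j') b p1 p2 q1 q2 ->
  U (embed i i' j j' (ten p1 p2 q1 q2)).
Proof.
move=> [[p10 p20] [q10 q20] h]; apply/r1setP; rewrite embed_ten.
do 2 eexists; split; last 2 [reflexivity].
- by move=> r; rewrite addr_ge0 ?mulrn_wge0.
- by move=> c; rewrite addr_ge0 ?mulrn_wge0.
by move=> k; rewrite -embed_ten mxdot_embed.
Qed.
End Hull.

(** * Cones for single rows, single columns and arcs *)

Section Pieces.
Variables (R : realType) (m n : nat) (A : bool -> 'M[R]_(m, n)) (b : bool -> R).
Variable M : R.
Hypothesis bdU : entry_bound A b M.
Local Notation U := (r1set A b).
Local Notation pairs := ('M[R]_(m, n) * R)%type.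
Local Notation hullable := (hullable A b).

(** On such a support the rank condition holds automatically, so the piece is a polytope and its
    cone is given by homogeneous linear inequalities. A nonzero vector at height 0 could be added to
    a point of U indefinitely, against the bound. *)
Lemma hullable_supp (P : 'I_m -> 'I_n -> bool) :
  (forall W : 'M[R]_(m, n), (forall i j, ~~ P i j -> W i j = 0) -> (\rank W <= 1)%N) ->
  hullable [set W | U W /\ forall i j, ~~ P i j -> W i j = 0].
Proof.
move=> rP.
have [[W0 [UW0 PW0]]|nW] :=
  pselect (exists W, U W /\ forall i j, ~~ P i j -> W i j = 0); last first.
  by apply: hullable0 => W h; apply: nW; exists W.
exists [set z : pairs | [/\ 0 <= z.2, forall i j, 0 <= z.1 i j,
  forall i j, ~~ P i j -> z.1 i j = 0 & forall k, mxdot (A k) z.1 <= z.2 * b k]].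
split.
- rewrite (_ : mkset _ = [set z : 'cV_(m * n + 1) | 0 <= (pair_of z).2] `&`
    ([set z | forall i j, 0 <= (pair_of z).1 i j] `&`
    (* Off the support the entries are required to be nonpositive; with nonnegativity they
       vanish. *)
    ([set z | forall i j, 0 <= (if P i j then 0 else - (pair_of z).1 i j)] `&`
     [set z | forall k, mxdot (A k) (pair_of z).1 - (pair_of z).2 * b k <= 0]))).
    apply: socr_I; first by apply: socr_ge0; exact: linf_height.
    apply: socr_I; first by do 2 apply: socr_forall => ?; apply: socr_ge0; exact: linf_entry.
    apply: socr_I.
      apply: socr_forall => i; apply: socr_forall => j; apply: socr_ge0.
      by case: (P i j) => t x y; rewrite ?linf_entry; ring.
    apply: socr_forall => k; apply: socr_halfspace; apply: linfB.
      exact: linf_dot.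
    by move=> t x y; rewrite linf_height; ring.
  apply/seteqP; split=> z /=.
    move=> [z0 zp zP zA]; split=> //; split=> //; split=> [i j|k]; last first.
      by rewrite subr_le0.
    by case: ifPn => // /zP ->; rewrite oppr0.
  move=> [z0 [zp [zP zA]]]; split=> // [i j Pij|k]; last by rewrite -subr_le0.
  have := zP i j; rewrite (negPf Pij) oppr_ge0 => h.
  by apply/eqP; rewrite eq_le h zp.
- move=> z w [z0 zp zP zA] [w0 wp wP wA]; split=> /=; first by rewrite addr_ge0.
  + by move=> i j; rewrite mxE addr_ge0.
  + by move=> i j Pij; rewrite mxE zP // wP // addr0.
  + by move=> k; rewrite mxdotD mulrDl lerD.
- move=> t z t0 [z0 zp zP zA]; split=> /=; first by rewrite mulr_ge0.
  + by move=> i j; rewrite mxE mulr_ge0.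
  + by move=> i j Pij; rewrite mxE zP // mulr0.
  + by move=> k; rewrite mxdotZ -mulrA ler_wpM2l.
- split; first by split=> //= *; rewrite ?mxE ?mxdot0 ?mul0r.
  move=> [V t] /= [t0 Vp VP VA]; rewrite /hcone /=.
  have [tz|tn] := eqVneq t 0; last first.
    have tp : 0 < t by rewrite lt_neqAle eq_sym tn.
    right; split=> //; apply: sub_cvU; split.
    + by move=> i j; rewrite mxE mulr_ge0 // invr_ge0.
    + by rewrite mxdotZ mulrC ler_pdivrMr // mulrC.
    + by rewrite mxdotZ mulrC ler_pdivrMr // mulrC.
    + by apply: rP => i j Pij; rewrite mxE VP // mulr0.
  left; rewrite tz; apply/pair_equal_spec; split=> //.
  have VA0 k : mxdot (A k) V <= 0 by have := VA k; rewrite tz mul0r.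
  have inU s : 0 <= s -> U (W0 + s *: V).
    move=> s0; case: UW0 => W0p h1 h2 _; split.
    + by move=> i j; rewrite !mxE addr_ge0 // mulr_ge0.
    + by rewrite mxdotD mxdotZ -[leRHS]addr0 lerD // mulr_ge0_le0.
    + by rewrite mxdotD mxdotZ -[leRHS]addr0 lerD // mulr_ge0_le0.
    + by apply: rP => i j Pij; rewrite !mxE PW0 // VP // mulr0 addr0.
  apply/matrixP => i j; rewrite mxE; apply/eqP; rewrite eq_le Vp andbT leNgt.
  apply/negP => Vij.
  have W0p : 0 <= W0 i j by case: UW0.
  have M0 : 0 <= M by apply: le_trans (bdU UW0 i j).
  (* This multiple of [V] brings the entry to at least [M + 1]. *)
  have := inU ((M + 1) / V i j); rewrite divr_ge0 ?(ltW Vij) ?addr_ge0 //.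
  move=> /(_ isT) /bdU /(_ i j); rewrite !mxE divfK ?gt_eqF //; lra.
move=> W [[Wp h1 h2 _] PW]; split=> //=.
by case; rewrite mul1r.
Qed.

Lemma row_rank1 (i0 : 'I_m) (W : 'M[R]_(m, n)) :
  (forall i j, i != i0 -> W i j = 0) -> (\rank W <= 1)%N.
Proof.
move=> h; rewrite (_ : W = outer (fun i => (i == i0)%:R) (W i0)) ?outer_rank //.
apply/matrixP => i j; rewrite mxE; case: eqVneq => [->|/h ->].
  by rewrite mul1r.
by rewrite mul0r.
Qed.

Lemma col_rank1 (j0 : 'I_n) (W : 'M[R]_(m, n)) :
  (forall i j, j != j0 -> W i j = 0) -> (\rank W <= 1)%N.
Proof.
move=> h; rewrite (_ : W = outer (W^~ j0) (fun j => (j == j0)%:R)) ?outer_rank //.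
apply/matrixP => i j; rewrite mxE; case: eqVneq => [->|/h ->].
  by rewrite mulr1.
by rewrite mulr0.
Qed.

Section ArcPiece.
Variables (i i' : 'I_m) (j j' : 'I_n) (s : R).
Local Notation a := (fun k => subblk (A k) i i' j j').

(** The product of the sums consists of four products, each at most an entry of the embedded matrix,
    even when indices coincide. *)
Lemma bound2_block : bound2 a b (M *+ 4).
Proof.
move=> p1 p2 q1 q2 f; have := U_of_feas2 f => /bdU h.
case: f => [[p10 p20] [q10 q20] _].
have e r c : (p1 *+ (r == i) + p2 *+ (r == i')) * (q1 *+ (c == j) + q2 *+ (c == j')) <= M.
  by have := h r c; rewrite embed_ten mxE.
have le r c p q : p <= p1 *+ (r == i) + p2 *+ (r == i') -> 0 <= p ->
    q <= q1 *+ (c == j) + q2 *+ (c == j') -> 0 <= q -> p * q <= M.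
  by move=> h1 h2 h3 h4; apply: le_trans (e r c); apply: ler_pM.
have := le i j p1 q1; have := le i j' p1 q2.
have := le i' j p2 q1; have := le i' j' p2 q2.
rewrite !eqxx !mulr1n !lerDl !lerDr !mulrn_wge0 //.
move=> /(_ isT p20 isT q20) h1 /(_ isT p20 isT q10) h2.
move=> /(_ isT p10 isT q20) h3 /(_ isT p10 isT q10) h4.
have -> : M *+ 4 = M + M + M + M by ring.
have -> : (p1 + p2) * (q1 + q2) = p1 * q1 + p1 * q2 + p2 * q1 + p2 * q2 by ring.
by rewrite !lerD.
Qed.

(** Numerator and height of the arc: [AD / dn] is the tight matrix. The sign [s] makes the height
    positive on the cone. *)
Let AD x1 x2 : 'M[R]_(m, n) := (s * sqnorm b) *: embed i i' j j' (arcdir a b x1 x2).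
Let dn x1 x2 := s * den a b x1 x2.

(** For p = x e + y f, the pair [(AD, dn)] is a linear image of the moment vector (x^2, x y, y^2).
    With x, y nonnegative these vectors generate the cone [u1 >= 0], [u1 ^+ 2 <= u0 * u2], so its
    linear image serves as the cone of the arc. *)
Lemma hullable_arc :
  hullable [set W | exists p1 p2 q1 q2 rho,
    [/\ W = embed i i' j j' (ten p1 p2 q1 q2), arcpoint a b p1 p2 q1 q2 rho
      & 0 < s * rho /\ sgn1 s]].
Proof.
have [[W0 [p1 [p2 [q1 [q2 [rho [_ ap [srho s1]]]]]]]]|nW] := pselect (exists W p1 p2 q1 q2 rho,
    [/\ W = embed i i' j j' (ten p1 p2 q1 q2), arcpoint a b p1 p2 q1 q2 rho
      & 0 < s * rho /\ sgn1 s]); last first.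
  by apply: hullable0 => W h; apply: nW; exists W.
have [s' [e1 [e2 [f1 [f2 [s1' srho' ar _ _]]]]]] := arc_exists bound2_block ap.
(* Both are the sign of [rho]. *)
have ss' : s' = s.
  by case: s1 s1' srho srho' => -> [] -> //; rewrite !mulN1r !mul1r; lra.
rewrite {s' srho' s1'}ss' in ar.
have bb0 : 0 < sqnorm b by case: ap => ? ? ? ? [].
case: ar => ce cf dlt dpos cgen.
pose E1 := AD e1 e2; pose E3 := AD f1 f2.
pose E2 := AD (e1 + f1) (e2 + f2) - E1 - E3.
pose t1 := dn e1 e2; pose t3 := dn f1 f2.
pose t2 := dn (e1 + f1) (e2 + f2) - t1 - t3.
have ADE x y : AD (x * e1 + y * f1) (x * e2 + y * f2) =
    x ^+ 2 *: E1 + (x * y) *: E2 + y ^+ 2 *: E3.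
  apply/matrixP => r c; rewrite /E2 /E1 /E3 /AD /embed /arcdir /ten /g1 /g2 !mxE /=.
  ring.
have dnE x y : dn (x * e1 + y * f1) (x * e2 + y * f2) =
    x ^+ 2 * t1 + (x * y) * t2 + y ^+ 2 * t3.
  by rewrite /t2 /t1 /t3 /dn /den /arcdir /dot2 /ten /g1 /g2 /=; ring.
pose F (u : 'cV[R]_3) : pairs := (u 0 0 *: E1 + u 1 0 *: E2 + u 2 0 *: E3,
   u 0 0 * t1 + u 1 0 * t2 + u 2 0 * t3).
pose C := [set u : 'cV[R]_3 | 0 <= u 1 0 /\
   [/\ 0 <= u 0 0, 0 <= u 2 0 & u 1 0 ^+ 2 <= u 0 0 * u 2 0]].
have Flin : linm F.
  move=> t x y; apply/pair_equal_spec; split=> /=.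
    by apply/matrixP => r c; rewrite !mxE; ring.
  by rewrite !mxE /GRing.scale /=; ring.
have Csq x y : 0 <= x -> 0 <= y ->
    hcone A b (x ^+ 2 *: E1 + (x * y) *: E2 + y ^+ 2 *: E3,
       x ^+ 2 * t1 + (x * y) * t2 + y ^+ 2 * t3).
  move=> x0 y0; rewrite -ADE -dnE; rewrite /hcone /=.
  have [xz|xn] := eqVneq (x + y) 0.
    have [-> ->] : x = 0 /\ y = 0.
      by move/eqP: xz; rewrite paddr_eq0 // => /andP[/eqP-> /eqP->].
    left; apply/pair_equal_spec; split.
      by apply/matrixP => r c; rewrite /AD /embed /arcdir /ten /g1 /g2 !mxE /=; ring.
    by rewrite /dn /den /arcdir /dot2 /ten /g1 /g2 /=; ring.
  have xy : 0 < x + y by rewrite lt_neqAle eq_sym xn addr_ge0.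
  right; have dp := dpos x y x0 y0 xy; split=> //.
  have [/U_of_feas2 h _] := feas2_arc s1 bb0 (cone_comb ce cf x0 y0) dp.
  apply: sub_cvU; move: h; set z1 := x * e1 + y * f1; set z2 := x * e2 + y * f2.
  have dz : den a b z1 z2 != 0.
    by apply/eqP => h; move: dp; rewrite -/z1 -/z2 h mulr0 ltxx.
  have sn : s != 0 by case: s1 => ->; rewrite ?oppr_eq0 oner_eq0.
  congr U; apply/matrixP => r c; rewrite /AD /dn /embed /arcdir /ten !mxE /=.
  by field; rewrite dz sn.
exists [set z : pairs | exists2 u, C u & z = F u]; split.
- rewrite (_ : mkset _ = [set z | exists2 u, C u & z = of_pair (F u)]).
    apply: socr_image; first by move=> t x y; rewrite Flin of_pair_lin.
    apply: socr_I; first by apply: socr_ge0 => t x y; rewrite !mxE.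
    by apply: socr_rotated => t x y; rewrite !mxE.
  apply/seteqP; split=> z /= [u Cu e]; exists u => //.
    by rewrite -e pair_ofK.
  by rewrite e of_pairK.
- move=> _ _ [u [u1 [u0 u2 hu]] ->] [v [v1 [v0 v2 hv]] ->]; exists (u + v).
    split; first by rewrite mxE addr_ge0.
    split; rewrite !mxE ?addr_ge0 //.
    (* The arithmetic-geometric mean inequality for [u0 * v2] and [u2 * v0], whose product is at
       least [(u1 * v1) ^+ 2]. *)
    have h : (u 1 0 * v 1 0) *+ 2 <= u 0 0 * v 2 0 + u 2 0 * v 0 0.
      have h1 : (u 1 0 * v 1 0) ^+ 2 <= (u 0 0 * v 2 0) * (u 2 0 * v 0 0).
        rewrite exprMn (_ : _ * _ = (u 0 0 * u 2 0) * (v 0 0 * v 2 0)); last by ring.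
        by rewrite ler_pM ?sqr_ge0.
      have h2 : ((u 1 0 * v 1 0) *+ 2) ^+ 2 <= (u 0 0 * v 2 0 + u 2 0 * v 0 0) ^+ 2.
        have := sqr_ge0 (u 0 0 * v 2 0 - u 2 0 * v 0 0).
        by rewrite -subr_ge0; move: h1; nra.
      by move: h2; rewrite ler_sqr ?nnegrE ?mulrn_wge0 ?addr_ge0 ?mulr_ge0.
    have -> : (u 1 0 + v 1 0) ^+ 2 = u 1 0 ^+ 2 + v 1 0 ^+ 2 + (u 1 0 * v 1 0) *+ 2 by ring.
    have -> : (u 0 0 + v 0 0) * (u 2 0 + v 2 0) =
      u 0 0 * u 2 0 + v 0 0 * v 2 0 + (u 0 0 * v 2 0 + u 2 0 * v 0 0) by ring.
    by apply: lerD h; apply: lerD.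
  by have := Flin 1 u v; rewrite !scale1r => ->.
- move=> t _ t0 [u [u1 [u0 u2 hu]] ->]; exists (t *: u).
    split; first by rewrite mxE mulr_ge0.
    split; rewrite !mxE ?mulr_ge0 //.
    have -> : t * u 0 0 * (t * u 2 0) = t ^+ 2 * (u 0 0 * u 2 0) by ring.
    by rewrite exprMn ler_wpM2l ?sqr_ge0.
  have := Flin t u 0; rewrite addr0 => ->.
  rewrite (_ : F 0 = 0) ?addr0 //; apply/pair_equal_spec; split=> /=.
    by rewrite !mxE !scale0r !addr0.
  by rewrite !mxE !mul0r !addr0.
- split.
    exists 0; first by rewrite /C /= !mxE; split=> //; split=> //; rewrite mul0r expr0n.
    by apply/pair_equal_spec; split; rewrite /= !mxE ?scale0r ?mul0r !addr0.
  move=> _ [u [u1 [u0 u2 hu]] ->].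
  have [uz|un] := eqVneq (u 0 0) 0.
    have u1z : u 1 0 = 0.
      by apply/eqP; rewrite -sqrf_eq0 eq_le sqr_ge0 andbT; move: hu; rewrite uz mul0r.
    have := Csq 0 (Num.sqrt (u 2 0)) (lexx _) (sqrtr_ge0 _).
    by rewrite /F uz u1z expr0n mul0r sqr_sqrtr.
  have up : 0 < u 0 0 by rewrite lt_neqAle eq_sym un.
  have [r r0 rr] : exists2 r, 0 < r & r ^+ 2 = u 0 0.
    by exists (Num.sqrt (u 0 0)); rewrite ?sqrtr_gt0 ?sqr_sqrtr.
  (* A vector of the cone is the moment vector of [(r, u1 / r)] plus [(0, 0, w)], the moment vector
     of [(0, q)]. *)
  pose w := u 2 0 - u 1 0 ^+ 2 / u 0 0.
  have w0 : 0 <= w by rewrite subr_ge0 ler_pdivrMr // mulrC.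
  have [q q0 qq] : exists2 q, 0 <= q & q ^+ 2 = w.
    by exists (Num.sqrt w); rewrite ?sqrtr_ge0 ?sqr_sqrtr.
  have := hconeD (Csq r (u 1 0 / r) (ltW r0) (divr_ge0 u1 (ltW r0)))
                 (Csq 0 q (lexx _) q0).
  have re1 : r * (u 1 0 / r) = u 1 0 by field; rewrite gt_eqF.
  have re2 : (u 1 0 / r) ^+ 2 = u 1 0 ^+ 2 / u 0 0 by rewrite expr_div_n rr.
  have re3 : (0 : R) ^+ 2 = 0 by rewrite expr0n.
  congr hcone; apply/pair_equal_spec; split=> /=.
    rewrite re1 re2 qq rr re3 mul0r /w.
    by clearbody E2 E1 E3; apply/matrixP => ? ?; rewrite !mxE; field.
  rewrite re1 re2 qq rr re3 mul0r /w.
  by rewrite /w; field.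
move=> W [z1 [z2 [y1 [y2 [r [-> [zz yy y1E y2E [rd _ _]] [sr _]]]]]]].
have ss : s * s = 1 by case: s1 => ->; ring.
have cz : cone a b s z1 z2.
  have h c : 0 < r * c -> 0 <= s * c.
    move=> rc; rewrite -(pmulr_rge0 _ sr) mulrACA ss mul1r; exact: ltW.
  case: zz yy => z10 z20 [y10 y20]; split; [exact: ltW|exact: ltW| |].
    by apply: h; rewrite -y1E.
  by rewrite -mulrN; apply: h; rewrite mulrN -y2E.
(* The generators were found from one arc point, but they span the whole cone of sign [s] and so
   reach every point of the piece. *)
have [x [y [x0 y0 z1E z2E]]] := cgen z1 z2 cz.
have dz : 0 < dn z1 z2.
  by rewrite -(pmulr_rgt0 _ sr) /dn mulrACA ss mul1r rd.
pose t := (dn z1 z2)^-1.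
have t0 : 0 <= t by rewrite invr_ge0 ltW.
exists (\col_k (if k == 0 then t * x ^+ 2 else if k == 1 then t * (x * y) else t * y ^+ 2)).
  split; first by rewrite mxE /= !mulr_ge0.
  split; rewrite !mxE /= ?mulr_ge0 ?sqr_ge0 //.
  by rewrite le_eqVlt; apply/orP; left; apply/eqP; ring.
have sn : s != 0 by case: s1 => ->; rewrite ?oppr_eq0 oner_eq0.
have dzn : den a b z1 z2 != 0.
  by apply/eqP => h; move: dz; rewrite /dn h mulr0 ltxx.
apply/pair_equal_spec; rewrite !mxE /=; split.
  rewrite -!(scalerA t) -!scalerDr -ADE -z1E -z2E y1E y2E.
  have -> : r = sqnorm b / den a b z1 z2 by rewrite -rd mulfK.
  apply/matrixP => ? ?; rewrite /t /AD /dn /embed /arcdir /ten !mxE /=.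
  by field; rewrite dzn sn.
by rewrite -!(mulrA t) -!mulrDr -dnE -z1E -z2E /t mulVf // gt_eqF.
Qed.

End ArcPiece.

(** The first two terminal shapes lie in a row, the third in a column and the fourth on an arc. Arcs
    are indexed by four matrix indices and a sign, so the family is finite. *)
Theorem socr_hull : (0 < m)%N -> socr_mx (conv_hull U).
Proof.
move=> m0.
pose rows := [set W | exists i, U W /\ forall r c, ~~ (r == i) -> W r c = 0].
pose cols := [set W | exists j, U W /\ forall r c, ~~ (c == j) -> W r c = 0].
pose sg (e : bool) : R := if e then 1 else -1.
pose arcs := [set W | exists k : 'I_m * 'I_m * ('I_n * 'I_n) * bool,
  exists p1 p2 q1 q2 rho,
    [/\ W = embed k.1.1.1 k.1.1.2 k.1.2.1 k.1.2.2 (ten p1 p2 q1 q2),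
       arcpoint (fun h => subblk (A h) k.1.1.1 k.1.1.2 k.1.2.1 k.1.2.2) b p1 p2 q1 q2 rho
      & 0 < sg k.2 * rho /\ sgn1 (sg k.2)]].
apply: (@hullable_socr _ _ _ _ _ (U `&` (rows `|` (cols `|` arcs)))).
- by move=> W [].
- move=> S cS TS; apply: (reduction bdU) => // [U0|i i' j j' p1 p2 q1 q2 T UW].
    apply: TS; split=> //; left; exists (Ordinal m0); split=> // r c _.
    by rewrite mxE.
  apply: TS; split=> //; move: UW; case: T.
  + move=> [-> -> _ _] UW; left; exists i; split=> // r c /negPf ri.
    by rewrite embed_ten mxE ri mulr0n add0r mul0rn mul0r.
  + move=> [[-> ->] _ _ _] UW; left; exists i; split=> // r c /negPf ri.
    by rewrite embed_ten mxE ri mulr0n add0r mul0rn mul0r.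
  + move=> [_ [-> ->] _ _] UW; right; left; exists j; split=> // r c /negPf ri.
    by rewrite embed_ten mxE ri mulr0n add0r mul0rn mulr0.
  move=> [pp qq tight rd cd] UW; right; right.
  have [rho ap] := term4_arcpoint pp qq tight rd cd.
  have r0 : rho != 0.
    by case: ap => _ [q10 _] q1E _ _; apply: contraTneq q10 => e; rewrite q1E e mul0r ltxx.
  exists (i, i', (j, j'), 0 < rho) => /=; exists p1, p2, q1, q2, rho; split=> //.
  rewrite /sg /sgn1; have [h|h] := ltP 0 rho.
    by rewrite mul1r; split=> //; left.
  split; last by right.
  by rewrite mulN1r oppr_gt0 lt_neqAle r0.
apply: hullable_subset (_ : _ `<=` rows `|` (cols `|` arcs)) _; first by move=> W [].
apply: hullableU; [|apply: hullableU].
- apply: hullable_bigcup => i; apply: (@hullable_supp (fun r c => r == i)).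
  by move=> W; apply: row_rank1.
- apply: hullable_bigcup => i; apply: (@hullable_supp (fun r c => c == i)).
  by move=> W h; apply: col_rank1 (fun r c => h r c).
by apply: hullable_bigcup => k; apply: hullable_arc.
Qed.

End Pieces.

(** * Maximization on a block *)

(** In the basis e, f the form is [q(e) l^2 + B l m + q(f) m^2] with negative outer coefficients, so
    a nonnegative value forces [B > 0]. The direction [(qb, - 2 qa)] is the vertex along lines of
    constant second coordinate, and it falls inside the cone. *)
Lemma quad_vertex (R : realFieldType) (qa qb qc e1 e2 f1 f2 l m : R) :
  let q x y := qa * x ^+ 2 + qb * (x * y) + qc * y ^+ 2 in
  0 <= e1 -> 0 <= e2 -> 0 <= f1 -> 0 <= f2 -> 0 < e1 * f2 - e2 * f1 ->
  0 < l -> 0 < m -> q e1 e2 < 0 -> q f1 f2 < 0 ->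
  0 <= q (l * e1 + m * f1) (l * e2 + m * f2) ->
  [/\ exists x y, [/\ 0 < x, 0 < y, qb = x * e1 + y * f1 & - (2 * qa) = x * e2 + y * f2],
      qa < 0, 0 <= qb ^+ 2 - 4 * qa * qc &
      0 < q (l * e1 + m * f1) (l * e2 + m * f2) -> 0 < qb ^+ 2 - 4 * qa * qc].
Proof.
move=> q e10 e20 f10 f20 dlt l0 m0 qe qf qp.
set D := e1 * f2 - e2 * f1 in dlt.
pose B := q (e1 + f1) (e2 + f2) - q e1 e2 - q f1 f2.
have qE : q (l * e1 + m * f1) (l * e2 + m * f2) =
  q e1 e2 * l ^+ 2 + B * (l * m) + q f1 f2 * m ^+ 2 by rewrite /B /q; ring.
have lm : 0 < l * m by rewrite mulr_gt0.
have l2 : q e1 e2 * l ^+ 2 < 0 by rewrite pmulr_llt0 // exprn_gt0.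
have m2 : q f1 f2 * m ^+ 2 < 0 by rewrite pmulr_llt0 // exprn_gt0.
have B0 : 0 < B.
  by rewrite -(pmulr_lgt0 _ lm); move: qp; rewrite qE; lra.
have f2p : 0 < f2.
  rewrite lt_neqAle f20 andbT eq_sym; apply: contraTneq dlt => h.
  by rewrite /D h -leNgt mulr0 sub0r oppr_le0 mulr_ge0.
have Dn : D != 0 by rewrite gt_eqF.
have discE : (qb ^+ 2 - 4 * qa * qc) * D ^+ 2 = B ^+ 2 - 4 * q e1 e2 * q f1 f2.
  by rewrite /B /q /D; ring.
have D2 : 0 < D ^+ 2 by rewrite exprn_gt0.
have lm2 : 0 < (l * m) ^+ 2 by rewrite exprn_gt0.
(* At (l, m) the middle term is at least the sum of the absolute values of the outer ones, so its
   square is at least four times their product. *)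
have BE : (B ^+ 2 - 4 * q e1 e2 * q f1 f2) * (l * m) ^+ 2 =
   (B * (l * m)) ^+ 2 - 4 * (- (q e1 e2 * l ^+ 2)) * (- (q f1 f2 * m ^+ 2)) by ring.
(* [qa] is the value at (1, 0), whose coordinates in the basis e, f are [f2 / D] and [- e2 / D]. *)
have qaE : qa * D ^+ 2 = f2 ^+ 2 * q e1 e2 - f2 * e2 * B + e2 ^+ 2 * q f1 f2.
  by rewrite /B /q /D; ring.
have dxE : (qb * f2 + 2 * qa * f1) * D = f2 * B - e2 * (2 * q f1 f2).
  by rewrite /B /q /D; ring.
have dyE : - (2 * qa * e1 + qb * e2) * D = e2 * B - f2 * (2 * q e1 e2).
  by rewrite /B /q /D; ring.
split.
- exists ((qb * f2 + 2 * qa * f1) / D), (- (2 * qa * e1 + qb * e2) / D).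
  split.
  + rewrite divr_gt0 // -(pmulr_lgt0 _ dlt) dxE ltr_pwDl ?mulr_gt0 //.
    by rewrite oppr_ge0 mulr_ge0_le0 //; lra.
  + rewrite divr_gt0 // -(pmulr_lgt0 _ dlt) dyE ltr_wpDl ?mulr_ge0 ?(ltW B0) //.
    by rewrite oppr_gt0 pmulr_rlt0 //; lra.
  + by rewrite /D; field.
  + by rewrite /D; field.
- rewrite -(pmulr_llt0 _ D2) qaE.
  have h1 : f2 ^+ 2 * q e1 e2 < 0 by rewrite pmulr_rlt0 // exprn_gt0.
  have h2 : 0 <= f2 * e2 * B by rewrite !mulr_ge0 // ltW.
  have h3 : e2 ^+ 2 * q f1 f2 <= 0 by rewrite mulr_ge0_le0 ?sqr_ge0 // ltW.
  lra.
- rewrite -(pmulr_lge0 _ D2) discE -(pmulr_lge0 _ lm2) BE.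
  move: qp; rewrite qE => qp.
  have := sqr_ge0 (q e1 e2 * l ^+ 2 - q f1 f2 * m ^+ 2); nra.
- rewrite qE => qp'; rewrite -(pmulr_lgt0 _ D2) discE -(pmulr_lgt0 _ lm2) BE.
  have := sqr_ge0 (q e1 e2 * l ^+ 2 - q f1 f2 * m ^+ 2); nra.
Qed.

Section Dirs.
Variables (K : comNzRingType) (a : bool -> blk K) (b : bool -> K) (c : blk K).

(** Objective minus [j], multiplied by [den]: once multiplied by the sign of [den], it is
    nonnegative at p exactly when the tight block through p has objective at least [j]. *)
Definition qform j x1 x2 := sqnorm b * dot2 c (arcdir a b x1 x2) - j * den a b x1 x2.
Definition qA j := qform j 1 0.
Definition qC j := qform j 0 1.
Definition qB j := qform j 1 1 - qA j - qC j.

(** A single entry, then the four possible ends of an arc: p2 = 0, p1 = 0, q2 = 0 (a zero of [g1]),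
    q1 = 0 (a zero of [g2]). The shapes with two entries in a row or a column are among them. *)
Definition vdirs := [:: ten 1 0 1 0; arcdir a b 1 0; arcdir a b 0 1;
  ten (e21 (cross a b)) (- e11 (cross a b)) 1 0;
  ten (e22 (cross a b)) (- e12 (cross a b)) 0 1].

(** The vertex direction [(qB, - 2 qA)], spelled so as to agree with the machine expression
    [earcvertex]. *)
Definition arcvertex j := arcdir a b (qB j) (0 - (qA j + qA j)).

Lemma qformE j x1 x2 :
  qform j x1 x2 = qA j * x1 ^+ 2 + qB j * (x1 * x2) + qC j * x2 ^+ 2.
Proof.
by rewrite /qB /qA /qC /qform /den /arcdir /dot2 /ten /g1 /g2 /=; ring.
Qed.

End Dirs.

Definition scaleb (K : comNzRingType) t (v : blk K) :=
  Blk (t * e11 v) (t * e12 v) (t * e21 v) (t * e22 v).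

Lemma dot2Z (K : comNzRingType) (a : blk K) t v : dot2 a (scaleb t v) = t * dot2 a v.
Proof. by rewrite /dot2 /scaleb /=; ring. Qed.

Lemma arcdirZ (K : comNzRingType) (a : bool -> blk K) b t x y :
  arcdir a b (t * x) (t * y) = scaleb (t ^+ 2) (arcdir a b x y).
Proof. by rewrite /arcdir /ten /scaleb /g1 /g2 /=; congr Blk; ring. Qed.

Lemma scalebA (K : comNzRingType) s t (v : blk K) :
  scaleb s (scaleb t v) = scaleb (s * t) v.
Proof. by rewrite /scaleb /=; congr Blk; rewrite mulrA. Qed.

Section BlockAnalysis.
Variables (R : rcfType) (a : bool -> blk R) (b : bool -> R) (c : blk R) (M : R).
Hypothesis bM : bound2 a b M.

Definition feasb (w : blk R) :=
  [/\ 0 <= e11 w /\ 0 <= e12 w, 0 <= e21 w /\ 0 <= e22 w &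
      forall k, dot2 (a k) w <= b k].

(** A tight constraint with [b k != 0] determines the scale as [b k / dot2 (a k) v], so the block
    can be computed from [v] alone. *)
Definition good_dir (j : R) (v : blk R) := exists t k,
  [/\ feasb (scaleb t v), b k != 0, dot2 (a k) (scaleb t v) = b k
    & j <= dot2 c (scaleb t v)].

Definition arc_case (j : R) := exists s e1 e2 f1 f2 l m,
  let q x y := s * qform a b c j x y in
  [/\ sgn1 s /\ 0 < sqnorm b, arc_span a b s e1 e2 f1 f2, 0 < l /\ 0 < m,
      q e1 e2 < 0 /\ q f1 f2 < 0 & 0 <= q (l * e1 + m * f1) (l * e2 + m * f2)].

Lemma feasb_ten p1 p2 q1 q2 : feas2 a b p1 p2 q1 q2 -> feasb (ten p1 p2 q1 q2).
Proof. by move=> [[? ?] [? ?] h]; split=> //=; rewrite !mulr_ge0. Qed.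

Lemma sqnorm_gt0_ex : 0 < sqnorm b -> exists k, b k != 0.
Proof.
move=> bb0; apply: contrapT => h.
have z k : b k = 0 by apply/eqP; apply: contraT => nk; case: h; exists k.
by move: bb0; rewrite /sqnorm !z expr0n /= addr0 ltxx.
Qed.

Definition arcw x1 x2 := let t := sqnorm b / den a b x1 x2 in
  ten x1 x2 (t * g2 a b x1 x2) (- (t * g1 a b x1 x2)).

Lemma arcwE x1 x2 : arcw x1 x2 = scaleb (sqnorm b / den a b x1 x2) (arcdir a b x1 x2).
Proof. by rewrite /arcw /arcdir /ten /scaleb /=; congr Blk; ring. Qed.

Lemma qform_arcw j x1 x2 : den a b x1 x2 != 0 ->
  qform a b c j x1 x2 = den a b x1 x2 * (dot2 c (arcw x1 x2) - j).
Proof. by move=> h; rewrite arcwE dot2Z /qform; field. Qed.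

Lemma den_neq0 s x1 x2 : 0 < s * den a b x1 x2 -> den a b x1 x2 != 0.
Proof. by apply: contraTneq => ->; rewrite mulr0 ltxx. Qed.

(* An end point of an arc has a zero coordinate, so it is reached by one of the
   directions that do not depend on the objective. *)
Lemma bdry_dir j s e1 e2 : sgn1 s -> 0 < sqnorm b -> detc a b != 0 -> cone a b s e1 e2 ->
  0 < s * den a b e1 e2 -> bdry a b e1 e2 -> j <= dot2 c (arcw e1 e2) ->
  exists2 v, v \in vdirs a b & good_dir j v.
Proof.
move=> s1 bb0 dc ce sd bd jw.
have [fe tight] := feas2_arc s1 bb0 ce sd.
have [k bk] := sqnorm_gt0_ex bb0.
(* The solutions of a nontrivial equation in two unknowns form the line through [(v, - u)]. *)
have ratio (u v x y : R) : (u != 0) || (v != 0) -> u * x + v * y = 0 ->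
    exists t, x = t * v /\ y = t * - u.
  have [->|vn] := eqVneq v 0.
    rewrite orbF mul0r addr0 => un /eqP; rewrite mulf_eq0 (negPf un) => /eqP ->.
    by exists (- (y / u)); split; [rewrite mulr0|field].
  move=> _ h; exists (x / v); split; first by field.
  apply: (mulfI vn); transitivity (- (u * x)); first by move: h; lra.
  by field.
have good t v : arcdir a b e1 e2 = scaleb t v -> good_dir j v.
  move=> E; exists (sqnorm b / den a b e1 e2 * t), k.
  have -> : scaleb (sqnorm b / den a b e1 e2 * t) v = arcw e1 e2.
    by rewrite arcwE E scalebA.
  by split=> //; exact: feasb_ten.
case: bd => h.
- exists (arcdir a b 0 1); first by rewrite !inE eqxx ?orbT.
  apply: (good (e2 ^+ 2)); rewrite -arcdirZ mulr0 mulr1 h //.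
- exists (arcdir a b 1 0); first by rewrite !inE eqxx ?orbT.
  apply: (good (e1 ^+ 2)); rewrite -arcdirZ mulr0 mulr1 h //.
- have cn : (e12 (cross a b) != 0) || (e22 (cross a b) != 0).
    apply: contraNT dc; rewrite negb_or !negbK => /andP[/eqP h1 /eqP h2].
    by rewrite /detc h1 h2 mulr0 mul0r subrr.
  have [t [E1 E2]] := ratio _ _ _ _ cn h.
  exists (ten (e22 (cross a b)) (- e12 (cross a b)) 0 1); first by rewrite !inE eqxx ?orbT.
  apply: (good (t * - g1 a b e1 e2)).
  by rewrite /arcdir h /ten /scaleb /= E1 E2; congr Blk; rewrite /cross /=; ring.
have cn : (e11 (cross a b) != 0) || (e21 (cross a b) != 0).
  apply: contraNT dc; rewrite negb_or !negbK => /andP[/eqP h1 /eqP h2].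
  by rewrite /detc h1 h2 mulr0 mul0r subrr.
have [t [E1 E2]] := ratio _ _ _ _ cn h.
exists (ten (e21 (cross a b)) (- e11 (cross a b)) 1 0); first by rewrite !inE eqxx ?orbT.
apply: (good (t * g2 a b e1 e2)).
by rewrite /arcdir h /ten /scaleb /= E1 E2; congr Blk; rewrite /cross /=; ring.
Qed.

(** Cramer's rule makes the two-entry shapes multiples of fixed directions. On an arc, either an end
    has objective at least [j], or the form is negative at both ends and nonnegative at the given
    point. *)
Lemma block_analysis j p1 p2 q1 q2 : term2 a b p1 p2 q1 q2 ->
  feas2 a b p1 p2 q1 q2 -> j <= dot2 c (ten p1 p2 q1 q2) ->
  (exists2 v, v \in vdirs a b & good_dir j v) \/
  arc_case j.
Proof.
move=> T /feasb_ten; case: T.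
- move=> [-> -> q10 [-> [k [ak tk]]]] f jw; left.
  exists (ten 1 0 1 0); first by rewrite !inE eqxx ?orbT.
  have E : scaleb q1 (ten 1 0 1 0) = ten 1 0 q1 0.
    by rewrite /scaleb /ten /=; congr Blk; ring.
  exists q1, k; rewrite E; split=> //.
  by rewrite -tk /dot2 /ten /= !(mulr0, mul0r, addr0) mul1r mulf_neq0 // gt_eqF.
- move=> [[-> ->] [q10 q20] tight rd] f jw; left.
  exists (arcdir a b 1 0); first by rewrite !inE eqxx ?orbT.
  have bt := tight true; have bf := tight false; rewrite /dot2 /= in bt bf.
  set r := (X in X != 0) in rd.
  have q1E : q1 = - r^-1 * g2 a b 1 0.
    by rewrite -[LHS](mulKf rd) /r /g2 /= -bt -bf; ring.
  have q2E : q2 = - r^-1 * - g1 a b 1 0.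
    by rewrite -[LHS](mulKf rd) /r /g1 /= -bt -bf; ring.
  have [k bk] : exists k, b k != 0.
    apply: contrapT => h.
    have z k : b k = 0 by apply/eqP; apply: contraT => nk; case: h; exists k.
    by move: q10; rewrite q1E /g2 /= !z !(mul0r, mulr0, addr0, subr0) ltxx.
  have E : scaleb (- r^-1) (arcdir a b 1 0) = ten 1 0 q1 q2.
    by rewrite /scaleb /arcdir /ten /= q1E q2E; congr Blk; ring.
  by exists (- r^-1), k; rewrite E.
- move=> [[p10 p20] [-> ->] tight cd] f jw; left.
  exists (ten (e21 (cross a b)) (- e11 (cross a b)) 1 0); first by rewrite !inE eqxx ?orbT.
  have bt := tight true; have bf := tight false; rewrite /dot2 /= in bt bf.
  set r := (X in X != 0) in cd.
  have p1E : p1 = - r^-1 * e21 (cross a b).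
    by rewrite -[LHS](mulKf cd) /r /= -bt -bf; ring.
  have p2E : p2 = - r^-1 * - e11 (cross a b).
    by rewrite -[LHS](mulKf cd) /r /= -bt -bf; ring.
  have [k bk] : exists k, b k != 0.
    apply: contrapT => h.
    have z k : b k = 0 by apply/eqP; apply: contraT => nk; case: h; exists k.
    by move: p10; rewrite p1E /= !z !(mul0r, mulr0, addr0, subr0) ltxx.
  have E : scaleb (- r^-1) (ten (e21 (cross a b)) (- e11 (cross a b)) 1 0) = ten p1 p2 1 0.
    by rewrite /scaleb /ten /= p1E p2E; congr Blk; rewrite /cross /=; ring.
  by exists (- r^-1), k; rewrite E.
move=> [pp qq tight rd cd] f jw.
have [rho ap] := term4_arcpoint pp qq tight rd cd.
have [s [e1 [e2 [f1 [f2 [s1 srho ar [be bf] [l [m [l0 m0 p1E p2E]]]]]]]]] :=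
  arc_exists bM ap.
case: ap => _ _ q1E q2E [rd' bb0 dc].
case: (ar) => ce cf _ dpos _.
have de : 0 < s * den a b e1 e2.
  by have := dpos 1 0 ler01 (lexx _); rewrite !mul1r !mul0r !addr0 ltr01; apply.
have df : 0 < s * den a b f1 f2.
  by have := dpos 0 1 (lexx _) ler01; rewrite !mul1r !mul0r !add0r ltr01; apply.
have [je|ej] := leP j (dot2 c (arcw e1 e2)); first by left; exact: (bdry_dir s1 bb0 dc ce de be je).
have [jf|fj] := leP j (dot2 c (arcw f1 f2)); first by left; exact: (bdry_dir s1 bb0 dc cf df bf jf).
right; exists s, e1, e2, f1, f2, l, m => /=.
have dp : 0 < s * den a b p1 p2.
  by rewrite p1E p2E dpos ?ltW // addr_gt0.
split=> //.
  by rewrite !qform_arcw ?(den_neq0 de) ?(den_neq0 df) // !mulrA;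
    split; rewrite pmulr_rlt0 // subr_lt0.
rewrite -p1E -p2E qform_arcw ?(den_neq0 dp) // mulrA mulr_ge0 ?(ltW dp) // subr_ge0.
apply: le_trans jw _; rewrite /arcw.
by rewrite -rd' mulfK ?(den_neq0 dp) // -q1E -q2E.
Qed.

(** The vertex lies in the cone and the form takes the value [- qA * disc] there up to sign [s],
    which is nonnegative. Since [arcdir] is homogeneous of degree 2, the sign of its argument
    cancels. *)
Lemma arc_vertex j : arc_case j ->
  good_dir j (arcvertex a b c j).
Proof.
move=> [s [e1 [e2 [f1 [f2 [l [m [[s1 bb0] ar [l0 m0] [qe qf] qp]]]]]]]].
case: ar => ce cf dlt dpos _.
case: (ce) => e10 e20 _ _; case: (cf) => f10 f20 _ _.
have ss : s * s = 1 by case: s1 => ->; ring.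
have qs x y : s * qform a b c j x y = s * qA a b c j * x ^+ 2 +
    s * qB a b c j * (x * y) + s * qC a b c j * y ^+ 2 by rewrite qformE; ring.
rewrite qs in qe; rewrite qs in qf; rewrite qs in qp.
have [[x [y [x0 y0 xE yE]]] qa disc _] :=
  quad_vertex e10 e20 f10 f20 dlt l0 m0 qe qf qp.
have cz := cone_comb ce cf (ltW x0) (ltW y0).
have dz := dpos x y (ltW x0) (ltW y0) (addr_gt0 x0 y0).
rewrite -xE -yE in cz dz.
have [fz tight] := feas2_arc s1 bb0 cz dz.
have [k bk] := sqnorm_gt0_ex bb0.
have E : arcdir a b (s * qB a b c j) (- (2 * (s * qA a b c j))) = arcvertex a b c j.
  transitivity (scaleb (s ^+ 2) (arcvertex a b c j)).
    by rewrite /arcvertex -arcdirZ; f_equal; ring.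
  by rewrite /scaleb expr2 ss !mul1r; case: arcvertex.
exists (sqnorm b / den a b (s * qB a b c j) (- (2 * (s * qA a b c j)))), k.
rewrite -E -arcwE; split=> //; [exact: feasb_ten|].
rewrite -subr_ge0 -(pmulr_rge0 _ dz) -mulrA -qform_arcw ?(den_neq0 dz) //.
rewrite qformE.
have -> : s * (qA a b c j * (s * qB a b c j) ^+ 2 + qB a b c j *
   (s * qB a b c j * - (2 * (s * qA a b c j))) +
   qC a b c j * (- (2 * (s * qA a b c j))) ^+ 2) =
  - (s * qA a b c j) * ((s * qB a b c j) ^+ 2 - 4 * (s * qA a b c j) * (s * qC a b c j)).
  transitivity (s * s * s * (- qA a b c j) * (qB a b c j ^+ 2 - 4 * qA a b c j * qC a b c j)).
    by ring.
  by ring.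
by rewrite mulr_ge0 // oppr_ge0 ltW.
Qed.

(* Values above the maximum are not attained on the arc, so the quadratic form
   at the maximum has a double root. *)
Lemma arc_disc v : arc_case v ->
  (forall p1 p2 q1 q2, feas2 a b p1 p2 q1 q2 -> dot2 c (ten p1 p2 q1 q2) <= v) ->
  let disc j := qB a b c j ^+ 2 - 4 * qA a b c j * qC a b c j in
  disc v = 0 /\ exists j, disc j != 0.
Proof.
move=> ac vmax disc.
have gv := arc_vertex ac.
case: ac => [s [e1 [e2 [f1 [f2 [l [m [[s1 bb0] ar [l0 m0] [qe qf] qp]]]]]]]].
case: ar => ce cf dlt dpos _.
case: (ce) => e10 e20 _ _; case: (cf) => f10 f20 _ _.
have ss : s * s = 1 by case: s1 => ->; ring.
have qs j x y : s * qform a b c j x y = s * qA a b c j * x ^+ 2 +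
    s * qB a b c j * (x * y) + s * qC a b c j * y ^+ 2 by rewrite qformE; ring.
have ds j : (s * qB a b c j) ^+ 2 - 4 * (s * qA a b c j) * (s * qC a b c j) = disc j.
  by transitivity (s * s * disc j); [rewrite /disc; ring | rewrite ss mul1r].
split; last first.
  have de : 0 < s * den a b e1 e2.
    by have := dpos 1 0 ler01 (lexx _); rewrite !mul1r !mul0r !addr0 ltr01; apply.
  have df : 0 < s * den a b f1 f2.
    by have := dpos 0 1 (lexx _) ler01; rewrite !mul1r !mul0r !add0r ltr01; apply.
  have dp := dpos l m (ltW l0) (ltW m0) (addr_gt0 l0 m0).
  (* Small enough that both ends stay below the level [v - ep]; the interior value then exceeds this
     level strictly, so the discriminant is positive there. *)
  pose ep := Num.min (- (s * qform a b c v e1 e2) / (s * den a b e1 e2) / 2)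
                     (- (s * qform a b c v f1 f2) / (s * den a b f1 f2) / 2).
  have ep0 : 0 < ep.
    by rewrite lt_min !divr_gt0 // oppr_gt0.
  have qj x y : s * qform a b c (v - ep) x y = s * qform a b c v x y + ep * (s * den a b x y).
    by rewrite /qform; ring.
  exists (v - ep).
  have h u1 u2 : s * qform a b c v u1 u2 < 0 -> 0 < s * den a b u1 u2 ->
      ep <= - (s * qform a b c v u1 u2) / (s * den a b u1 u2) / 2 ->
      s * qform a b c (v - ep) u1 u2 < 0.
    move=> qu du; rewrite ler_pdivlMr // ler_pdivlMr // => le.
    by rewrite qj; lra.
  have qe' := h _ _ qe de (_ : ep <= _).
  have qf' := h _ _ qf df (_ : ep <= _).
  move: qe' qf'; rewrite /ep !ge_min !lexx orbT -/ep => /(_ isT) qe' /(_ isT) qf'.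
  have qp' : 0 < s * qform a b c (v - ep) (l * e1 + m * f1) (l * e2 + m * f2).
    by rewrite qj ltr_wpDl // mulr_gt0.
  have qp'' := ltW qp'.
  rewrite qs in qe'; rewrite qs in qf'; rewrite qs in qp'; rewrite qs in qp''.
  have [_ _ _ /(_ qp')] := quad_vertex e10 e20 f10 f20 dlt l0 m0 qe' qf' qp''.
  by rewrite ds => /lt0r_neq0.
rewrite qs in qe; rewrite qs in qf; rewrite qs in qp.
have [[x [y [x0 y0 xE yE]]] qa ge0 _] :=
  quad_vertex e10 e20 f10 f20 dlt l0 m0 qe qf qp.
rewrite ds in ge0.
have cz := cone_comb ce cf (ltW x0) (ltW y0).
have dz := dpos x y (ltW x0) (ltW y0) (addr_gt0 x0 y0).
rewrite -xE -yE in cz dz.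
have [/vmax fz _] := feas2_arc s1 bb0 cz dz.
(* Maximality of [v] makes the form nonpositive at the vertex, which gives the opposite sign for the
   discriminant. *)
apply/eqP; rewrite eq_le ge0 andbT -(nmulr_rge0 _ qa) -oppr_le0.
have -> : - (s * qA a b c v * disc v) =
  s * qform a b c v (s * qB a b c v) (- (2 * (s * qA a b c v))).
  by rewrite qs -ds; ring.
rewrite qform_arcw ?(den_neq0 dz) // mulrA pmulr_rle0 // subr_le0.
exact: fz.
Qed.

End BlockAnalysis.

(** * Candidate solutions *)

Section Candidates.
Variables (K : comNzRingType) (a : bool -> blk K) (b : bool -> K) (c : blk K).

Definition dirs j := rcons (vdirs a b) (arcvertex a b c j).

(* Where the ray of [v] meets the hyperplane of constraint [k]: a block and a
   common denominator, squared to be nonnegative. *)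
Definition cand_of (v : blk K) k :=
  (scaleb (b k * dot2 (a k) v) v, dot2 (a k) v * dot2 (a k) v).

(** The zero block stands for the zero matrix. Either constraint may be the one with [b k != 0] that
    fixes the scale, so both are tried. *)
Definition cands j : seq (blk K * K) :=
  (Blk 0 0 0 0, 1) :: flatten [seq [:: cand_of v true; cand_of v false] | v <- dirs j].

Lemma dirs_ten j v : v \in dirs j -> exists p1 p2 q1 q2, v = ten p1 p2 q1 q2.
Proof.
rewrite mem_rcons !inE.
by do ![case/orP => [/eqP->|]|move=> /eqP->]; do 4 eexists; reflexivity.
Qed.

Lemma cands_ten j n d : (n, d) \in cands j ->
  exists p1 p2 q1 q2, n = ten p1 p2 q1 q2.
Proof.
rewrite inE => /orP[/eqP[-> _]|/flatten_mapP[v /dirs_ten[p1 [p2 [q1 [q2 ->]]]]]].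
  by exists 0, 0, 0, 0; rewrite /ten !mul0r.
have H k z : z = cand_of (ten p1 p2 q1 q2) k ->
    exists p1 p2 q1 q2, z.1 = ten p1 p2 q1 q2.
  move=> ->; set t := b k * dot2 (a k) (ten p1 p2 q1 q2).
  exists (t * p1), (t * p2), q1, q2.
  by rewrite /cand_of /ten /scaleb /=; congr Blk; rewrite mulrA.
by rewrite !inE => /orP[] /eqP/H.
Qed.

End Candidates.

(** Feasibility and objective of the block [z.1 / z.2] with denominators cleared, so that over the
    integers it is decided without division. *)
Definition cand_ok (R : numDomainType) (a : bool -> blk R) (b : bool -> R) (c : blk R) j
    (z : blk R * R) :=
  [/\ 0 < z.2, 0 <= e11 z.1 /\ 0 <= e12 z.1, 0 <= e21 z.1 /\ 0 <= e22 z.1,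
      forall k, dot2 (a k) z.1 <= b k * z.2 & j * z.2 <= dot2 c z.1].

Lemma good_dir_cand_ok (R : rcfType) (a : bool -> blk R) b c j v :
  v \in dirs a b c j -> good_dir a b c j v ->
  exists z, z \in cands a b c j /\ cand_ok a b c j z.
Proof.
move=> vd [t [k [[w1 w2 wa] bk tk jw]]].
pose d := dot2 (a k) v.
have tkE : t * d = b k by rewrite /d -dot2Z.
have d0 : d != 0 by apply: contraNneq bk => h; rewrite -tkE h mulr0.
have dd : 0 < d * d by rewrite -expr2 exprn_even_gt0.
(* The candidate is the good block times the square of [d], which is also its recorded
   denominator. *)
have E : (cand_of a b v k).1 = scaleb (d * d) (scaleb t v).
  by rewrite /cand_of /= -/d -tkE scalebA; congr scaleb; ring.
exists (cand_of a b v k); split.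
  rewrite inE; apply/orP; right; apply/flatten_mapP; exists v => //.
  by rewrite !inE; case: (k); rewrite eqxx ?orbT.
split=> //; rewrite ?E.
- by case: w1 => w11 w12; split; apply: mulr_ge0 => //; exact: ltW.
- by case: w2 => w11 w12; split; apply: mulr_ge0 => //; exact: ltW.
- by move=> l; rewrite dot2Z mulrC ler_wpM2r // ltW.
- by rewrite dot2Z mulrC ler_wpM2l // ltW.
Qed.

(** * Completeness of the candidates and size of the maximum *)

Section Global.
Variables (R : realType) (m n : nat) (A : bool -> 'M[R]_(m, n)) (b : bool -> R).
Variables (C : 'M[R]_(m, n)) (M : R).
Hypothesis bdU : entry_bound A b M.
Local Notation U := (r1set A b).
Local Notation sub i i' l l' := (fun k => subblk (A k) i i' l l').

Lemma U_ten i i' l l' (v : blk R) : feasb (sub i i' l l') b v ->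
  (exists p1 p2 q1 q2, v = ten p1 p2 q1 q2) -> U (embed i i' l l' v).
Proof.
move=> [[v11 v12] [v21 v22] va] [p1 [p2 [q1 [q2 E]]]]; split.
- by move=> r s; rewrite /embed !mxE !addr_ge0 // mulr_ge0.
- by rewrite mxdot_embed.
- by rewrite mxdot_embed.
- by rewrite E embed_ten outer_rank.
Qed.

Lemma term2_feas2 a p1 p2 q1 q2 : term2 a b p1 p2 q1 q2 ->
  (forall k, dot2 (a k) (ten p1 p2 q1 q2) <= b k) -> feas2 a b p1 p2 q1 q2.
Proof.
move=> T h; have [] : (0 <= p1 /\ 0 <= p2) /\ (0 <= q1 /\ 0 <= q2); last by split.
case: T.
- by move=> [-> -> /ltW q10 [-> _]].
- by move=> [[-> ->] [/ltW q10 /ltW q20] _ _].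
- by move=> [[/ltW p10 /ltW p20] [-> ->] _ _].
- by move=> [[/ltW p10 /ltW p20] [/ltW q10 /ltW q20] _ _ _].
Qed.

Lemma bound2_sub i i' l l' : bound2 (sub i i' l l') b (M *+ 4).
Proof.
move=> p1 p2 q1 q2 f; have := U_of_feas2 f => /bdU h.
case: f => [[p10 p20] [q10 q20] _].
have e r c : (p1 *+ (r == i) + p2 *+ (r == i')) * (q1 *+ (c == l) + q2 *+ (c == l')) <= M.
  by have := h r c; rewrite embed_ten mxE.
have le r c p q : p <= p1 *+ (r == i) + p2 *+ (r == i') -> 0 <= p ->
    q <= q1 *+ (c == l) + q2 *+ (c == l') -> 0 <= q -> p * q <= M.
  by move=> h1 h2 h3 h4; apply: le_trans (e r c); apply: ler_pM.
have := le i l p1 q1; have := le i l' p1 q2.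
have := le i' l p2 q1; have := le i' l' p2 q2.
rewrite !eqxx !mulr1n !lerDl !lerDr !mulrn_wge0 //.
move=> /(_ isT p20 isT q20) h1 /(_ isT p20 isT q10) h2.
move=> /(_ isT p10 isT q20) h3 /(_ isT p10 isT q10) h4.
have -> : M *+ 4 = M + M + M + M by ring.
have -> : (p1 + p2) * (q1 + q2) = p1 * q1 + p1 * q2 + p2 * q1 + p2 * q2 by ring.
by rewrite !lerD.
Qed.

(** If no terminal block reached [j], the convex set of matrices with objective less than [j] would
    contain all of U by the reduction. *)
Lemma terminal_ge W j : U W -> j <= mxdot C W ->
  (U 0 /\ j <= 0) \/ exists i i' l l',
    (exists2 v, v \in vdirs (sub i i' l l') b
       & good_dir (sub i i' l l') b (subblk C i i' l l') j v) \/
    arc_case (sub i i' l l') b (subblk C i i' l l') j.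
Proof.
move=> UW jW; apply: contrapT => h.
suff /(_ W UW) : U `<=` [set V | mxdot C V < j] by rewrite /= ltNge jW.
apply: (reduction bdU) => [V V' t /andP[t0 t1]|U0|i i' l l' p1 p2 q1 q2 T UV] /=.
- move=> h1 h2; rewrite mxdotD !mxdotZ.
  have [tz|tn] := eqVneq t 0; first by rewrite tz mul0r add0r subr0 mul1r.
  have tp : 0 < t by rewrite lt_neqAle eq_sym tn.
  have -> : j = t * j + (1 - t) * j by ring.
  by rewrite ltr_leD ?ltr_pM2l // ler_wpM2l ?subr_ge0 // ltW.
- by rewrite mxdot0 ltNge; apply/negP => j0; apply: h; left.
rewrite mxdot_embed ltNge; apply/negP => jV; apply: h; right.
exists i, i', l, l'; apply: (block_analysis (@bound2_sub i i' l l') T _ jV).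
apply: term2_feas2 T _ => k; rewrite -mxdot_embed.
by case: UV; case: k.
Qed.

Theorem cands_complete W j : (0 < m)%N -> (0 < n)%N -> U W -> j <= mxdot C W ->
  exists i i' l l', exists z,
    z \in cands (sub i i' l l') b (subblk C i i' l l') j /\
    cand_ok (sub i i' l l') b (subblk C i i' l l') j z.
Proof.
move=> m0 n0 UW jW.
case: (terminal_ge UW jW) => [[U0 j0]|[i [i' [l [l' [[v vd gv]|ac]]]]]].
- exists (Ordinal m0), (Ordinal m0), (Ordinal n0), (Ordinal n0), (Blk 0 0 0 0, 1).
  split; first by rewrite inE eqxx.
  have z x : dot2 x (Blk 0 0 0 0) = 0 :> R by rewrite /dot2 /= !mulr0 !addr0.
  split; rewrite /= ?ltr01 ?z ?mulr1 //.
  move=> k; rewrite z mulr1.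
  by case: U0 => _ + + _; rewrite !mxdot0; case: k.
- exists i, i', l, l'; apply: (good_dir_cand_ok _ gv).
  by rewrite mem_rcons inE vd orbT.
- exists i, i', l, l'; have gv := arc_vertex ac.
  by apply: (good_dir_cand_ok _ gv); rewrite mem_rcons inE eqxx.
Qed.

Lemma cands_sound i i' l l' z j :
  z \in cands (sub i i' l l') b (subblk C i i' l l') j ->
  cand_ok (sub i i' l l') b (subblk C i i' l l') j z ->
  let W := embed i i' l l' (scaleb z.2^-1 z.1) in U W /\ j <= mxdot C W.
Proof.
case: z => v d /cands_ten[p1 [p2 [q1 [q2 E]]]] [/= d0 [v1 v2] [v3 v4] va jv].
have d1 : 0 <= d^-1 by rewrite invr_ge0 ltW.
split; last by rewrite mxdot_embed dot2Z mulrC ler_pdivlMr.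
apply: U_ten.
  split; [by split; rewrite mulr_ge0|by split; rewrite mulr_ge0|].
  by move=> k; rewrite dot2Z mulrC ler_pdivrMr.
exists (d^-1 * p1), (d^-1 * p2), q1, q2.
by rewrite E /ten /scaleb /=; congr Blk; rewrite mulrA.
Qed.

Variable N : R.
Hypotheses (N2 : 2 <= N) (bN : forall k, b k \is a Num.int /\ `|b k| <= N).
Hypothesis AN : forall k i j, A k i j \is a Num.int /\ `|A k i j| <= N.
Hypothesis CN : forall i j, C i j \is a Num.int /\ `|C i j| <= N.

(** The Cauchy root bound: a nonzero integral leading coefficient has absolute value at least 1. The
    point [t] witnesses that the polynomial is not zero. *)
Lemma cauchy_bound (P0 P1 P2 v t : R) :
  P1 \is a Num.int -> P2 \is a Num.int ->
  P0 + P1 * v + P2 * v ^+ 2 = 0 -> P0 + P1 * t + P2 * t ^+ 2 != 0 ->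
  `|v| <= `|P0| + `|P1| + `|P2|.
Proof.
move=> i1 i2 hv ht.
have [z2|n2] := eqVneq P2 0.
  have [z1|n1] := eqVneq P1 0.
    move: hv ht; rewrite z1 z2 !mul0r !addr0 => ->; by rewrite eqxx.
  have h : `|P1| * `|v| = `|P0|.
    rewrite -normrM -[RHS]normrN; congr (`|_|).
    by move: hv; rewrite z2 mul0r addr0; lra.
  have : 1 * `|v| <= `|P0| by rewrite -h ler_wpM2r // norm_intr_ge1.
  have := normr_ge0 P1; have := normr_ge0 P2; lra.
have p2 : 1 <= `|P2| by rewrite norm_intr_ge1.
have [v1|v1] := leP `|v| 1.
  have := normr_ge0 P1; have := normr_ge0 P0; lra.
have h : `|P2| * `|v| ^+ 2 <= `|P0| + `|P1| * `|v|.
  rewrite -normrX -normrM -normrM.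
  have -> : P2 * v ^+ 2 = - (P0 + P1 * v) by lra.
  by rewrite normrN ler_normD.
have : `|v| * `|v| <= (`|P0| + `|P1|) * `|v|.
  apply: le_trans (_ : `|P0| + `|P1| * `|v| <= _).
    by apply: le_trans h; rewrite -expr2 ler_peMl ?sqr_ge0.
  rewrite mulrDl lerD2r ler_peMr //; exact: ltW.
rewrite ler_pM2r; last by lra.
have := normr_ge0 P2; lra.
Qed.

Section OneBlock.
Variables (a : bool -> blk R) (c : blk R).

(** Integrality and size are carried together: sizes bound the coefficients from above, integrality
    bounds the nonzero ones away from 0. *)
Definition int_le (x y : R) := x \is a Num.int /\ `|x| <= y.
Definition blk_int_le (v : blk R) y :=
  [/\ int_le (e11 v) y, int_le (e12 v) y, int_le (e21 v) y & int_le (e22 v) y].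

Lemma iszD x y u v : int_le x u -> int_le y v -> int_le (x + y) (u + v).
Proof.
move=> [x1 x2] [y1 y2]; split; first by rewrite rpredD.
by apply: le_trans (ler_normD _ _) _; rewrite lerD.
Qed.

Lemma iszN x u : int_le x u -> int_le (- x) u.
Proof. by move=> [x1 x2]; split; rewrite ?rpredN ?normrN. Qed.

Lemma iszB x y u v : int_le x u -> int_le y v -> int_le (x - y) (u + v).
Proof. by move=> hx /iszN; apply: iszD. Qed.

Lemma iszM x y u v : int_le x u -> int_le y v -> int_le (x * y) (u * v).
Proof.
move=> [x1 x2] [y1 y2]; split; first by rewrite rpredM.
by rewrite normrM ler_pM.
Qed.

Lemma iszW x u v : u <= v -> int_le x u -> int_le x v.
Proof. by move=> uv [h1 h2]; split=> //; apply: le_trans uv. Qed.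

Lemma isz_dot2 v w x y : blk_int_le v x -> blk_int_le w y -> int_le (dot2 v w) (x * y *+ 4).
Proof.
move=> [v1 v2 v3 v4] [w1 w2 w3 w4].
have -> : x * y *+ 4 = x * y + x * y + x * y + x * y by ring.
by rewrite /dot2; do ?apply: iszD; apply: iszM.
Qed.

Lemma bisz_ten p1 p2 q1 q2 x y : int_le p1 x -> int_le p2 x -> int_le q1 y -> int_le q2 y ->
  blk_int_le (ten p1 p2 q1 q2) (x * y).
Proof. by move=> *; split; apply: iszM. Qed.

Lemma isz01 : int_le 0 1 /\ int_le 1 1.
Proof. by rewrite /int_le !normr0 normr1 rpred0 rpred1 ler01 lexx. Qed.

Hypotheses (aN : forall k, blk_int_le (a k) N) (cN : blk_int_le c N).

Lemma isz_cross : blk_int_le (cross a b) (N ^+ 2 *+ 2).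
Proof.
have [a1 a2 a3 a4] := aN true; have [a5 a6 a7 a8] := aN false.
by split; rewrite mulr2n expr2; apply: iszB; apply: iszM.
Qed.

Lemma isz_arcdir x1 x2 : int_le x1 1 -> int_le x2 1 -> blk_int_le (arcdir a b x1 x2) (N ^+ 2 *+ 4).
Proof.
move=> h1 h2; have [k1 k2 k3 k4] := isz_cross.
have -> : N ^+ 2 *+ 4 = 1 * (N ^+ 2 *+ 2 * 1 + N ^+ 2 *+ 2 * 1) by ring.
by apply: bisz_ten => //; [|apply: iszN]; rewrite /g1 /g2; apply: iszD; apply: iszM.
Qed.

Lemma isz_sqnorm : int_le (sqnorm b) (N ^+ 2 *+ 2).
Proof. by rewrite mulr2n /sqnorm !expr2; apply: iszD; apply: iszM; apply: bN. Qed.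

Lemma N0 : 0 <= N. Proof. by apply: le_trans N2; rewrite ler0n. Qed.

Lemma isz_qnum x1 x2 : int_le x1 1 -> int_le x2 1 ->
  int_le (sqnorm b * dot2 c (arcdir a b x1 x2)) (N ^+ 5 *+ 32).
Proof.
move=> h1 h2; have := iszM isz_sqnorm (isz_dot2 cN (isz_arcdir h1 h2)).
by apply: iszW; rewrite le_eqVlt; apply/orP; left; apply/eqP; ring.
Qed.

Lemma isz_qden x1 x2 : int_le x1 1 -> int_le x2 1 -> int_le (den a b x1 x2) (N ^+ 5 *+ 32).
Proof.
move=> h1 h2.
have h := iszD (iszM (bN true) (isz_dot2 (aN true) (isz_arcdir h1 h2)))
               (iszM (bN false) (isz_dot2 (aN false) (isz_arcdir h1 h2))).
apply: iszW h; rewrite -[leRHS]mulr_natr.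
have -> : N * (N * (N ^+ 2 *+ 4) *+ 4) + N * (N * (N ^+ 2 *+ 4) *+ 4) = N ^+ 4 * 32%:R by ring.
rewrite ler_wpM2r // [leRHS]exprS ler_peMl ?exprn_ge0 ?N0 //; move: N2; lra.
Qed.

(** [dot2 (a k) v] is a nonzero integer, so [|t| <= |b k| <= N]; the value is then at most 16
    N^4. *)
Lemma vdir_bound v t k : v \in vdirs a b -> dot2 (a k) (scaleb t v) = b k -> b k != 0 ->
  `|dot2 c (scaleb t v)| <= N ^+ 27.
Proof.
move=> vd; rewrite !dot2Z => tk bk.
have N1 : 1 <= N by move: N2; lra.
have bv : blk_int_le v (N ^+ 2 *+ 4).
  have [i0 i1] := isz01; have [k1 k2 k3 k4] := isz_cross.
  have h2 x : int_le x (N ^+ 2 *+ 2) -> int_le x (N ^+ 2 *+ 4).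
    by apply: iszW; rewrite ler_wpMn2l ?sqr_ge0.
  move: vd; rewrite !inE; do ![case/orP => [/eqP->|]|move=> /eqP->].
  - have -> : N ^+ 2 *+ 4 = 1 * (N ^+ 2 *+ 4) by rewrite mul1r.
    have h x : int_le x 1 -> int_le x (N ^+ 2 *+ 4).
      apply: iszW; rewrite -mulr_natr; have : 1 <= N ^+ 2 by rewrite exprn_ege1.
      by lra.
    by apply: bisz_ten => //; apply: h.
  - exact: isz_arcdir.
  - exact: isz_arcdir.
  - by rewrite -[X in blk_int_le _ X]mulr1; apply: bisz_ten => //; apply: h2 => //; apply: iszN.
  by rewrite -[X in blk_int_le _ X]mulr1; apply: bisz_ten => //; apply: h2 => //; apply: iszN.
have [id _] := isz_dot2 (aN k) bv.
have [_ cv] := isz_dot2 cN bv.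
have d0 : dot2 (a k) v != 0 by apply: contraNneq bk => h; rewrite -tk h mulr0.
have tN : `|t| <= N.
  have [_ h] := bN k; apply: le_trans h; rewrite -tk normrM.
  by rewrite ler_peMr // norm_intr_ge1.
rewrite normrM; apply: le_trans (_ : N * (N * (N ^+ 2 *+ 4) *+ 4) <= _).
  by rewrite ler_pM.
have -> : N * (N * (N ^+ 2 *+ 4) *+ 4) = 2 ^+ 4 * N ^+ 4 by ring.
have -> : N ^+ 27 = N ^+ 23 * N ^+ 4 by rewrite -exprD.
rewrite ler_wpM2r ?exprn_ge0 ?N0 //.
apply: le_trans (_ : N ^+ 4 <= _); first by rewrite lerXn2r ?nnegrE ?N0.
by rewrite ler_eXn2l //; move: N2; lra.
Qed.

(** The maximum over an arc is a root of the discriminant, a nonzero polynomial of degree at most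
    two in the level, with integer coefficients [P0], [P1], [P2]. *)
Lemma arc_bound v : arc_case a b c v ->
  (forall p1 p2 q1 q2, feas2 a b p1 p2 q1 q2 -> dot2 c (ten p1 p2 q1 q2) <= v) ->
  `|v| <= N ^+ 27.
Proof.
move=> ac vmax; have [hv [t ht]] := arc_disc ac vmax.
have [i0 i1] := isz01.
pose X := N ^+ 5 *+ 32.
pose n1 := sqnorm b * dot2 c (arcdir a b 1 0); pose n2 := sqnorm b * dot2 c (arcdir a b 0 1).
pose n3 := sqnorm b * dot2 c (arcdir a b 1 1).
pose d1 := den a b 1 0; pose d2 := den a b 0 1; pose d3 := den a b 1 1.
have hn1 : int_le n1 X by apply: isz_qnum.
have hn2 : int_le n2 X by apply: isz_qnum.
have hn3 : int_le n3 X by apply: isz_qnum.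
have hd1 : int_le d1 X by apply: isz_qden.
have hd2 : int_le d2 X by apply: isz_qden.
have hd3 : int_le d3 X by apply: isz_qden.
pose P0 := (n3 - n1 - n2) * (n3 - n1 - n2) - 4 * (n1 * n2).
pose P1 := 4 * (n1 * d2) + 4 * (d1 * n2) - 2 * ((n3 - n1 - n2) * (d3 - d1 - d2)).
pose P2 := (d3 - d1 - d2) * (d3 - d1 - d2) - 4 * (d1 * d2).
have discE j : qB a b c j ^+ 2 - 4 * qA a b c j * qC a b c j =
    P0 + P1 * j + P2 * j ^+ 2.
  by rewrite /P0 /P1 /P2 /qB /qA /qC /qform -/n1 -/n2 -/n3 -/d1 -/d2 -/d3; ring.
rewrite !discE in hv ht.
have i4 : int_le 4 4 by split; rewrite ?normr_nat // rpred_nat.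
have i2 : int_le 2 2 by split; rewrite ?normr_nat // rpred_nat.
have hP0 : int_le P0 ((X + X + X) * (X + X + X) + 4 * (X * X)).
  by apply: iszB; apply: iszM => //; [do ?apply: iszB|do ?apply: iszB|apply: iszM].
have hP1 : int_le P1 (4 * (X * X) + 4 * (X * X) + 2 * ((X + X + X) * (X + X + X))).
  apply: iszB; first by apply: iszD; do 2 apply: iszM => //.
  by do 2 apply: iszM => //; do ?apply: iszB.
have hP2 : int_le P2 ((X + X + X) * (X + X + X) + 4 * (X * X)).
  by apply: iszB; apply: iszM => //; [do ?apply: iszB|do ?apply: iszB|apply: iszM].
case: hP0 hP1 hP2 => [_ h0] [h1i h1] [h2i h2].
apply: le_trans (cauchy_bound h1i h2i hv ht) _.
(* The three coefficients are at most 13 X^2, 26 X^2 and 13 X^2, together less than 128 X^2 = 2^17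
   N^10; the constant is absorbed by N^17 since [N >= 2]. *)
apply: le_trans (_ : 2 ^+ 17 * N ^+ 10 <= _).
  have -> : 2 ^+ 17 * N ^+ 10 = 128 * (X * X).
    by rewrite /X; ring.
  have X0 : 0 <= X * X by rewrite -expr2 sqr_ge0.
  lra.
have -> : N ^+ 27 = N ^+ 17 * N ^+ 10 by rewrite -exprD.
rewrite ler_wpM2r ?exprn_ge0 ?N0 //.
by rewrite lerXn2r ?nnegrE ?N0.
Qed.
End OneBlock.

Theorem max_bound V : U V -> (forall W, U W -> mxdot C W <= mxdot C V) ->
  `|mxdot C V| <= N ^+ 27.
Proof.
move=> UV Vmax; set v := mxdot C V in Vmax *.
have bs (B : 'M[R]_(m, n)) i i' l l' : (forall i j, int_le (B i j) N) ->
  blk_int_le (subblk B i i' l l') N by move=> h; split; apply: h.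
have maxw i i' l l' w : feasb (sub i i' l l') b w ->
    (exists p1 p2 q1 q2, w = ten p1 p2 q1 q2) -> dot2 (subblk C i i' l l') w <= v.
  by move=> fw tw; rewrite -mxdot_embed; apply: Vmax; apply: U_ten.
case: (terminal_ge UV (lexx v)) => [[U0 v0]|[i [i' [l [l' [[w wd [t [k [fw bk tk vw]]]]|ac]]]]]].
- have -> : v = 0.
    by apply/eqP; rewrite eq_le v0 -(mxdot0 C) Vmax.
  by rewrite normr0 exprn_ge0 // N0.
- have wten : exists p1 p2 q1 q2, scaleb t w = ten p1 p2 q1 q2.
    have [|p1 [p2 [q1 [q2 ->]]]] := @dirs_ten _ (sub i i' l l') b (subblk C i i' l l') 0 w.
      by rewrite mem_rcons inE wd orbT.
    by exists (t * p1), (t * p2), q1, q2; rewrite /ten /scaleb /=; congr Blk; rewrite mulrA.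
  have -> : v = dot2 (subblk C i i' l l') (scaleb t w).
    by apply/eqP; rewrite eq_le vw maxw.
  by apply: (vdir_bound _ _ wd tk bk) => [k'|]; apply: bs => ? ?; [exact: AN|exact: CN].
apply: (arc_bound _ _ ac) => [k||p1 p2 q1 q2 f];
  [by apply: bs => ? ?; exact: AN|by apply: bs => ? ?; exact: CN|].
by apply: maxw; [exact: feasb_ten|do 4 eexists; reflexivity].
Qed.

End Global.

(** * Attainment of the maximum *)

Lemma bounded_entry_bound (R : realType) m n (A : bool -> 'M[R]_(m, n)) b :
  bounded_set (r1set A b) -> exists M, entry_bound A b M.
Proof.
(* Boundedness only speaks of numbers beyond [M], hence [M + 1]. *)
move=> [M [Mreal hM]]; exists (M + 1) => W UW i j.
apply: le_trans (ler_norm _) _; apply: le_trans (hM (M + 1) _ W UW); last first.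
  by rewrite ltrDl.
have /mapP[k Hk ->] : `|W i j| \in [seq `|W x.1 x.2| | x : 'I_m * 'I_n].
  by apply/mapP; exists (i, j) => //=; rewrite mem_enum.
by rewrite [leRHS]/Num.norm /= mx_normrE; apply/bigmax_geP; right => /=; exists k.
Qed.

Section Maximum.
Variables (R : realType) (m n : nat) (A : bool -> 'M[R]_(m, n)) (b : bool -> R).
Variables (C : 'M[R]_(m, n)) (M : R).
Hypothesis bdU : entry_bound A b M.
Local Notation U := (r1set A b).

Lemma entry_continuous i j : continuous (fun v : 'rV[R]_(m * n) => vec_mx v i j).
Proof.
have -> : (fun v : 'rV[R]_(m * n) => vec_mx v i j) =
    (fun v : 'rV[R]_(m * n) => v 0 (mxvec_index i j)).
  by apply/funext => v; rewrite mxE.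
exact: coord_continuous.
Qed.

Lemma mxdot_continuous (B : 'M[R]_(m, n)) :
  continuous (fun v : 'rV[R]_(m * n) => mxdot B (vec_mx v)).
Proof.
apply: continuous_big => [|i _]; first exact: add_continuous.
apply: continuous_big => [|j _ v]; first exact: add_continuous.
apply: (continuousM (s := fun=> B i j)); first exact: cst_continuous.
exact: entry_continuous.
Qed.

(** Vanishing of the two-by-two minors expresses the rank condition by polynomial equations, so it
    defines a closed set. *)
Lemma minors_rank1 (W : 'M[R]_(m, n)) :
  (forall i i' j j', W i j * W i' j' = W i j' * W i' j) -> (\rank W <= 1)%N.
Proof.
move=> h; have [[i0 [j0 w0]]|nw] := pselect (exists i j, W i j != 0); last first.
  rewrite (_ : W = 0) ?mxrank0 //; apply/matrixP => i j; rewrite mxE.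
  by apply/eqP; apply: contraT => wn; case: nw; exists i, j.
rewrite (_ : W = outer (fun i => W i j0) (fun j => W i0 j / W i0 j0)) ?outer_rank //.
apply/matrixP => i j; rewrite mxE; apply: (mulIf w0).
by rewrite h; field.
Qed.

Lemma U_compact : compact [set v : 'rV[R]_(m * n) | U (vec_mx v)].
Proof.
have boxc : compact [set v : 'rV[R]_(m * n) | forall i, v ord0 i \in `[0, M]].
  apply: (@rV_compact _ _ (fun=> `[0, M]%classic)) => _; exact: segment_compact.
apply: subclosed_compact boxc _; last first.
  move=> v Uv k; case/mxvec_indexP: k => i j; rewrite in_itv /=.
  have -> : v ord0 (mxvec_index i j) = vec_mx v i j by rewrite mxE.
  by rewrite (bdU Uv) andbT; case: Uv.
have closed_lef (f : 'rV[R]_(m * n) -> R) c : continuous f -> closed [set v | f v <= c].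
  by move=> cf; apply: (preimage_closed _ (@closed_le _ c)) => x _; exact: cf.
have closed_eqf (f : 'rV[R]_(m * n) -> R) c : continuous f -> closed [set v | f v = c].
  by move=> cf; apply: (preimage_closed _ (@closed_eq _ c)) => x _; exact: cf.
rewrite (_ : mkset _ =
  (\bigcap_(p in [set: 'I_m * 'I_n]) [set v : 'rV[R]_(m * n) | - vec_mx v p.1 p.2 <= 0]) `&`
  ((\bigcap_(k in [set: bool]) [set v : 'rV[R]_(m * n) | mxdot (A k) (vec_mx v) <= b k]) `&`
   (\bigcap_(p in [set: 'I_m * 'I_m * ('I_n * 'I_n)])
      [set v : 'rV[R]_(m * n) | vec_mx v p.1.1 p.2.1 * vec_mx v p.1.2 p.2.2 -
         vec_mx v p.1.1 p.2.2 * vec_mx v p.1.2 p.2.1 = 0]))).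
  apply: closedI; last apply: closedI.
  - apply: closed_bigI => p _; apply: closed_lef => v.
    exact: (continuousN (@entry_continuous p.1 p.2 v)).
  - by apply: closed_bigI => k _; apply: closed_lef; exact: mxdot_continuous.
  - apply: closed_bigI => p _; apply: closed_eqf => v.
    exact: (continuousB
      (continuousM (@entry_continuous p.1.1 p.2.1 v) (@entry_continuous p.1.2 p.2.2 v))
      (continuousM (@entry_continuous p.1.1 p.2.2 v) (@entry_continuous p.1.2 p.2.1 v))).
apply/seteqP; split=> v /=.
  move=> [v0 vt vf vr]; split; first by move=> p _ /=; rewrite oppr_le0.
  split; first by case.
  by move=> p _ /=; apply/eqP; rewrite subr_eq0; apply/eqP; exact: rank1_minor.
move=> [v0 [vA vr]]; split.
- by move=> i j; have := v0 (i, j) I; rewrite /= oppr_le0.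
- exact: (vA true I).
- exact: (vA false I).
apply: minors_rank1 => i i' j j'; apply/eqP; rewrite -subr_eq0; apply/eqP.
exact: (vr (i, i', (j, j')) I).
Qed.

Lemma max_exists : U !=set0 ->
  exists2 V, U V & forall W, U W -> mxdot C W <= mxdot C V.
Proof.
move=> [W0 UW0].
have ne : [set v : 'rV[R]_(m * n) | U (vec_mx v)] !=set0.
  by exists (mxvec W0); rewrite /= mxvecK.
have [v vU vmax] := compact_EVT_max ne U_compact
  (continuous_subspaceT (@mxdot_continuous C)).
exists (vec_mx v); first by move: vU; rewrite inE.
move=> W UW; rewrite -(mxvecK W); apply: vmax.
by rewrite inE /= mxvecK.
Qed.

End Maximum.

(** * Cost of programs *)

Section Costs.

(** A growth degree: with registers of at most [B] bits, the value has at most [edeg e * B] bits.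
    Adding degrees, as for a product, covers all four operations. *)
Fixpoint edeg (e : expr) : nat :=
  match e with
  | Cst z => bits z
  | Get _ _ => 1
  | Op _ e1 e2 => edeg e1 + edeg e2
  end.

Fixpoint ecost (e : expr) : nat :=
  match e with
  | Cst z => bits z
  | Get _ i => (ecost i).+1
  | Op _ e1 e2 => ecost e1 + ecost e2 + (edeg e1 + edeg e2)
  end.

Fixpoint reads (P : pred nat) (e : expr) : bool :=
  match e with
  | Cst _ => true
  | Get a i => P a && reads P i
  | Op _ e1 e2 => reads P e1 && reads P e2
  end.

Definition bnd (P : pred nat) (B : nat) (s : memory) :=
  forall a i, P a -> (`|s a i|%N < 2 ^ B)%N.

Lemma bits_gt (z : int) : (`|z|%N < 2 ^ bits z)%N.
Proof. exact: trunc_log_ltn. Qed.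

Lemma bits_le (z : int) B : (0 < B)%N -> (`|z|%N < 2 ^ B)%N -> (bits z <= B)%N.
Proof.
move=> B0 h; rewrite /bits; have [->|z0] := posnP `|z|%N; first by rewrite trunc_log0.
rewrite -(ltn_exp2l _ _ (isT : 1 < 2)%N); apply: leq_ltn_trans h.
exact: trunc_logP.
Qed.

Lemma edeg_gt0 e : (0 < edeg e)%N.
Proof. by elim: e => //= o e1 h1 e2 h2; rewrite addn_gt0 h1. Qed.

(** Both powers are at least 2, so their sum is at most their product; division does not increase
    the absolute value. *)
Lemma binop_bound o x y p q : (0 < p)%N -> (0 < q)%N ->
  (`|x|%N < 2 ^ p)%N -> (`|y|%N < 2 ^ q)%N -> (`|binop_val o x y|%N < 2 ^ (p + q))%N.
Proof.
move=> p0 q0 hx hy.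
have sum : (`|x| + `|y| < 2 ^ (p + q))%N.
  have h1 : (2 <= 2 ^ p)%N by rewrite -{1}(expn1 2) leq_exp2l.
  have h2 : (2 <= 2 ^ q)%N by rewrite -{1}(expn1 2) leq_exp2l.
  by rewrite expnD; nia.
case: o => /=.
- by apply: leq_ltn_trans sum; lia.
- by apply: leq_ltn_trans sum; lia.
- by rewrite abszM expnD ltn_mul.
apply: leq_ltn_trans (_ : `|x| < _)%N; last first.
  by apply: leq_trans hx _; rewrite leq_exp2l // leq_addr.
exact: lez_div.
Qed.

Lemma val_bound P B s e : (0 < B)%N -> bnd P B s -> reads P e ->
  (`|val_of s e|%N < 2 ^ (edeg e * B))%N.
Proof.
move=> B0 bs; elim: e => [z _|a i _ /= /andP[Pa _]|o e1 IH1 e2 IH2 /= /andP[r1 r2]].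
- apply: leq_trans (bits_gt z) _; rewrite leq_exp2l //= leq_pmulr //.
- by rewrite mul1n; apply: bs.
by rewrite mulnDl; apply: binop_bound; rewrite ?muln_gt0 ?edeg_gt0 ?B0 ?IH1 ?IH2.
Qed.

Lemma cost_bound P B s e : (0 < B)%N -> bnd P B s -> reads P e ->
  (cost_of s e <= ecost e * B)%N.
Proof.
move=> B0 bs; elim: e => [z _|a i IH /= /andP[Pa ri]|o e1 IH1 e2 IH2 /= /andP[r1 r2]].
- by rewrite /= add0n leq_pmulr.
- rewrite mulSn addnC leq_add ?IH // bits_le //; exact: bs.
rewrite !mulnDl; apply: leq_add; first by rewrite leq_add ?IH1 ?IH2.
have := @val_bound P B s (Op o e1 e2) B0 bs; rewrite /= r1 r2 => /(_ isT) h.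
by apply: bits_le; rewrite ?addn_gt0 ?muln_gt0 ?edeg_gt0 ?B0 // -mulnDl.
Qed.

Lemma val_agree P s s' e : reads P e -> (forall a i, P a -> s a i = s' a i) ->
  val_of s e = val_of s' e.
Proof.
move=> re h; elim: e re => [//|a i IH /= /andP[Pa ri]|o e1 IH1 e2 IH2 /= /andP[r1 r2]].
  by rewrite IH // h.
by rewrite IH1 // IH2.
Qed.

Lemma bnd_update (P : pred nat) B s a i z : bnd P B s ->
  (P a -> `|z| < 2 ^ B)%N -> bnd P B (update s a i z).
Proof.
move=> bs hz a' i' Pa; rewrite /update; case: ifP => [/andP[/eqP e _]|_]; last exact: bs.
by apply: hz; rewrite -e.
Qed.

Lemma update_ne s a a' i i' z : a != a' -> update s a' i' z a i = s a i.
Proof. by rewrite /update => /negPf ->. Qed.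

End Costs.

Section Runs.

(** A total-correctness triple with a time bound. *)
Definition run (c : cmd) (s : memory) (Q : memory -> Prop) (T : nat) :=
  exists s' t, [/\ exec c s s' t, (t <= T)%N & Q s'].

Lemma run_weaken c s Q Q' T T' : run c s Q T -> (T <= T')%N ->
  (forall s', Q s' -> Q' s') -> run c s Q' T'.
Proof.
move=> [s' [t [e tT q]]] TT QQ; exists s', t.
by split=> //; [apply: leq_trans TT | apply: QQ].
Qed.

Lemma run_skip s (Q : memory -> Prop) : Q s -> run Skip s Q 1.
Proof. by move=> q; exists s, 1%N; split=> //; constructor. Qed.

Lemma run_assign a i e s (Q : memory -> Prop) T :
  Q (update s a `|val_of s i|%N (val_of s e)) ->
  (cost_of s i + cost_of s e <= T)%N -> run (Assign a i e) s Q T.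
Proof. by move=> q h; do 2 eexists; split; [constructor| |]. Qed.

Lemma run_seq c1 c2 s (Q1 Q : memory -> Prop) T1 T2 : run c1 s Q1 T1 ->
  (forall s1, Q1 s1 -> run c2 s1 Q T2) -> run (Seq c1 c2) s Q (T1 + T2).
Proof.
move=> [s1 [t1 [e1 h1 q1]]] /(_ s1 q1)[s2 [t2 [e2 h2 q2]]].
by exists s2, (t1 + t2)%N; split; [econstructor; eassumption|rewrite leq_add|].
Qed.

Lemma run_if e c1 c2 s Q Tc T : (cost_of s e <= Tc)%N ->
  run (if 0 < val_of s e then c1 else c2) s Q T -> run (If e c1 c2) s Q (Tc + T).
Proof.
move=> hc [s1 [t1 [e1 h1 q1]]]; exists s1, (cost_of s e + t1)%N.
by split=> //; [constructor|rewrite leq_add].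
Qed.

(** The index of the invariant bounds the remaining rounds; the loop may stop earlier. *)
Lemma run_while e c (I : nat -> memory -> Prop) (Q : memory -> Prop) Tc T k s :
  (forall k s, I k s -> (cost_of s e <= Tc)%N) ->
  (forall k s, I k s -> ~~ (0 < val_of s e) /\ Q s \/
     [/\ 0 < val_of s e, (0 < k)%N & run c s (I k.-1) T]) ->
  I k s -> run (While e c) s Q (k.+1 * Tc + k * T).
Proof.
move=> hc hI; elim: k s => [|k IH] s Is.
  case: (hI _ _ Is) => [[h q]|[] //].
  exists s, (cost_of s e); split=> //; first by constructor.
  by rewrite mul1n mul0n addn0; apply: hc Is.
case: (hI _ _ Is) => [[h q]|[h _ [s1 [t1 [e1 h1 /= /IH[s2 [t2 [e2 h2 q2]]]]]]]].
  exists s, (cost_of s e); split=> //; first by constructor.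
  by apply: leq_trans (hc _ _ Is) _; rewrite mulSn -addnA leq_addr.
exists s2, (cost_of s e + t1 + t2)%N; split=> //; first by econstructor; eassumption.
have := hc _ _ Is; rewrite !mulSn in h2 *; lia.
Qed.

End Runs.

(** * Candidates as symbolic expressions *)

Section Morphism.
Variables (K L : comNzRingType) (f : {rmorphism K -> L}).
Variables (a : bool -> blk K) (b : bool -> K) (c : blk K).

Definition mapb (v : blk K) := Blk (f (e11 v)) (f (e12 v)) (f (e21 v)) (f (e22 v)).
Local Notation fa := (fun k => mapb (a k)).
Local Notation fb := (fun k => f (b k)).

Lemma dot2_map u v : dot2 (mapb u) (mapb v) = f (dot2 u v).
Proof. by rewrite /dot2 /= !rmorphD !rmorphM. Qed.

Lemma ten_map p1 p2 q1 q2 : ten (f p1) (f p2) (f q1) (f q2) = mapb (ten p1 p2 q1 q2).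
Proof. by rewrite /ten /mapb /= !rmorphM. Qed.

Lemma cross_map : cross fa fb = mapb (cross a b).
Proof. by rewrite /cross /mapb /= !rmorphB !rmorphM. Qed.

Lemma scaleb_map t v : scaleb (f t) (mapb v) = mapb (scaleb t v).
Proof. by rewrite /scaleb /mapb /= !rmorphM. Qed.

Lemma arcdir_map x y : arcdir fa fb (f x) (f y) = mapb (arcdir a b x y).
Proof.
by rewrite /arcdir /g1 /g2 cross_map -!rmorphM -!rmorphD -rmorphN ten_map.
Qed.

Lemma den_map x y : den fa fb (f x) (f y) = f (den a b x y).
Proof. by rewrite /den arcdir_map !dot2_map -!rmorphM -rmorphD. Qed.

Lemma qform_map j x y : qform fa fb (mapb c) (f j) (f x) (f y) = f (qform a b c j x y).
Proof.
by rewrite /qform /sqnorm arcdir_map dot2_map den_map -!rmorphXn -rmorphD -!rmorphM -rmorphB.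
Qed.

Lemma arcvertex_map j : arcvertex fa fb (mapb c) (f j) = mapb (arcvertex a b c j).
Proof.
rewrite /arcvertex /qB /qA /qC -(rmorph0 f) -(rmorph1 f) !qform_map.
by rewrite -!rmorphD -!rmorphB arcdir_map.
Qed.

Lemma dirs_map j : dirs fa fb (mapb c) (f j) = map mapb (dirs a b c j).
Proof.
rewrite /dirs map_rcons arcvertex_map /vdirs; congr rcons.
rewrite cross_map /= -(rmorph0 f) -(rmorph1 f) !arcdir_map -!rmorphN !ten_map.
by [].
Qed.

(** Candidates are ring polynomials in the data and [j], so those computed over the integers are the
    real ones. *)
Lemma cands_map j :
  cands fa fb (mapb c) (f j) = [seq (mapb z.1, f z.2) | z <- cands a b c j].
Proof.
rewrite /cands dirs_map; move: (dirs a b c j) => d.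
rewrite map_cons map_flatten -!map_comp.
have -> : (mapb (Blk 0 0 0 0, 1 : K).1, f (Blk 0 0 0 0, 1 : K).2) = (Blk 0 0 0 0, 1).
  by rewrite /mapb /= !rmorph0 rmorph1.
congr cons; congr flatten; apply: eq_map => v /=.
by rewrite /cand_of !dot2_map -!rmorphM !scaleb_map.
Qed.

End Morphism.

Lemma cand_ok_map (R : numDomainType) (a : bool -> blk int) b c j (z : blk int * int) :
  cand_ok (fun k => mapb (intr : {rmorphism int -> R}) (a k)) (fun k => (b k)%:~R)
      (mapb (intr : {rmorphism int -> R}) c) j%:~R (mapb intr z.1, z.2%:~R) <->
  cand_ok a b c j z.
Proof.
split=> -[/=]; rewrite ?ltr0z ?ler0z => h1 h2 h3 h4 h5; split=> //=;
  rewrite ?ltr0z ?ler0z //.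
- by move=> k; have := h4 k; rewrite dot2_map -intrM ler_int.
- by move: h5; rewrite dot2_map -intrM ler_int.
- by move=> k; rewrite dot2_map -intrM ler_int.
- by rewrite dot2_map -intrM ler_int.
Qed.

Local Notation eadd := (Op Add).
Local Notation esub := (Op Defs.Sub).
Local Notation emul := (Op Mul).
Local Notation ediv := (Op Div).

Section Symbolic.
Variables (a : bool -> blk expr) (b : bool -> expr) (c : blk expr) (j : expr).

(** These expressions copy the ring formulas symbol by symbol, so that their values agree mostly by
    conversion; negation becomes subtraction from 0. *)
Definition edot2 (u v : blk expr) :=
  eadd (eadd (eadd (emul (e11 u) (e11 v)) (emul (e12 u) (e12 v)))
             (emul (e21 u) (e21 v))) (emul (e22 u) (e22 v)).
Definition eneg x := esub (Cst 0) x.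
Definition eten p1 p2 q1 q2 := Blk (emul p1 q1) (emul p1 q2) (emul p2 q1) (emul p2 q2).
Definition ecross1 x y := esub (emul (b false) x) (emul (b true) y).
Definition ecross := Blk (ecross1 (e11 (a true)) (e11 (a false)))
  (ecross1 (e12 (a true)) (e12 (a false))) (ecross1 (e21 (a true)) (e21 (a false)))
  (ecross1 (e22 (a true)) (e22 (a false))).
Definition eg1 p1 p2 := eadd (emul (e11 ecross) p1) (emul (e21 ecross) p2).
Definition eg2 p1 p2 := eadd (emul (e12 ecross) p1) (emul (e22 ecross) p2).
Definition earcdir p1 p2 := eten p1 p2 (eg2 p1 p2) (eneg (eg1 p1 p2)).
Definition esqnorm := eadd (emul (b true) (b true)) (emul (b false) (b false)).
Definition eden p1 p2 := eadd (emul (b true) (edot2 (a true) (earcdir p1 p2)))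
  (emul (b false) (edot2 (a false) (earcdir p1 p2))).
Definition eqform x1 x2 := esub (emul esqnorm (edot2 c (earcdir x1 x2))) (emul j (eden x1 x2)).
Definition eqA := eqform (Cst 1) (Cst 0).
Definition eqC := eqform (Cst 0) (Cst 1).
Definition eqB := esub (esub (eqform (Cst 1) (Cst 1)) eqA) eqC.
Definition earcvertex := earcdir eqB (esub (Cst 0) (eadd eqA eqA)).
Definition edirs := [:: eten (Cst 1) (Cst 0) (Cst 1) (Cst 0);
  earcdir (Cst 1) (Cst 0); earcdir (Cst 0) (Cst 1);
  eten (e21 ecross) (eneg (e11 ecross)) (Cst 1) (Cst 0);
  eten (e22 ecross) (eneg (e12 ecross)) (Cst 0) (Cst 1); earcvertex].
Definition escaleb t v :=
  Blk (emul t (e11 v)) (emul t (e12 v)) (emul t (e21 v)) (emul t (e22 v)).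
Definition ecand_of v k :=
  (escaleb (emul (b k) (edot2 (a k) v)) v, emul (edot2 (a k) v) (edot2 (a k) v)).
Definition ecands := (Blk (Cst 0) (Cst 0) (Cst 0) (Cst 0), Cst 1) ::
  flatten [seq [:: ecand_of v true; ecand_of v false] | v <- edirs].

(** Tests have the form [0 < e], so over the integers [0 <= x] becomes [0 < x + 1]. *)
Definition enonneg x := eadd x (Cst 1).
Definition etests (z : blk expr * expr) := [:: z.2;
  enonneg (e11 z.1); enonneg (e12 z.1); enonneg (e21 z.1); enonneg (e22 z.1);
  enonneg (esub (emul (b true) z.2) (edot2 (a true) z.1));
  enonneg (esub (emul (b false) z.2) (edot2 (a false) z.1));
  enonneg (esub (edot2 c z.1) (emul j z.2))].

Section Values.
Variable s : memory.

Definition valb (v : blk expr) :=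
  Blk (val_of s (e11 v)) (val_of s (e12 v)) (val_of s (e21 v)) (val_of s (e22 v)).
Definition valz (z : blk expr * expr) := (valb z.1, val_of s z.2).
Local Notation va := (fun k => valb (a k)).
Local Notation vc := (fun k => val_of s (b k)).

Lemma val_dot2 u v : val_of s (edot2 u v) = dot2 (valb u) (valb v).
Proof. by []. Qed.

Lemma val_ten p1 p2 q1 q2 : valb (eten p1 p2 q1 q2) =
  ten (val_of s p1) (val_of s p2) (val_of s q1) (val_of s q2).
Proof. by []. Qed.

Lemma val_neg x : val_of s (eneg x) = - val_of s x.
Proof. exact: sub0r. Qed.

Lemma val_cross : valb ecross = cross va vc.
Proof. by []. Qed.

Lemma val_arcdir p1 p2 : valb (earcdir p1 p2) = arcdir va vc (val_of s p1) (val_of s p2).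
Proof. by rewrite /earcdir val_ten val_neg. Qed.

Lemma val_den p1 p2 : val_of s (eden p1 p2) = den va vc (val_of s p1) (val_of s p2).
Proof. by rewrite /den -!val_arcdir -!val_dot2. Qed.

Lemma val_qform x1 x2 :
  val_of s (eqform x1 x2) = qform va vc (valb c) (val_of s j) (val_of s x1) (val_of s x2).
Proof. by rewrite /qform -val_den -val_arcdir -val_dot2. Qed.

Lemma val_arcvertex : valb earcvertex = arcvertex va vc (valb c) (val_of s j).
Proof.
have hA : val_of s eqA = qA va vc (valb c) (val_of s j) by rewrite val_qform.
have hC : val_of s eqC = qC va vc (valb c) (val_of s j) by rewrite val_qform.
rewrite /earcvertex val_arcdir /arcvertex; congr arcdir; last by rewrite -hA.
by rewrite /qB -hA -hC -[1]/(val_of s (Cst 1)) -val_qform.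
Qed.

Lemma val_cands : [seq valz z | z <- ecands] = cands va vc (valb c) (val_of s j).
Proof.
have -> : cands va vc (valb c) (val_of s j) = (Blk 0 0 0 0, 1) ::
    flatten [seq [:: cand_of va vc (valb v) true; cand_of va vc (valb v) false]
            | v <- edirs].
  rewrite /cands (_ : dirs _ _ _ _ = [seq valb v | v <- edirs]) -?map_comp //.
  rewrite /dirs -val_arcvertex /vdirs -val_cross [rcons _ _]/= /edirs !map_cons.
  by congr [:: _; _; _; _; _; _]; rewrite ?val_arcdir // val_ten val_neg.
rewrite /ecands; move: edirs => d.
rewrite map_cons map_flatten -map_comp; congr cons; congr flatten.
Qed.

Lemma tests_cand_ok z : all (fun e => 0 < val_of s e) (etests z) <->
  cand_ok va vc (valb c) (val_of s j) (valz z).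
Proof.
have nn x : (0 < val_of s (enonneg x)) = (0 <= val_of s x) by rewrite /= ltzD1.
rewrite /etests /all !nn andbT /cand_ok /=; split.
  case/and5P => h1 h2 h3 h4 /and4P[h5 h6 h7 h8]; split=> //.
    by case; rewrite -subr_ge0 -val_dot2.
  by rewrite -subr_ge0 -val_dot2.
case=> h1 [h2 h3] [h4 h5] h6 h7; rewrite h1 h2 h3 h4 h5 /=.
by rewrite !subr_ge0; have := h6 true; have := h6 false; rewrite -!val_dot2 => -> ->.
Qed.

End Values.

Section Reads.
Variable P : pred nat.
Definition readsb (v : blk expr) :=
  [&& reads P (e11 v), reads P (e12 v), reads P (e21 v) & reads P (e22 v)].
Hypotheses (Pa : forall k, readsb (a k)) (Pb : forall k, reads P (b k)).
Hypotheses (Pc : readsb c) (Pj : reads P j).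

Lemma reads_op o x y : reads P x -> reads P y -> reads P (Op o x y).
Proof. by move=> h1 h2; apply/andP. Qed.

Lemma reads_ten p1 p2 q1 q2 : reads P p1 -> reads P p2 -> reads P q1 -> reads P q2 ->
  readsb (eten p1 p2 q1 q2).
Proof. by move=> h1 h2 h3 h4; apply/and4P; split; apply: reads_op. Qed.

Lemma reads_dot2 u v : readsb u -> readsb v -> reads P (edot2 u v).
Proof.
by case/and4P=> u1 u2 u3 u4 /and4P[v1 v2 v3 v4]; do ?apply: reads_op.
Qed.

Lemma reads_cross : readsb ecross.
Proof.
have := Pa true; have := Pa false; have := Pb true; have := Pb false.
move=> hf ht /and4P[h1 h2 h3 h4] /and4P[k1 k2 k3 k4].
by apply/and4P; split; apply: reads_op; apply: reads_op.
Qed.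

Lemma reads_arcdir p1 p2 : reads P p1 -> reads P p2 -> readsb (earcdir p1 p2).
Proof.
move=> h1 h2; have /and4P[c1 c2 c3 c4] := reads_cross.
apply: reads_ten => //; first by apply: reads_op; apply: reads_op.
by apply: reads_op => //; apply: reads_op; apply: reads_op.
Qed.

Lemma reads_qform x1 x2 : reads P x1 -> reads P x2 -> reads P (eqform x1 x2).
Proof.
move=> h1 h2; have hd := reads_arcdir h1 h2.
apply: reads_op; apply: reads_op => //.
- by apply: reads_op; apply: reads_op.
- exact: reads_dot2.
- by apply: reads_op; apply: reads_op => //; apply: reads_dot2.
Qed.

Lemma reads_cands z : List.In z ecands -> readsb z.1 && reads P z.2.
Proof.
have hA : reads P eqA by apply: reads_qform.
have hC : reads P eqC by apply: reads_qform.
have h11 : reads P (eqform (Cst 1) (Cst 1)) by apply: reads_qform.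
have hB : reads P eqB by exact: reads_op (reads_op _ h11 hA) hC.
have /and4P[c1 c2 c3 c4] := reads_cross.
have rd v k : readsb v -> readsb (ecand_of v k).1 && reads P (ecand_of v k).2.
  move=> rv; have rd := reads_dot2 (Pa k) rv; case/and4P: (rv) => v1 v2 v3 v4.
  apply/andP; split; last exact: reads_op.
  by apply/and4P; split; apply: reads_op => //; apply: reads_op.
have rdirs : all readsb edirs.
  have d1 : readsb (eten (Cst 1) (Cst 0) (Cst 1) (Cst 0)) by [].
  have d2 : readsb (earcdir (Cst 1) (Cst 0)) by apply: reads_arcdir.
  have d3 : readsb (earcdir (Cst 0) (Cst 1)) by apply: reads_arcdir.
  have d4 : readsb (eten (e21 ecross) (eneg (e11 ecross)) (Cst 1) (Cst 0)).
    by apply: reads_ten => //; apply: reads_op.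
  have d5 : readsb (eten (e22 ecross) (eneg (e12 ecross)) (Cst 0) (Cst 1)).
    by apply: reads_ten => //; apply: reads_op.
  have d6 : readsb earcvertex.
    by apply: reads_arcdir => //; apply: reads_op => //; apply: reads_op.
  apply/andP; split; first exact: d1.
  apply/andP; split; first exact: d2.
  apply/and5P; split; [exact: d3|exact: d4|exact: d5|exact: d6|by []].
rewrite /ecands; move: edirs rdirs => l rl [<- //|].
elim: l rl => [_ []|v l IH /= /andP[rv rl]].
case=> [<-|]; first exact: rd.
case=> [<-|]; first exact: rd.
by move/IH; apply.
Qed.

Lemma reads_tests z : readsb z.1 && reads P z.2 -> all (reads P) (etests z).
Proof.
case/andP => rz r2; case/and4P: (rz) => h1 h2 h3 h4.
have nn x : reads P x -> reads P (enonneg x) by move=> ?; apply: reads_op.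
apply/and5P; split=> //; [exact: nn|exact: nn|exact: nn|].
apply/and5P; split=> //; [exact: nn| | |]; apply: nn.
- by apply: reads_op; [exact: reads_op|exact: reads_dot2].
- by apply: reads_op; [exact: reads_op|exact: reads_dot2].
- by apply: reads_op; [exact: reads_dot2|exact: reads_op].
Qed.

End Reads.
End Symbolic.

(** * The input and its common denominator *)

Lemma nth_allpairs (S T U : Type) (f : S -> T -> U) x0 y0 z0 (s : seq S) (t : seq T) i j :
  (i < size s)%N -> (j < size t)%N ->
  nth z0 [seq f x y | x <- s, y <- t] (i * size t + j) = f (nth x0 s i) (nth y0 t j).
Proof.
elim: s i => // x s IH [|i] si tj; rewrite /= nth_cat size_map.
  by rewrite mul0n add0n tj (nth_map y0).
by rewrite mulSn -addnA ltnNge leq_addr /= addKn IH.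
Qed.

Lemma size_mx_entries m n (A : 'M[rat]_(m, n)) : size (mx_entries A) = (m * n)%N.
Proof. by rewrite size_allpairs !size_enum_ord. Qed.

Lemma nth_mx_entries m n (A : 'M[rat]_(m, n)) (i : 'I_m) (j : 'I_n) :
  nth 0 (mx_entries A) (i * n + j) = A i j.
Proof.
have := @nth_allpairs _ _ _ (fun i j => A i j) i j 0 (enum 'I_m) (enum 'I_n) i j.
rewrite !size_enum_ord => /(_ (ltn_ord i) (ltn_ord j)) ->.
by rewrite !nth_ord_enum.
Qed.

Section Data.
Variable x : instance.
Local Notation n1 := (nrows x).
Local Notation n2 := (ncols x).
Local Notation F := (load (encode_instance x)).
Local Notation N := (n1 * n2)%N.

Definition mat (m : nat) : 'M[rat]_(n1, n2) :=
  if m == 3%N then A1_of x else if m == 5%N then A2_of x else obj_of x.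

Definition scalar_of (i : nat) : rat := nth 0 [:: b1_of x; b2_of x; acc_of x] i.

Definition matbank (m : nat) := m \in [:: 3%N; 5%N; 7%N].

Lemma load_num m (i : 'I_n1) (j : 'I_n2) : matbank m ->
  F m (i * n2 + j)%N = numq (mat m i j).
Proof.
have h (A : 'M[rat]_(n1, n2)) : nth 0 (map numq (mx_entries A)) (i * n2 + j) = numq (A i j).
  rewrite (nth_map 0) ?nth_mx_entries // size_mx_entries.
  by have := ltn_ord i; have := ltn_ord j; nia.
by rewrite /matbank !inE => /or3P[]/eqP->; exact: h.
Qed.

Lemma load_den m (i : 'I_n1) (j : 'I_n2) : matbank m ->
  F m.+1 (i * n2 + j)%N = denq (mat m i j).
Proof.
have h (A : 'M[rat]_(n1, n2)) : nth 0 (map denq (mx_entries A)) (i * n2 + j) = denq (A i j).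
  rewrite (nth_map 0) ?nth_mx_entries // size_mx_entries.
  by have := ltn_ord i; have := ltn_ord j; nia.
by rewrite /matbank !inE => /or3P[]/eqP->; exact: h.
Qed.

Lemma load_scalar i : (i < 3)%N ->
  F 1%N i = numq (scalar_of i) /\ F 2%N i = denq (scalar_of i).
Proof. by case: i => [|[|[|]]]. Qed.

(* The factor [num ^ 2 + 1] makes [D] bound the numerators as well, hence the
   data scaled by [D]. *)
Definition fac m i : int := (F m i * F m i + 1) * F m.+1 i.
Definition fac3 i := fac 3%N i * (fac 5%N i * fac 7%N i).
Definition fac0 := fac 1%N 0%N * (fac 1%N 1%N * fac 1%N 2%N).
(** The factor 2 ensures [D >= 2] for all data; the partial products are the loop invariant of the
    program. *)
Definition den_prod k := 2 * fac0 * \prod_(i < k) fac3 i.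
Definition D := den_prod N.

Lemma pos_split p : (p < N)%N -> exists (i : 'I_n1) (j : 'I_n2), p = (i * n2 + j)%N.
Proof.
move=> pN; have n20 : (0 < n2)%N by case: (n2) pN => //; rewrite muln0.
have pi : (p %/ n2 < n1)%N by rewrite ltn_divLR.
exists (Ordinal pi), (Ordinal (ltn_pmod p n20)).
exact: divn_eq.
Qed.

Lemma fac_ge1 m i : 0 < F m.+1 i -> 1 <= fac m i.
Proof. by move=> d0; rewrite /fac; nia. Qed.

Lemma den_pos m i : matbank m -> (i < N)%N -> 0 < F m.+1 i.
Proof. by move=> mb /pos_split[r [c ->]]; rewrite load_den // denq_gt0. Qed.

Lemma den0_pos i : (i < 3)%N -> 0 < F 2%N i.
Proof. by move=> /load_scalar[_ ->]; rewrite denq_gt0. Qed.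

Lemma fac3_ge1 i : (i < N)%N -> 1 <= fac3 i.
Proof.
move=> iN; have h m : matbank m -> 1 <= fac m i.
  by move=> mb; apply: fac_ge1; apply: den_pos.
by rewrite /fac3; have := h 3%N isT; have := h 5%N isT; have := h 7%N isT; nia.
Qed.

Lemma fac0_ge1 : 1 <= fac0.
Proof.
have h i : (i < 3)%N -> 1 <= fac 1%N i.
  by move=> i3; apply: fac_ge1; apply: den0_pos.
by rewrite /fac0; have := h 0%N isT; have := h 1%N isT; have := h 2%N isT; nia.
Qed.

Lemma den_prodS k : den_prod k.+1 = den_prod k * fac3 k.
Proof. by rewrite /den_prod big_ord_recr /= mulrA. Qed.

Lemma den_prod_ge2 k : (k <= N)%N -> 2 <= den_prod k.
Proof.
elim: k => [|k IH] kN; first by rewrite /den_prod big_ord0; have := fac0_ge1; lia.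
by rewrite den_prodS; have := IH (ltnW kN); have := fac3_ge1 kN; nia.
Qed.

Lemma den_prod_le k : (k <= N)%N -> den_prod k <= D.
Proof.
have h d : (k + d <= N)%N -> den_prod k <= den_prod (k + d).
  elim: d => [|d IH] le; first by rewrite addn0.
  rewrite addnS in le *; apply: le_trans (IH (ltnW le)) _.
  rewrite den_prodS; have := den_prod_ge2 (ltnW le); have := fac3_ge1 le; nia.
by move=> kN; have := h (N - k)%N; rewrite subnKC // => /(_ (leqnn _)).
Qed.

Lemma D_ge2 : 2 <= D. Proof. exact: den_prod_ge2. Qed.

(** Writing [q = k (num^2 + 1) d], the scaled numerator is [num * k (num^2 + 1)], and both [|num|]
    and [k (num^2 + 1)] are at most [q]. *)
Lemma fac_dvd_bound (q num d : int) : 0 < d ->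
  ((num * num + 1) * d %| q)%Z -> 0 < q ->
  (d %| q)%Z /\ `|num * (q %/ d)%Z| <= q * q.
Proof.
move=> d0 /dvdzP[k qE] q0; split; first by apply/dvdzP; exists (k * (num * num + 1)); lia.
have k0 : 0 < k by nia.
have -> : (q %/ d)%Z = k * (num * num + 1) by rewrite qE mulrA mulzK //; lia.
rewrite normrM.
have h1 : `|num| <= num * num + 1.
  by have [h|h] := leP 0 num; [rewrite ger0_norm //|rewrite ltr0_norm //]; nia.
have h2 : `|k * (num * num + 1)| = k * (num * num + 1) by rewrite ger0_norm //; nia.
have h3 : num * num + 1 <= q by rewrite qE; nia.
have h4 : k * (num * num + 1) <= q by rewrite qE; nia.
rewrite h2; apply: ler_pM => //; first by nia.
exact: le_trans h3.
Qed.

Lemma fac_dvd_D m i : matbank m -> (i < N)%N -> (fac m i %| D)%Z.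
Proof.
move=> mb iN; rewrite /D /den_prod (bigD1 (Ordinal iN)) //=.
apply: dvdz_mull; apply: dvdz_mulr; rewrite /fac3.
move: mb; rewrite /matbank !inE => /or3P[]/eqP->.
- exact: dvdz_mulr.
- by apply: dvdz_mull; apply: dvdz_mulr.
- by apply: dvdz_mull; apply: dvdz_mull.
Qed.

Lemma fac0_dvd_D i : (i < 3)%N -> (fac 1%N i %| D)%Z.
Proof.
move=> i3; rewrite /D /den_prod; apply: dvdz_mulr; apply: dvdz_mull; rewrite /fac0.
case: i i3 => [|[|[|//]]] _.
- exact: dvdz_mulr.
- by apply: dvdz_mull; apply: dvdz_mulr.
- by apply: dvdz_mull; apply: dvdz_mull.
Qed.

Definition scaled (q : rat) : int := numq q * (D %/ denq q)%Z.

Lemma scaledE (R : numFieldType) q : (denq q %| D)%Z ->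
  (scaled q)%:~R = D%:~R * ratr q :> R.
Proof.
move=> /dvdzP[k DE]; rewrite /scaled {1}DE mulzK ?denq_neq0 // DE.
have d0 : (denq q)%:~R != 0 :> R by rewrite intr_eq0 denq_neq0.
by rewrite /ratr !intrM; field.
Qed.

Lemma entry_data i j m : matbank m ->
  (denq (mat m i j) %| D)%Z /\ `|scaled (mat m i j)| <= D * D.
Proof.
move=> mb; have pN : (i * n2 + j < N)%N by have := ltn_ord i; have := ltn_ord j; nia.
have := fac_dvd_D mb pN; rewrite /fac load_num // load_den // => h.
apply: fac_dvd_bound h _; first by rewrite denq_gt0.
have := D_ge2; lia.
Qed.

Lemma scalar_data i : (i < 3)%N ->
  (denq (scalar_of i) %| D)%Z /\ `|scaled (scalar_of i)| <= D * D.
Proof.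
move=> i3; have := fac0_dvd_D i3; rewrite /fac.
have [-> ->] := load_scalar i3 => h.
apply: fac_dvd_bound h _; first by rewrite denq_gt0.
have := D_ge2; lia.
Qed.

Lemma fac_bits m i : (`|fac m i|%N <= 2 ^ (2 * (bits (F m i) + bits (F m.+1 i))))%N.
Proof.
rewrite /fac; have h1 := bits_gt (F m i); have h2 := bits_gt (F m.+1 i).
rewrite abszM mulnDr expnD leq_mul //; last first.
  apply: leq_trans (ltnW h2) _; rewrite leq_exp2l //; lia.
rewrite mulnC expnM; set P := (2 ^ _)%N in h1 *; nia.
Qed.

Lemma bits_sum m : matbank m ->
  (\sum_(i < N) bits (F m i) = \sum_(z <- map numq (mx_entries (mat m))) bits z)%N /\
  (\sum_(i < N) bits (F m.+1 i) = \sum_(z <- map denq (mx_entries (mat m))) bits z)%N.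
Proof.
move=> mb.
have h f a : F a = nth 0 (map f (mx_entries (mat m))) ->
    (\sum_(i < N) bits (F a i) = \sum_(z <- map f (mx_entries (mat m))) bits z)%N.
  move=> ->; rewrite [RHS](big_nth 0) size_map size_mx_entries big_mkord.
  by [].
by move: mb h; rewrite /matbank !inE => /or3P[]/eqP-> h; split; apply: h.
Qed.

(** Bit lengths add up in a product and each factor of [D] takes at most twice the bits of its
    numerator and denominator, so [D] has linearly many bits. The additional bit is the factor 2. *)
Lemma D_size : (`|D|%N <= 2 ^ (2 * input_size (encode_instance x) + 1))%N.
Proof.
have [a3 b3] := bits_sum (isT : matbank 3%N).
have [a5 b5] := bits_sum (isT : matbank 5%N).
have [a7 b7] := bits_sum (isT : matbank 7%N).
pose W i := (bits (F 3%N i) + bits (F 4%N i) + (bits (F 5%N i) + bits (F 6%N i)) +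
  (bits (F 7%N i) + bits (F 8%N i)))%N.
pose W0 := (bits (F 1%N 0%N) + bits (F 2%N 0%N) + (bits (F 1%N 1%N) + bits (F 2%N 1%N)) +
  (bits (F 1%N 2%N) + bits (F 2%N 2%N)))%N.
have szE : (W0 + \sum_(i < N) W i <= input_size (encode_instance x))%N.
  rewrite /W !big_split /= a3 b3 a5 b5 a7 b7 /W0.
  rewrite /input_size /encode_instance /= !big_cons big_nil /=.
  rewrite ?big_cons ?big_nil /load /= /mat /=; lia.
have mul3 (u v w p q r : nat) : (u <= 2 ^ (2 * p) -> v <= 2 ^ (2 * q) ->
    w <= 2 ^ (2 * r) -> u * (v * w) <= 2 ^ (2 * (p + q + r)))%N.
  move=> h1 h2 h3.
  have -> : (2 ^ (2 * (p + q + r)) = 2 ^ (2 * p) * (2 ^ (2 * q) * 2 ^ (2 * r)))%N.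
    by rewrite -!expnD; congr expn; lia.
  by apply: leq_mul => //; apply: leq_mul.
have f3 i : (`|fac3 i|%N <= 2 ^ (2 * W i))%N.
  by rewrite /fac3 /W abszM [X in (_ * X)%N]abszM; apply: mul3; apply: fac_bits.
have f0 : (`|fac0|%N <= 2 ^ (2 * W0))%N.
  by rewrite /fac0 /W0 abszM [X in (_ * X)%N]abszM; apply: mul3; apply: fac_bits.
have pr k : (`|(\prod_(i < k) fac3 i)%R|%N <= 2 ^ (2 * \sum_(i < k) W i))%N.
  elim: k => [|k IH]; first by rewrite !big_ord0.
  by rewrite !big_ord_recr /= abszM mulnDr expnD; apply: leq_mul.
rewrite /D /den_prod abszM [X in (X * _ <= _)%N]abszM; apply: leq_trans (_ : 2 * 2 ^ (2 * W0) * 2 ^ (2 * \sum_(i < N) W i) <= _)%N.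
  by apply: leq_mul => //; apply: leq_mul.
rewrite -[X in (X * _ * _ <= _)%N](expn1 2) -!expnD leq_exp2l //; lia.
Qed.

(** Every entry of the first matrix costs at least one bit, so the number of entries is bounded by
    the input size. *)
Lemma dims_size : (N <= input_size (encode_instance x))%N /\
  (0 < input_size (encode_instance x))%N /\
  (bits n1 + bits n2 <= input_size (encode_instance x))%N.
Proof.
have [a3 b3] := bits_sum (isT : matbank 3%N).
have le : (N <= \sum_(i < N) bits (F 3%N i))%N.
  by rewrite -[X in (X <= _)%N]card_ord -sum1_card leq_sum.
rewrite a3 in le; move: le; rewrite /input_size /encode_instance /= !big_cons big_nil /=.
by rewrite ?big_cons ?big_nil /mat /=; have : (0 < bits n1)%N by []; lia.
Qed.

End Data.

(** * The program *)

Section Program.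

(* Bank 9 holds the status, the common denominator, the search value, the
   current step and a loop counter; bank 12 holds the recorded solution. *)
Definition rD := Get 9 (Cst 1).
Definition rJ := Get 9 (Cst 2).
Definition rS := Get 9 (Cst 3).
Definition rR := Get 9 (Cst 4).
Definition rN1 := Get 0 (Cst 0).
Definition rN2 := Get 0 (Cst 1).
Definition xN := emul rN1 rN2.

(* The counter encodes two positions of the matrix, hence two rows and two columns. *)
Definition xp := ediv rR xN.
Definition xq := esub rR (emul xp xN).
Definition xi := ediv xp rN2.
Definition xl := esub xp (emul xi rN2).
Definition xi' := ediv xq rN2.
Definition xl' := esub xq (emul xi' rN2).
Definition xp12 := eadd (emul xi rN2) xl'.
Definition xp21 := eadd (emul xi' rN2) xl.

Definition xsc m pos := emul (Get m pos) (ediv rD (Get m.+1 pos)).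
Definition xblk m := Blk (xsc m xp) (xsc m xp12) (xsc m xp21) (xsc m xq).
Definition xa (k : bool) := xblk (if k then 3%N else 5%N).
Definition xb (k : bool) := xsc 1%N (Cst (if k then 0 else 1)).
Definition xc := xblk 7%N.
Definition xj := eadd rJ rS.

Fixpoint xpow e n := if n is n'.+1 then emul e (xpow e n') else Cst 1.
Definition xfac m i := emul (eadd (emul (Get m i) (Get m i)) (Cst 1)) (Get m.+1 i).

Definition incr := Assign 9 (Cst 4) (eadd rR (Cst 1)).
Definition den_init := Assign 9 (Cst 1) (emul (Cst 2)
  (emul (xfac 1%N (Cst 0)) (emul (xfac 1%N (Cst 1)) (xfac 1%N (Cst 2))))).
Definition den_step := Assign 9 (Cst 1)
  (emul rD (emul (xfac 3%N rR) (emul (xfac 5%N rR) (xfac 7%N rR)))).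
Definition den_loop := While (esub xN rR) (Seq den_step incr).
(** The scaled maximum is at most D^54 in absolute value and [D >= 2], so a search from -D^55 with
    first step D^55 covers it. *)
Definition set_step := Assign 9 (Cst 3) (xpow rD 55).
Definition set_search := Assign 9 (Cst 2) (eneg rS).

Fixpoint store (k : nat) (l : seq expr) :=
  if l is e :: l' then Seq (Assign 12 (Cst k%:Z) e) (store k.+1 l') else Skip.
Definition record_list (z : blk expr * expr) :=
  [:: e11 z.1; e12 z.1; e21 z.1; e22 z.1; z.2; xp; xp12; xp21; xq].
(** The search value is raised last: the recorded expressions and [xj] itself refer to its old
    value. *)
Definition record z := Seq (store 0 (record_list z))
  (Seq (Assign 9 (Cst 0) (Cst 1)) (Assign 9 (Cst 2) xj)).
Definition guard (es : seq expr) c := foldr (fun e c' => If e c' Skip) c es.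
Definition xcands := ecands xa xb xc xj.
Definition check z := guard (etests xa xb xc xj z) (record z).
Definition checks := foldr (fun z c => Seq (check z) c) Skip.
Definition sweep := Seq (Assign 9 (Cst 4) (Cst 0))
  (While (esub (emul xN xN) rR) (Seq (checks xcands) incr)).
(** Rounding up keeps twice the new step at least the old one, as the search invariant requires; a
    step of 1 becomes 0, which ends the search. *)
Definition halve := If (esub rS (Cst 1))
  (Assign 9 (Cst 3) (ediv (eadd rS (Cst 1)) (Cst 2))) (Assign 9 (Cst 3) (Cst 0)).
Definition search := While rS (Seq sweep halve).

(** Numerators are added, not assigned, since coinciding indices make entries of the block add
    up. *)
Definition out (q : nat) :=
  Seq (Assign 10 (Get 12 (Cst (5 + q)%N%:Z))
        (eadd (Get 10 (Get 12 (Cst (5 + q)%N%:Z))) (Get 12 (Cst q%:Z))))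
      (Assign 11 (Get 12 (Cst (5 + q)%N%:Z)) (Get 12 (Cst 4))).
Definition output := If (Get 9 (Cst 0)) (Seq (out 0) (Seq (out 1) (Seq (out 2) (out 3)))) Skip.

Definition solver := Seq (Seq (Seq den_init den_loop) (Seq set_step (Seq set_search search)))
  output.

(** For loop-free code, in units of the register size. Loops count 0 here; their time comes from
    [run_while]. *)
Fixpoint ctime (c : cmd) : nat :=
  match c with
  | Skip => 1
  | Assign _ i e => ecost i + ecost e
  | Seq c1 c2 => ctime c1 + ctime c2
  | If e c1 c2 => ecost e + (ctime c1 + ctime c2)
  | While e c => 0
  end.

End Program.

(** The banks that obey the uniform bit bound during the search. Recorded candidates in bank 12 are
    larger and are read only by the output. *)
Definition low : pred nat := fun a => (a < 10)%N.

(** * Execution of loop-free code *)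

Section Straight.
Variable B : nat.
Hypothesis B0 : (0 < B)%N.

Lemma run_assignB P a i e s (Q : memory -> Prop) : bnd P B s -> reads P i -> reads P e ->
  Q (update s a `|val_of s i|%N (val_of s e)) ->
  run (Assign a i e) s Q (ctime (Assign a i e) * B).
Proof.
move=> bs ri re q; apply: run_assign q _.
by rewrite mulnDl; apply: leq_add; exact: cost_bound bs _.
Qed.

Lemma run_seqB c1 c2 s (Q1 Q : memory -> Prop) : run c1 s Q1 (ctime c1 * B) ->
  (forall s1, Q1 s1 -> run c2 s1 Q (ctime c2 * B)) ->
  run (Seq c1 c2) s Q (ctime (Seq c1 c2) * B).
Proof. by rewrite mulnDl; exact: run_seq. Qed.

Lemma run_skipB s (Q : memory -> Prop) : Q s -> run Skip s Q (ctime Skip * B).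
Proof. by move=> q; apply: run_weaken (run_skip q) _ _; rewrite ?mul1n. Qed.

Lemma run_ifB P e c1 c2 s (Q : memory -> Prop) : bnd P B s -> reads P e ->
  (0 < val_of s e -> run c1 s Q (ctime c1 * B)) ->
  (~~ (0 < val_of s e) -> run c2 s Q (ctime c2 * B)) ->
  run (If e c1 c2) s Q (ctime (If e c1 c2) * B).
Proof.
move=> bs re h1 h2; rewrite mulnDl; apply: run_if; first exact: cost_bound bs _.
case: ifPn => [/h1|/h2] h; apply: run_weaken h _ _ => //.
  by rewrite mulnDl leq_addr.
by rewrite mulnDl leq_addl.
Qed.

(** The stored expressions read only low banks, so writing into bank 12 does not disturb the later
    ones. *)
Lemma run_store k l s (Q : memory -> Prop) : bnd low B s -> all (reads low) l ->
  (forall s', (forall a i, a != 12%N -> s' a i = s a i) ->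
     (forall i, s' 12%N i = if (k <= i < k + size l)%N then val_of s (nth (Cst 0) l (i - k))
                            else s 12%N i) -> Q s') ->
  run (store k l) s Q (ctime (store k l) * B).
Proof.
elim: l k s Q => [|e l IH] k s Q bs.
  move=> _ h; apply: run_skipB; apply: h => // i.
  by rewrite addn0; case: ltnP => //; lia.
move=> /= /andP[re rl] h.
apply: (run_seqB (Q1 := fun s1 => s1 = update s 12%N k (val_of s e))).
  by apply: run_assignB bs _ re _.
move=> s1 ->.
have agr a i : low a -> update s 12%N k (val_of s e) a i = s a i.
  by rewrite /update /low; case: eqP => // ->.
apply: IH => // [|s' h1 h2].
  by apply: bnd_update.
apply: h => [a i an|i].
  by rewrite h1 // /update (negPf an).
rewrite h2 /=; have [ik|[ik|->]] : (i < k)%N \/ (k < i)%N \/ i = k by lia.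
- have -> : (k < i < k.+1 + size l)%N = false by lia.
  have -> : (k <= i < k + (size l).+1)%N = false by lia.
  by rewrite /update /= [i == k]ltn_eqF.
- have -> : (k < i < k.+1 + size l)%N = (k <= i < k + (size l).+1)%N by lia.
  case: ifP => il; last by rewrite /update /= [i == k]gtn_eqF.
  have -> : (i - k = (i - k.+1).+1)%N by lia.
  rewrite /=; apply: val_agree agr.
  by apply: (all_nthP _ rl); lia.
have -> : (k < k < k.+1 + size l)%N = false by lia.
have -> : (k <= k < k + (size l).+1)%N by lia.
by rewrite subnn /update !eqxx.
Qed.

Lemma run_guard es c s (Q : memory -> Prop) : bnd low B s -> all (reads low) es ->
  (all (fun e => 0 < val_of s e) es -> run c s Q (ctime c * B)) ->
  (~~ all (fun e => 0 < val_of s e) es -> Q s) ->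
  run (guard es c) s Q (ctime (guard es c) * B).
Proof.
move=> bs; elim: es => [|e es IH] /=; first by move=> _ h _; apply: h.
move=> /andP[re res] h1 h2; apply: (run_ifB bs re) => [e0|ne0].
  apply: IH => // h; [apply: h1|apply: h2]; first by rewrite e0.
  by rewrite e0.
by apply: run_skipB; apply: h2; rewrite (negPf ne0).
Qed.

Definition recorded z s s' :=
  [/\ forall a i, a != 9%N -> a != 12%N -> s' a i = s a i,
      forall i, i != 0%N -> i != 2%N -> s' 9%N i = s 9%N i,
      s' 9%N 0%N = 1, s' 9%N 2%N = val_of s xj &
      forall i, s' 12%N i =
        if (i < 9)%N then val_of s (nth (Cst 0) (record_list z) i) else s 12%N i].

Lemma run_check z s (Q : memory -> Prop) : bnd low B s ->
  all (reads low) (etests xa xb xc xj z) -> all (reads low) (record_list z) ->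
  (all (fun e => 0 < val_of s e) (etests xa xb xc xj z) ->
     forall s', recorded z s s' -> Q s') ->
  (~~ all (fun e => 0 < val_of s e) (etests xa xb xc xj z) -> Q s) ->
  run (check z) s Q (ctime (check z) * B).
Proof.
move=> bs rt rr h1 h2; apply: run_guard => // ok.
apply: (run_seqB (Q1 := fun s1 => (forall a i, a != 12%N -> s1 a i = s a i) /\
  forall i, s1 12%N i =
    if (i < 9)%N then val_of s (nth (Cst 0) (record_list z) i) else s 12%N i)).
  apply: run_store => // s1 e1 e2; split=> // i.
  by rewrite e2 /= add0n subn0.
move=> s1 [e1 e2].
have b1 : bnd low B s1.
  by move=> a i la; rewrite e1 ?bs //; apply: contraTneq la => ->.
pose s2 := update s1 9%N 0%N 1.
apply: (run_seqB (Q1 := fun s' => s' = s2)).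
  by apply: run_assignB b1 _ _ _.
move=> _ ->.
have b2 : bnd low B s2.
  apply: bnd_update => // _; rewrite -[X in (X < _)%N]/(2 ^ 0)%N.
  by rewrite ltn_exp2l.
apply: run_assignB b2 _ _ _ => //; apply: h1 => //; split.
- by move=> a i a9 a12; rewrite /s2 /update (negPf a9) /= e1.
- by move=> i /negPf i0 /negPf i2; rewrite /s2 /update /= i2 i0 /= e1.
- by [].
- by rewrite /s2 /update /= !e1.
- by move=> i; rewrite /s2 /update /= e2.
Qed.

(** The state predicate is indexed by the candidates already tested, in reverse order, so that it
    can say which of them failed. *)
Lemma run_checks l s (J : seq (blk expr * expr) -> memory -> Prop) done :
  (forall d s, J d s -> bnd low B s) ->
  (forall z, List.In z l -> all (reads low) (etests xa xb xc xj z) /\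
     all (reads low) (record_list z)) ->
  (forall d z s, J d s -> all (fun e => 0 < val_of s e) (etests xa xb xc xj z) ->
     List.In z l -> forall s', recorded z s s' -> J (z :: d) s') ->
  (forall d z s, J d s -> ~~ all (fun e => 0 < val_of s e) (etests xa xb xc xj z) ->
     J (z :: d) s) ->
  J done s -> run (checks l) s (J (catrev l done)) (ctime (checks l) * B).
Proof.
move=> hb; elim: l done s => [|z l IH] d s hr hp hn Js.
  exact: run_skipB.
apply: (run_seqB (Q1 := J (z :: d))).
  have [r1 r2] := hr z (or_introl erefl).
  apply: run_check (hb _ _ Js) r1 r2 _ _ => [ok s' rec|nok].
    by apply: hp rec => //; left.
  exact: hn.
move=> s1 J1; apply: IH => // [y hy|d' y s' Js' ok hy]; first by apply: hr; right.
by apply: hp => //; right.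
Qed.

End Straight.

(** * The search *)

Lemma load_bits w a i : (bits (load w a i) <= (input_size w).+1)%N.
Proof.
have mem_sum (T : eqType) (f : T -> nat) (s : seq T) y : y \in s ->
    (f y <= \sum_(z <- s) f z)%N.
  by move=> ys; rewrite (big_rem y) //= leq_addr.
rewrite /load; have [ai|ai] := ltnP a (size w); last first.
  by rewrite (nth_default [::] ai) nth_nil.
set v := nth [::] w a; have [iv|iv] := ltnP i (size v); last first.
  by rewrite (nth_default 0 iv).
apply: leqW; apply: leq_trans (mem_sum _ _ _ _ (mem_nth 0 iv)) _.
exact: (mem_sum _ (fun v => \sum_(z <- v) bits z)%N _ _ (mem_nth [::] ai)).
Qed.

Lemma mem_map_In (T : Type) (U : eqType) (f : T -> U) (l : seq T) y :
  y \in map f l <-> exists t, List.In t l /\ y = f t.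
Proof.
elim: l => [|t l IH]; first by split=> // -[t []].
rewrite in_cons; split.
  case/orP => [/eqP ->|h]; first by exists t; split=> //; left.
  by have [u [hu ->]] := proj1 IH h; exists u; split=> //; right.
move=> [u [[<-|hu] yE]]; first by rewrite yE eqxx.
by apply/orP; right; apply: (proj2 IH); exists u.
Qed.

Section Search.
Variable x : instance.
Local Notation n1 := (nrows x).
Local Notation n2 := (ncols x).
Local Notation N := (n1 * n2)%N.
Local Notation F := (load (encode_instance x)).
Local Notation D := (D x).
Hypotheses (n10 : (0 < n1)%N) (n20 : (0 < n2)%N).

(** [D] has at most [2 * size + 1] bits, so D^55, the largest number of the search, stays below
    2^(110 size + 60). *)
Definition reg_bits := (110 * input_size (encode_instance x) + 60)%N.
Definition search_range : int := D ^+ 55.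
Local Notation B := reg_bits.
Local Notation S0 := search_range.

Definition zmat m : 'M[int]_(n1, n2) := map_mx (scaled x) (mat x m).
Definition za (k : bool) := zmat (if k then 3%N else 5%N).
Definition zb (k : bool) := scaled x (scalar_of x (if k then 0%N else 1%N)).
Definition zcands i i' l l' j :=
  cands (fun k => subblk (za k) i i' l l') zb (subblk (zmat 7%N) i i' l l') j.
Definition zcand_ok i i' l l' j z :=
  cand_ok (fun k => subblk (za k) i i' l l') zb (subblk (zmat 7%N) i i' l l') j z.

Definition pos (i : 'I_n1) (l : 'I_n2) := (i * n2 + l)%N.
Definition code i i' l l' := (pos i l * N + pos i' l')%N.

Lemma pos_lt i l : (pos i l < N)%N.
Proof. by have := ltn_ord i; have := ltn_ord l; rewrite /pos; nia. Qed.

Lemma code_lt i i' l l' : (code i i' l l' < N * N)%N.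
Proof. by have := pos_lt i l; have := pos_lt i' l'; rewrite /code; nia. Qed.

Lemma code_surj r : (r < N * N)%N -> exists i i' l l', r = code i i' l l'.
Proof.
move=> rN; have N0 : (0 < N)%N by rewrite muln_gt0 n10.
have [i [l e1]] : exists i l, (r %/ N)%N = pos i l.
  by apply: pos_split; rewrite ltn_divLR.
have [i' [l' e2]] : exists i' l', (r %% N)%N = pos i' l'.
  by apply: pos_split; rewrite ltn_mod.
by exists i, i', l, l'; rewrite /code -e1 -e2 -divn_eq.
Qed.

Definition base (s : memory) :=
  [/\ forall a i, (a < 9)%N -> s a i = F a i, s 9%N 1%N = D,
      forall i, [/\ s 10%N i = 0, s 11%N i = 0 & (9 <= i)%N -> s 12%N i = 0]
    & bnd low B s].

Lemma reg_bits_gt0 : (0 < B)%N. Proof. by rewrite /reg_bits addnS. Qed.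

Lemma search_range_lt : (`|S0| < 2 ^ B)%N.
Proof.
rewrite /search_range abszX; apply: leq_ltn_trans (_ : (2 ^ (2 * input_size (encode_instance x) + 1)) ^ 55 < _)%N.
  by rewrite leq_exp2r // D_size.
by rewrite -expnM ltn_exp2l // /reg_bits; lia.
Qed.

Lemma search_range_ge4 : 4 <= S0.
Proof.
have -> : S0 = D * D * D ^+ 53 by rewrite /search_range -expr2 -exprD.
have h : 1 <= D ^+ 53 by rewrite exprn_ege1 //; have := D_ge2 x; lia.
by have := D_ge2 x; nia.
Qed.

Section OneState.
Variable s : memory.
Hypothesis bs : base s.

Lemma val_N : val_of s xN = N%:Z.
Proof. by case: bs => h _ _ _; rewrite /xN /= !h //= PoszM. Qed.

Lemma val_n2 : val_of s rN2 = n2%:Z.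
Proof. by case: bs => h _ _ _; rewrite /= h. Qed.

Section Decode.
Variables (i i' : 'I_n1) (l l' : 'I_n2).
Hypothesis rE : s 9%N 4%N = (code i i' l l')%:Z.

Lemma val_p : val_of s xp = (pos i l)%:Z.
Proof.
have N0 : (0 < N)%N by rewrite muln_gt0 n10.
rewrite -[LHS]/(s 9%N 4%N %/ val_of s xN)%Z val_N rE divz_nat /code.
by rewrite divnMDl // divn_small ?addn0 // pos_lt.
Qed.

Lemma val_q : val_of s xq = (pos i' l')%:Z.
Proof.
rewrite -[LHS]/(s 9%N 4%N - val_of s xp * val_of s xN) val_p val_N rE.
by rewrite /code; lia.
Qed.

Lemma val_i : val_of s xi = i%:Z.
Proof.
rewrite -[LHS]/(val_of s xp %/ val_of s rN2)%Z val_p val_n2 divz_nat /pos.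
by rewrite divnMDl // divn_small ?addn0.
Qed.

Lemma val_i' : val_of s xi' = i'%:Z.
Proof.
rewrite -[LHS]/(val_of s xq %/ val_of s rN2)%Z val_q val_n2 divz_nat /pos.
by rewrite divnMDl // divn_small ?addn0.
Qed.

Lemma val_p12 : val_of s xp12 = (pos i l')%:Z.
Proof.
rewrite -[LHS]/(val_of s xi * val_of s rN2 + (val_of s xq - val_of s xi' * val_of s rN2)).
by rewrite val_i val_q val_i' val_n2 /pos; lia.
Qed.

Lemma val_p21 : val_of s xp21 = (pos i' l)%:Z.
Proof.
rewrite -[LHS]/(val_of s xi' * val_of s rN2 + (val_of s xp - val_of s xi * val_of s rN2)).
by rewrite val_i' val_p val_i val_n2 /pos; lia.
Qed.

Lemma val_sc m e r c : matbank m -> val_of s e = (pos r c)%:Z ->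
  val_of s (xsc m e) = zmat m r c.
Proof.
move=> mb eE; case: bs => h hD _ _.
have m9 : (m.+1 < 9)%N by move: mb; rewrite /matbank !inE => /or3P[]/eqP->.
by rewrite /= eE hD (h _ _ m9) (h _ _ (ltnW m9)) /= load_num // load_den // mxE.
Qed.

Lemma val_blk m : matbank m -> valb s (xblk m) = subblk (zmat m) i i' l l'.
Proof.
move=> mb; rewrite /valb /xblk /subblk; congr Blk; apply: val_sc => //.
- exact: val_p.
- exact: val_p12.
- exact: val_p21.
- exact: val_q.
Qed.

End Decode.

Lemma val_xb k : val_of s (xb k) = zb k.
Proof.
case: bs => h hD _ _.
have [a0 d0] := @load_scalar x 0 isT; have [a1 d1] := @load_scalar x 1 isT.
by rewrite /zb /scaled; case: k; rewrite /xb /xsc /rD /= hD !h // ?a0 ?d0 ?a1 ?d1.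
Qed.

Lemma val_xcands i i' l l' : s 9%N 4%N = (code i i' l l')%:Z ->
  [seq valz s z | z <- xcands] = zcands i i' l l' (val_of s xj).
Proof.
move=> rE; rewrite val_cands /zcands.
have -> : (fun k => valb s (xa k)) = (fun k => subblk (za k) i i' l l').
  by apply/funext => k; rewrite (val_blk rE) //; case: k.
have -> : (fun k => val_of s (xb k)) = zb by apply/funext => k; exact: val_xb.
by rewrite (val_blk rE).
Qed.

Lemma val_tests i i' l l' z : s 9%N 4%N = (code i i' l l')%:Z ->
  all (fun e => 0 < val_of s e) (etests xa xb xc xj z) <->
  zcand_ok i i' l l' (val_of s xj) (valz s z).
Proof.
move=> rE; rewrite tests_cand_ok /zcand_ok.
have -> : (fun k => valb s (xa k)) = (fun k => subblk (za k) i i' l l').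
  by apply/funext => k; rewrite (val_blk rE) //; case: k.
have -> : (fun k => val_of s (xb k)) = zb by apply/funext => k; exact: val_xb.
by rewrite (val_blk rE).
Qed.

End OneState.

Lemma reads_xp : [/\ reads low xp, reads low xp12, reads low xp21 & reads low xq].
Proof. by []. Qed.

Lemma reads_data : [/\ forall k, readsb low (xa k), forall k, reads low (xb k),
  readsb low xc & reads low xj].
Proof. by split=> // -[]. Qed.

Lemma reads_xcands z : List.In z xcands ->
  all (reads low) (etests xa xb xc xj z) /\ all (reads low) (record_list z).
Proof.
case: reads_data => ha hb hc hj hz.
have h := reads_cands ha hb hc hj hz.
split; first exact: reads_tests.
case/andP: h => /and4P[h1 h2 h3 h4] h5.
case: reads_xp => k1 k2 k3 k4.
by rewrite /record_list /= h1 h2 h3 h4 h5.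
Qed.

(* [Up v]: the scaled objective is less than [v] on the feasible set. *)
Variable Up : int -> Prop.
Hypothesis Up_mono : forall v w, Up v -> v <= w -> Up w.
Hypothesis Up_complete : forall j,
  (forall i i' l l' z, z \in zcands i i' l l' j -> ~ zcand_ok i i' l l' j z) -> Up j.
Hypothesis Up_sound : forall i i' l l' z j v,
  z \in zcands i i' l l' j -> zcand_ok i i' l l' j z -> Up v -> j < v.
Hypothesis Up_range : Up S0.

(** A crude common growth degree for everything that may be recorded, hence a bit bound for bank
    12. *)
Definition record_deg := sumn [seq edeg e | e <- flatten [seq record_list z | z <- xcands]].

Lemma record_deg_ge z i : List.In z xcands -> (i < 9)%N ->
  (edeg (nth (Cst 0) (record_list z) i) <= record_deg)%N.
Proof.
rewrite /record_deg => + i9; elim: xcands => [[]|y l IH].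
rewrite -[flatten _]/(record_list y ++ flatten [seq record_list z | z <- l]).
rewrite map_cat sumn_cat; case=> [<-|/IH h]; last exact: leq_trans h (leq_addl _ _).
apply: leq_trans (leq_addr _ _).
have : (i < size (record_list y))%N by [].
elim: (record_list y) (i) => // e r IHr [|k] ir; first exact: leq_addr.
by apply: leq_trans (IHr k ir) _; apply: leq_addl.
Qed.

Definition witnessed (s : memory) := s 9%N 0%N = 1 /\
  exists i i' l l' z, [/\ z \in zcands i i' l l' (s 9%N 2%N),
    zcand_ok i i' l l' (s 9%N 2%N) z,
    [/\ s 12%N 0%N = e11 z.1, s 12%N 1%N = e12 z.1, s 12%N 2%N = e21 z.1,
        s 12%N 3%N = e22 z.1 & s 12%N 4%N = z.2],
    [/\ s 12%N 5%N = (pos i l)%:Z, s 12%N 6%N = (pos i l')%:Z,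
        s 12%N 7%N = (pos i' l)%:Z & s 12%N 8%N = (pos i' l')%:Z] &
    forall k, (`|s 12%N k| < 2 ^ (record_deg * B))%N].

(** Either the search value is still the initial one and nothing is recorded, or the recorded
    candidate attains it. *)
Definition inv (st : int) (s : memory) :=
  [/\ base s, s 9%N 3%N = st, (s 9%N 0%N = 0 /\ s 9%N 2%N = - S0) \/ witnessed s,
      - S0 <= s 9%N 2%N & 0 <= st <= S0].

(** Soundness keeps the raised search value below the search range, so it still fits in a
    register. *)
Lemma recorded_inv st s s' z i i' l l' : inv st s -> s 9%N 4%N = (code i i' l l')%:Z ->
  List.In z xcands -> all (fun e => 0 < val_of s e) (etests xa xb xc xj z) ->
  recorded z s s' ->
  [/\ inv st s', s' 9%N 4%N = s 9%N 4%N & s' 9%N 2%N = s 9%N 2%N + st].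
Proof.
move=> [bs stE sw JS /andP[st0 stS]] rE hz ok [r1 r2 r3 r4 r5].
have jE : val_of s xj = s 9%N 2%N + st by rewrite /= stE.
have zin : valz s z \in zcands i i' l l' (val_of s xj).
  by rewrite -val_xcands //; apply/mem_map_In; exists z.
have zk : zcand_ok i i' l l' (val_of s xj) (valz s z) by apply/(val_tests bs z rE).
have jS : val_of s xj < S0 by apply: Up_sound zin zk Up_range.
have bs' : base s'.
  case: bs => h1 h2 h3 h4; split.
  - by move=> a k a9; rewrite r1 ?h1 //; lia.
  - by rewrite r2.
  - move=> k; have [g1 g2 g3] := h3 k; split; [by rewrite r1|by rewrite r1|].
    by move=> k9; rewrite r5 ltnNge k9; exact: g3.
  - move=> a k la; have [->|a9] := eqVneq a 9%N; last first.
      by rewrite r1 ?h4 //; apply: contraTneq la => ->.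
    have [->|k0] := eqVneq k 0%N.
      by rewrite r3 -[X in (X < _)%N]/(2 ^ 0)%N ltn_exp2l // reg_bits_gt0.
    have [->|k2] := eqVneq k 2%N; last by rewrite r2 ?h4.
    rewrite r4; apply: leq_ltn_trans search_range_lt.
    by move: jS JS st0; rewrite jE; lia.
split; [|by rewrite r2|by rewrite r4].
split=> //; [by rewrite r2| |rewrite r4 jE; lia|by rewrite st0].
right; split=> //; exists i, i', l, l', (valz s z); rewrite r4; split=> //.
- split; rewrite r5 //; [exact: (val_p bs rE)|exact: (val_p12 bs rE)
  |exact: (val_p21 bs rE)|exact: (val_q bs rE)].
move=> k; rewrite r5; have [k9|k9] := ltnP k 9; last first.
  by case: bs => _ _ /(_ k)[_ _ g] _; rewrite (g k9) expn_gt0.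
apply: leq_trans (_ : 2 ^ (edeg (nth (Cst 0) (record_list z) k) * B) <= _)%N; last first.
  by rewrite leq_exp2l // leq_mul2r record_deg_ge ?orbT.
apply: val_bound reg_bits_gt0 _ _; first by case: bs => _ _ _; apply.
by apply: (all_nthP _ (proj2 (reads_xcands hz))).
Qed.

Definition no_cand r j := forall i i' l l', code i i' l l' = r ->
  forall z, z \in zcands i i' l l' j -> ~ zcand_ok i i' l l' j z.

(** Either some candidate raises the value by [st], and the old bound [J0 + 2 st] becomes the
    required one, or the value stays and the block has no candidate for [J0 + st]. [X] carries what
    is known of earlier blocks. *)
Lemma run_block (X : Prop) st J0 r s : inv st s -> s 9%N 4%N = r%:Z -> (r < N * N)%N ->
  Up (J0 + st + st) -> Up (s 9%N 2%N + st) \/ (s 9%N 2%N = J0 /\ X) ->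
  run (checks xcands) s (fun s' => [/\ inv st s', s' 9%N 4%N = r%:Z &
    Up (s' 9%N 2%N + st) \/ [/\ s' 9%N 2%N = J0, X & no_cand r (J0 + st)]])
   (ctime (checks xcands) * B).
Proof.
move=> hi rE rN U2 UJ.
pose Jv (d : seq (blk expr * expr)) s' := [/\ inv st s', s' 9%N 4%N = r%:Z &
  Up (s' 9%N 2%N + st) \/ [/\ s' 9%N 2%N = J0, X &
    forall z, List.In z d -> ~ all (fun e => 0 < val_of s' e) (etests xa xb xc xj z)]].
have [i [i' [l [l' rc]]]] := code_surj rN.
apply: (run_weaken (@run_checks _ reg_bits_gt0 xcands s Jv [::] _ _ _ _ _)) => //.
- by move=> d s1 [[[_ _ _ ?] _ _ _ _]].
- exact: reads_xcands.
- move=> d z s1 [h1 h2 h3] ok hz s2 rec.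
  rewrite rc in h2; have [i2 r2 j2] := recorded_inv h1 h2 hz ok rec.
  split=> //; first by rewrite r2 h2 rc.
  left; rewrite j2; case: h1 => _ _ _ _ /andP[st0 _].
  case: h3 => [h3|[-> _ _]] //; apply: Up_mono h3 _; lia.
- move=> d z s1 [h1 h2 h3] nok; split=> //.
  case: h3 => [h3|[h3 hX h4]]; [by left|right]; split=> // y [<-|/h4//].
  exact/negP.
- by split=> //; case: UJ => [h|[h hX]]; [left|right].
move=> s' [h1 h2 h3]; split=> //; case: h3 => [h3|[h3 hX h4]]; [by left|right].
split=> // k k' m m' ce z zin zk.
have re : s' 9%N 4%N = (code k k' m m')%:Z by rewrite h2 ce.
have bs' : base s' by case: h1.
have jE : val_of s' xj = J0 + st by rewrite /= h3; case: h1 => _ -> _ _ _.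
rewrite -jE -(val_xcands bs' re) in zin.
have [y [hy zE]] := (mem_map_In _ _ _).1 zin.
have yin : List.In y (catrev xcands [::]).
  have gen (T : Type) (t : T) u w : List.In t u \/ List.In t w -> List.In t (catrev u w).
    elim: u w => [|b u IH] w /=; first by case.
    by case=> [[e|hu]|hw]; apply: IH; [right; left|left|right; right].
  by apply: gen; left.
apply: (h4 y yin); apply/(val_tests bs' y re).
by rewrite jE -zE.
Qed.

Lemma inv_counter st s z : inv st s -> (`|z| < 2 ^ B)%N -> inv st (update s 9%N 4%N z).
Proof.
move=> [[h1 h2 h3 h4] h5 h6 h7 h8] zB; split=> //; split=> //.
  by move=> a i a9; rewrite update_ne ?h1 // neq_ltn a9.
exact: bnd_update.
Qed.

Lemma inv_step st st' s : inv st s -> 0 <= st' <= S0 -> inv st' (update s 9%N 3%N st').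
Proof.
move=> [[h1 h2 h3 h4] h5 h6 h7 h8] /andP[s0 sS]; split=> //; last by rewrite s0.
split=> //.
  by move=> a i a9; rewrite update_ne ?h1 // neq_ltn a9.
by apply: bnd_update => // _; apply: leq_ltn_trans search_range_lt; lia.
Qed.

Lemma counter_lt r : (r <= N * N)%N -> (`|r%:Z| < 2 ^ B)%N.
Proof.
have [Nz _] := dims_size x; move=> rN.
have h : (N < 2 ^ N)%N by apply: ltn_expl.
apply: leq_ltn_trans (_ : N * N < _)%N; first by lia.
apply: leq_trans (_ : 2 ^ (N + N) <= _)%N; first by rewrite expnD ltn_mul.
by rewrite leq_exp2l // /reg_bits; lia.
Qed.

Definition sweep_time := (ctime (Assign 9 (Cst 4) (Cst 0)) * B +
  ((N * N).+1 * (ecost (esub (emul xN xN) rR) * B) +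
   N * N * (ctime (Seq (checks xcands) incr) * B)))%N.

(** One step of the binary search: the gap between the attained value and the strict upper bound
    shrinks from [2 st] to [st]. If nothing is found in any block, completeness supplies the
    bound. *)
Lemma run_sweep st s : inv st s -> Up (s 9%N 2%N + st + st) ->
  run sweep s (fun s' => inv st s' /\ Up (s' 9%N 2%N + st)) sweep_time.
Proof.
move=> hi U2; set J0 := s 9%N 2%N in U2.
have bl s' : inv st s' -> bnd low B s' by case=> -[].
apply: (run_seq (Q1 := fun s1 => s1 = update s 9%N 4%N 0)).
  by apply: run_assignB (bl _ hi) _ _ _ => //; exact: reg_bits_gt0.
move=> _ ->.
pose I k s' := exists r, [/\ (k + r = N * N)%N, inv st s', s' 9%N 4%N = r%:Z &
  Up (s' 9%N 2%N + st) \/ (s' 9%N 2%N = J0 /\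
    forall r', (r' < r)%N -> no_cand r' (J0 + st))].
have gE k s' : I k s' -> val_of s' (esub (emul xN xN) rR) = k%:Z.
  move=> [r [kr [bs' _ _ _ _] rE _]].
  rewrite -[LHS]/(val_of s' xN * val_of s' xN - s' 9%N 4%N) (val_N bs') rE.
  by move: kr; lia.
apply: (run_while (I := I)).
- by move=> k s' [r [_ /bl b' _ _]]; exact: cost_bound reg_bits_gt0 b' _.
- move=> k s' Ik; rewrite (gE _ _ Ik) ltz_nat; case: Ik => r [kr hi' rE hU].
  case: k kr => [|k] kr; [left|right]; split=> //.
    split=> //; case: hU => // -[-> h]; apply: Up_complete => i i' l l' z.
    apply: (h (code i i' l l')) => //.
    by have := code_lt i i' l l'; move: kr; rewrite add0n => ->.
  have rN : (r < N * N)%N by move: kr; lia.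
  apply: (run_seqB (Q1 := fun s1 => [/\ inv st s1, s1 9%N 4%N = r%:Z &
     Up (s1 9%N 2%N + st) \/ (s1 9%N 2%N = J0 /\ forall r', (r' < r.+1)%N ->
        no_cand r' (J0 + st))])).
    apply: run_weaken (run_block hi' rE rN U2 hU) (leqnn _) _.
    move=> s1 [a1 a2 a3]; split=> //; case: a3 => [a3|[a3 hX a4]]; [by left|right].
    split=> // r'; rewrite ltnS leq_eqVlt => /orP[/eqP->//|]; exact: hX.
  move=> s1 [a1 a2 a3]; apply: run_assignB (bl _ a1) _ _ _ => //; first exact: reg_bits_gt0.
  have -> : val_of s1 (Op Add rR (Cst 1)) = (r.+1)%:Z by rewrite /= a2; lia.
  exists r.+1; split=> //; first by move: kr; rewrite addSnnS.
  by apply: inv_counter => //; exact: counter_lt.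
exists 0%N; split=> //; first by rewrite addn0.
  by apply: inv_counter => //; rewrite expn_gt0.
by right; split.
Qed.

Definition search_time := (B.+2 * (ecost rS * B) +
  B.+1 * (sweep_time + ctime halve * B))%N.

(** A step of at most 2^(k-1) leaves at most [k] rounds: the halvings down to 1 and the final
    replacement by 0. Initially [k] is the register size plus 1. *)
Lemma run_search s : inv S0 s -> s 9%N 2%N = - S0 ->
  run search s (fun s' => inv 0 s' /\ Up (s' 9%N 2%N + 1)) search_time.
Proof.
move=> hi hJ.
have bl st s' : inv st s' -> bnd low B s' by case=> -[].
pose I k s' := exists st, inv st s' /\
  ((st = 0 /\ Up (s' 9%N 2%N + 1)) \/
   [/\ 0 < st, (0 < k)%N, (`|st| <= 2 ^ k.-1)%N & Up (s' 9%N 2%N + st + st)]).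
apply: (run_while (I := I)).
- by move=> k s' [st [/bl b' _]]; exact: cost_bound reg_bits_gt0 b' _.
- move=> k s' [st [hi' h]]; have stE : val_of s' rS = st by case: hi'.
  rewrite stE; case: h => [[st0 hU]|[st0 k0 stk hU]].
    by left; rewrite st0 ltxx; split=> //; rewrite -st0.
  right; split=> //.
  apply: run_seq (run_sweep hi' hU) _ => s1 [hi1 U1].
  have st1 : s1 9%N 3%N = st by case: hi1.
  have stS : st <= S0 by case: hi1 => _ _ _ _ /andP[].
  apply: run_ifB (bl _ _ hi1) _ _ _ => //; first exact: reg_bits_gt0.
    rewrite /= st1 => stgt; apply: run_assignB (bl _ _ hi1) _ _ _ => //; first exact: reg_bits_gt0.
    have [st' stE'] : exists st', st' = val_of s1 (Op Div (Op Add rS (Cst 1)) (Cst 2)).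
      by eexists.
    rewrite -stE'; move: stE'; rewrite /= st1 => stE'.
    exists st'; split; first by apply: inv_step hi1 _; lia.
    right; split; [lia| | |].
    - by case: k k0 stk => [|[|k]] //=; lia.
    - case: k k0 stk => [|[|k]] //=; first by lia.
      by rewrite expnS; lia.
    - by apply: Up_mono U1 _; rewrite /update /=; lia.
  rewrite /= st1 => stle; have st1' : st = 1 by lia.
  apply: run_assignB (bl _ _ hi1) _ _ _ => //; first exact: reg_bits_gt0.
  exists 0; split; first by apply: inv_step hi1 _; have := search_range_ge4; lia.
  by left; split=> //; move: U1; rewrite st1'.
exists S0; split=> //; right; split=> //.
- by have := search_range_ge4; lia.
- exact: ltnW search_range_lt.
by rewrite hJ addNr add0r.
Qed.

Definition den_time := (ctime den_init * B +
  (N.+1 * (ecost (esub xN rR) * B) + N * (ctime (Seq den_step incr) * B)))%N.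

Lemma load_low a i : (`|F a i| < 2 ^ B)%N.
Proof.
apply: leq_trans (bits_gt _) _; rewrite leq_exp2l //.
by apply: leq_trans (load_bits _ _ _) _; rewrite /reg_bits; lia.
Qed.

Definition started s := [/\ base s, s 9%N 0%N = 0 & s 9%N 3%N = 0].

Lemma den_prod_lt k : (k <= N)%N -> (`|den_prod x k| < 2 ^ B)%N.
Proof.
move=> kN; apply: leq_ltn_trans (_ : `|D| < _)%N.
  by have := den_prod_le kN; have := den_prod_ge2 kN; lia.
apply: leq_ltn_trans (D_size x) _; rewrite ltn_exp2l // /reg_bits; lia.
Qed.

Lemma run_den : run (Seq den_init den_loop) F started den_time.
Proof.
have F9 i : F 9%N i = 0 by rewrite /load nth_default // nth_nil.
have bF : bnd low B F by move=> a i _; exact: load_low.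
have facE s m e i : (forall a i, (a < 9)%N -> s a i = F a i) -> (m.+1 < 9)%N ->
    val_of s e = i%:Z -> val_of s (xfac m e) = fac x m i.
  by move=> h m9 eE; rewrite /= eE (h _ _ m9) (h _ _ (ltnW m9)).
pose I k s := exists i, [/\ (k + i = N)%N, forall a i, (a < 9)%N -> s a i = F a i,
  s 9%N 1%N = den_prod x i /\ s 9%N 4%N = i%:Z,
  (forall j, [/\ s 10%N j = 0, s 11%N j = 0 & (9 <= j)%N -> s 12%N j = 0]) /\ bnd low B s &
  s 9%N 0%N = 0 /\ s 9%N 3%N = 0].
have dvE s : (forall a i, (a < 9)%N -> s a i = F a i) -> val_of s xN = N%:Z.
  by move=> h; rewrite /xN /= !h //= PoszM.
apply: (run_seq (Q1 := I N)).
  apply: run_assignB (bF) _ _ _ => //; first exact: reg_bits_gt0.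
  have -> : val_of F (emul (Cst 2) (emul (xfac 1 (Cst 0))
      (emul (xfac 1 (Cst 1)) (xfac 1 (Cst 2))))) = den_prod x 0.
    rewrite /den_prod big_ord0 mulr1 /fac0.
    by rewrite -(@facE F 1%N (Cst 0) 0%N) // -(@facE F 1%N (Cst 1) 1%N) //
      -(@facE F 1%N (Cst 2) 2%N).
  exists 0%N; split; first by rewrite addn0.
  - by move=> a i a9; rewrite update_ne // neq_ltn a9.
  - by rewrite /update /= F9.
  - split=> [j|]; last first.
      refine (@bnd_update low B F 9 `|val_of F (Cst 1)| (den_prod x 0) bF _).
      by move=> _; exact: den_prod_lt.
    by split=> [||_]; rewrite !update_ne // /load !nth_default // nth_nil.
  - by rewrite /update /= !F9.
move=> s1 h1; apply: (run_while (I := I)) h1.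
- by move=> k s [i [_ _ _ [_ b1] _]]; exact: cost_bound reg_bits_gt0 b1 _.
move=> k s [i [kN h [hD hi] [h0 b1] [h3 h4]]].
have -> : val_of s (esub xN rR) = k%:Z.
  rewrite -[LHS]/(val_of s xN - s 9%N 4%N) dvE // hi; lia.
rewrite ltz_nat; case: k kN => [|k] kN; [left|right]; split=> //.
  move: kN; rewrite add0n => iN; split=> //; split=> //.
  by rewrite hD iN.
have iN : (i < N)%N by move: kN; lia.
have dE : val_of s (emul rD (emul (xfac 3 rR) (emul (xfac 5 rR) (xfac 7 rR)))) = den_prod x i.+1.
  rewrite den_prodS /fac3 -hD -(@facE s 3%N rR i) // -(@facE s 5%N rR i) //.
  by rewrite -(@facE s 7%N rR i).
apply: (run_seqB (Q1 := fun s1 => s1 = update s 9%N 1%N (den_prod x i.+1))).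
  apply: run_assignB (b1) _ _ _ => //; first exact: reg_bits_gt0.
  by rewrite dE.
move=> _ ->; have b2 : bnd low B (update s 9%N 1%N (den_prod x i.+1)).
  by apply: bnd_update => // _; exact: den_prod_lt.
apply: run_assignB (b2) _ _ _ => //; first exact: reg_bits_gt0.
have -> : val_of (update s 9%N 1%N (den_prod x i.+1)) (eadd rR (Cst 1)) = (i.+1)%:Z.
  by rewrite /= /update /= hi; lia.
exists i.+1; split=> //; first by move: kN; rewrite addSnnS.
- by move=> a j a9; rewrite !update_ne ?h // neq_ltn a9.
- split=> //; apply: bnd_update => // _; apply: counter_lt.
  by apply: leq_trans iN _; nia.
Qed.

Definition main_time := (den_time + (ctime set_step * B + (ctime set_search * B + search_time)))%N.

Lemma run_main : run (Seq (Seq den_init den_loop) (Seq set_step (Seq set_search search))) F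
  (fun s' => inv 0 s' /\ Up (s' 9%N 2%N + 1)) main_time.
Proof.
apply: run_seq run_den _ => s [bs h0 h3].
have b1 : bnd low B s by case: bs.
have powE n : val_of s (xpow rD n) = D ^+ n.
  by case: bs => _ hD _ _; elim: n => //= n ->; rewrite hD exprS.
have pr n : reads low (xpow rD n) by elim: n.
have Sb : (`|S0| < 2 ^ B)%N by exact: search_range_lt.
have S4 := search_range_ge4.
pose s1 := update s 9%N 3%N S0.
have b2 : bnd low B s1 by apply: bnd_update.
apply: (run_seq (Q1 := fun s' => s' = s1)).
  apply: run_assignB (b1) _ (pr 55%N) _ => //; first exact: reg_bits_gt0.
  by rewrite powE.
move=> _ ->; pose s2 := update s1 9%N 2%N (- S0).
have b3 : bnd low B s2 by apply: bnd_update => // _; rewrite abszN.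
apply: (run_seq (Q1 := fun s' => s' = s2)).
  apply: run_assignB (b2) _ _ _ => //; first exact: reg_bits_gt0.
  by rewrite /= sub0r.
move=> _ ->; apply: run_search => //; split=> //; last by rewrite lexx andbT; lia.
  case: bs => g1 g2 g3 _; split=> //.
  by move=> a i a9; rewrite /s2 /s1 !update_ne ?g1 // neq_ltn a9.
by left.
Qed.

End Search.

(** * Writing the recorded solution *)

Section Output.
Variables (B : nat) (s : memory).
Hypothesis B0 : (0 < B)%N.
Hypothesis sB : forall a i, (a < 13)%N -> a != 10%N -> a != 11%N ->
  (`|s a i| < 2 ^ B)%N.
Hypotheses (s10 : forall i, s 10%N i = 0) (s11 : forall i, s 11%N i = 0).
Let P t := `|s 12%N (5 + t)%N|%N.

Definition written q (s' : memory) :=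
  [/\ forall a i, a != 10%N -> a != 11%N -> s' a i = s a i,
      forall p, s' 10%N p = \sum_(t < q) (if P t == p then s 12%N t else 0) &
      forall p, s' 11%N p = if [exists t : 'I_q, P t == p] then s 12%N 4%N else 0].

(** At most four numbers accumulate in one register, which costs two more bits. *)
Lemma written_bnd q s' : (q <= 4)%N -> written q s' -> bnd (fun a => a < 13)%N (B + 2) s'.
Proof.
move=> q4 [h1 h2 h3] a i a13.
have BB : (2 ^ B <= 2 ^ (B + 2))%N by rewrite leq_exp2l // leq_addr.
have [->|a10] := eqVneq a 10%N.
  rewrite h2; apply: leq_ltn_trans (_ : q * (2 ^ B).-1 < _)%N.
    elim: (q) => [|q' IH]; first by rewrite big_ord0.
    rewrite big_ord_recr /= mulSn.
    have : (`|if P q' == i then s 12%N q' else 0%R| <= (2 ^ B).-1)%N.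
      by case: ifP => _ //; have := @sB 12%N q' isT isT isT; lia.
    move: IH; set u := bigop _ _ _; set w := (if _ then _ else _).
    by set t := (q' * _)%N; lia.
  have : (0 < 2 ^ B)%N by rewrite expn_gt0.
  rewrite expnD; nia.
have [->|a11] := eqVneq a 11%N.
  rewrite h3; case: ifP => _; last by rewrite expn_gt0.
  exact: leq_trans (sB _ _ _ _) BB.
by rewrite h1 //; exact: leq_trans (sB _ _ _ _) BB.
Qed.

Lemma run_out q s' : (q < 4)%N -> written q s' ->
  run (out q) s' (written q.+1) (ctime (out q) * (B + 2)).
Proof.
move=> q4 w; have b1 := written_bnd (ltnW q4) w; case: w => h1 h2 h3.
have B2 : (0 < B + 2)%N by rewrite addnC.
pose v := s' 10%N (P q) + s 12%N q.
pose s1 := update s' 10%N (P q) v.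
apply: (run_seqB (Q1 := fun s2 => s2 = s1)).
  apply: (run_assignB B2 b1) => //.
  by rewrite /s1 /v /= !(h1 12%N).
move=> _ ->.
have w1 p : s1 10%N p = \sum_(t < q.+1) (if P t == p then s 12%N t else 0).
  rewrite big_ord_recr /= -h2 /s1 /v /update /= eq_sym.
  by case: eqP => [->//|_]; rewrite addr0.
have b2 : bnd (fun a => a < 13)%N (B + 2) s1.
  apply: bnd_update b1 _ => _.
  (* Between the two assignments the state is not yet of the form [written]. An auxiliary memory
     with the same bank 10 and completed denominators is, and yields the bound on bank 10. *)
  have := @written_bnd q.+1 (fun a p => if a == 10%N then s1 10%N p else
    if a == 11%N then (if [exists t : 'I_q.+1, P t == p] then s 12%N 4%N else 0) else s a p) q4.
  have wr : written q.+1 (fun a p => if a == 10%N then s1 10%N p else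
    if a == 11%N then (if [exists t : 'I_q.+1, P t == p] then s 12%N 4%N else 0) else s a p).
    by split=> // a i /negPf -> /negPf ->.
  move=> /(_ wr 10%N (P q) isT); by rewrite /= /s1 /update !eqxx.
apply: (run_assignB B2 b2) => //.
have e12 i : s1 12%N i = s 12%N i by rewrite /s1 /update /= (h1 12%N).
rewrite /= !e12 -/(P q); split.
- by move=> a i a10 a11; rewrite /update (negPf a11) /= /s1 /update (negPf a10) /= h1.
- by move=> p; rewrite update_ne.
move=> p; rewrite /update /=; case: eqP => [pE|pE].
  have -> : [exists t : 'I_q.+1, P t == p].
    by apply/existsP; exists ord_max; rewrite pE /P.
  by [].
rewrite -[LHS]/(s1 11%N p) /s1 update_ne // h3; congr (if _ then _ else _).
apply/existsP/existsP => -[t ht].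
  by exists (widen_ord (leqnSn q) t).
have tq : (t < q)%N.
  rewrite ltn_neqAle -ltnS ltn_ord andbT; apply/eqP => tq; apply: pE.
  by rewrite -(eqP ht) /P tq.
by exists (Ordinal tq).
Qed.

Lemma run_output : 0 < s 9%N 0%N ->
  run output s (written 4) (ctime output * (B + 2)).
Proof.
have w0 : written 0 s.
  split=> // p; rewrite ?big_ord0 // ?s10 // s11; case: ifP => // /existsP[[]] //.
move=> st; have B2 : (0 < B + 2)%N by rewrite addnC.
apply: (run_ifB B2 (written_bnd (isT : (0 <= 4)%N) w0)) => //=; last by rewrite st.
move=> _; have r := run_out.
apply: (run_seqB (r _ _ _ w0)) => // s1 w1.
apply: (run_seqB (r _ _ _ w1)) => // s2 w2.
apply: (run_seqB (r _ _ _ w2)) => // s3 w3.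
exact: (r 3%N).
Qed.

End Output.

(** * Correctness and running time *)

Section Semantics.
Variables (R : realType) (x : instance).
Local Notation n1 := (nrows x).
Local Notation n2 := (ncols x).
Local Notation N := (n1 * n2)%N.
Local Notation D := (D x).
Local Notation feas := (@feasible R x).
Local Notation toR := (intr : {rmorphism int -> R}).
Hypothesis vx : valid_instance R x.

Definition rza k : 'M[R]_(n1, n2) := map_mx toR (za x k).
Definition rzb k : R := (zb x k)%:~R.
Definition rzc : 'M[R]_(n1, n2) := map_mx toR (zmat x 7%N).

Let n10 : (0 < n1)%N. Proof. by case: vx. Qed.
Let n20 : (0 < n2)%N. Proof. by case: vx. Qed.
Let D0 : 0 < D%:~R :> R. Proof. by rewrite ltr0z; have := D_ge2 x; lia. Qed.

Lemma rzmatE m : matbank m -> map_mx toR (zmat x m) = D%:~R *: mx_ratr R (mat x m).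
Proof.
move=> mb; apply/matrixP => i j; rewrite !mxE.
by apply: scaledE; case: (entry_data i j mb).
Qed.

Let sc3 (k : bool) : ((if k then 0 else 1) < 3)%N. Proof. by case: k. Qed.

Lemma rzbE k : rzb k = D%:~R * ratr (scalar_of x (if k then 0%N else 1%N)).
Proof. by apply: scaledE; apply: (scalar_data _ (sc3 k)).1. Qed.

Lemma mxdotZl m n (t : R) (A W : 'M[R]_(m, n)) : mxdot (t *: A) W = t * mxdot A W.
Proof.
rewrite /mxdot mulr_sumr; apply: eq_bigr => i _; rewrite mulr_sumr.
by apply: eq_bigr => j _; rewrite mxE mulrA.
Qed.

Lemma feasibleE : feas = r1set rza rzb.
Proof.
have e k W : (mxdot (rza k) W <= rzb k) =
    (mxdot (mx_ratr R (mat x (if k then 3%N else 5%N))) W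
     <= ratr (scalar_of x (if k then 0%N else 1%N))).
  rewrite /rza /za rzmatE ?rzbE ?mxdotZl ?ler_pM2l //; by case: k.
rewrite /feasible /r1set /rank1_set; apply/seteqP; split=> W /=.
  by move=> [h0 h1 h2 h3]; split=> //; rewrite e.
by move=> [h0 + + h3]; rewrite !e => h1 h2; split.
Qed.

Lemma objectiveE W : mxdot rzc W = D%:~R * objective W.
Proof. by rewrite /rzc rzmatE // mxdotZl. Qed.

Lemma subblk_mapb (A : 'M[int]_(n1, n2)) i i' l l' :
  subblk (map_mx toR A) i i' l l' = mapb toR (subblk A i i' l l').
Proof. by rewrite /subblk /mapb /= !mxE. Qed.

Lemma rcandsE (i i' : 'I_n1) (l l' : 'I_n2) j :
  cands (fun k => subblk (rza k) i i' l l') rzb (subblk rzc i i' l l') j%:~R =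
  [seq (mapb toR z.1, z.2%:~R : R) | z <- zcands i i' l l' j].
Proof.
rewrite -[RHS](@cands_map _ _ toR) -subblk_mapb.
by congr cands; apply/funext => k; rewrite subblk_mapb.
Qed.

Lemma rcand_okE (i i' : 'I_n1) (l l' : 'I_n2) j z :
  cand_ok (fun k => subblk (rza k) i i' l l') rzb (subblk rzc i i' l l') j%:~R
    (mapb toR z.1, z.2%:~R) <-> zcand_ok i i' l l' j z.
Proof.
rewrite /zcand_ok -(@cand_ok_map R) -subblk_mapb.
have -> // : (fun k => subblk (rza k) i i' l l') =
   (fun k => mapb toR (subblk (za x k) i i' l l')).
by apply/funext => k; rewrite subblk_mapb.
Qed.

Definition above (v : int) := forall W, feas W -> mxdot rzc W < v%:~R.

Lemma above_mono v w : above v -> v <= w -> above w.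
Proof. by move=> h vw W /h /lt_le_trans -> //; rewrite ler_int. Qed.

Let bdU : exists M, entry_bound rza rzb M.
Proof. by apply: bounded_entry_bound; rewrite -feasibleE; case: vx. Qed.

Lemma above_complete j :
  (forall (i i' : 'I_n1) (l l' : 'I_n2) z, z \in zcands i i' l l' j -> ~ zcand_ok i i' l l' j z) -> above j.
Proof.
move=> h W; rewrite feasibleE => fW; rewrite ltNge; apply/negP => jW.
have [M bM] := bdU.
have [i [i' [l [l' [z []]]]]] := cands_complete bM n10 n20 fW jW.
by rewrite rcandsE => /mapP[y /h ny ->] /rcand_okE.
Qed.

Definition solution (i i' : 'I_n1) (l l' : 'I_n2) (z : blk int * int) : 'M[R]_(n1, n2) :=
  embed i i' l l' (scaleb (z.2%:~R)^-1 (mapb toR z.1)).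

Lemma solutionP (i i' : 'I_n1) (l l' : 'I_n2) z j : z \in zcands i i' l l' j -> zcand_ok i i' l l' j z ->
  feas (solution i i' l l' z) /\ j%:~R <= mxdot rzc (solution i i' l l' z).
Proof.
move=> zin /rcand_okE zk; rewrite feasibleE.
by apply: cands_sound zk; rewrite rcandsE; apply/mapP; exists z.
Qed.

Lemma above_sound (i i' : 'I_n1) (l l' : 'I_n2) z j v :
  z \in zcands i i' l l' j -> zcand_ok i i' l l' j z -> above v -> j < v.
Proof.
move=> zin zk /(_ (solution i i' l l' z)); have [f g] := solutionP zin zk.
by move=> /(_ f) /(le_lt_trans g); rewrite ltr_int.
Qed.

Lemma max_feasible : feas !=set0 -> exists V, [/\ feas V,
  forall W, feas W -> mxdot rzc W <= mxdot rzc V &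
  `|mxdot rzc V| <= D%:~R ^+ 54].
Proof.
rewrite feasibleE => ne; have [M bM] := bdU.
have [V fV Vmax] := max_exists rzc bM ne; exists V; split=> //.
(* The scaled data are bounded by N = D^2, and the maximum by N^27. *)
have -> : D%:~R ^+ 54 = (D%:~R ^+ 2) ^+ 27 :> R by rewrite -exprM.
have zD (z : int) : `|z| <= D * D -> z%:~R \is a Num.int /\ `|z%:~R| <= D%:~R ^+ 2 :> R.
  by move=> h; rewrite intr_int -intr_norm expr2 -intrM ler_int.
apply: (@max_bound _ _ _ _ _ rzc M bM (D%:~R ^+ 2) _ _ _ _ V fV Vmax).
- by rewrite expr2 -intrM -[2]/(2%:~R) ler_int; have := D_ge2 x; nia.
- by move=> k; apply: zD; apply: (scalar_data _ (sc3 k)).2.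
- move=> k i j; rewrite !mxE; apply: zD.
  by case: k; [case: (entry_data i j (isT : matbank 3))|case: (entry_data i j (isT : matbank 5))].
by move=> i j; rewrite !mxE; apply: zD; case: (entry_data i j (isT : matbank 7)).
Qed.

Lemma den_pow_lt : D ^+ 54 + 1 <= search_range x.
Proof.
rewrite /search_range [D ^+ 55]exprS; have h : 1 <= D ^+ 54.
  by rewrite exprn_ege1 //; have := D_ge2 x; lia.
by move: h; set y := D ^+ 54 => h; have := D_ge2 x; nia.
Qed.

Lemma above_range : above (search_range x).
Proof.
move=> W fW; have [V [fV Vmax Vb]] := max_feasible (ex_intro _ W fW).
apply: le_lt_trans (Vmax _ fW) _; apply: le_lt_trans (ler_norm _) _.
apply: le_lt_trans Vb _; rewrite -rmorphXn /= ltr_int.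
by have := den_pow_lt; set y := _ ^+ 54; lia.
Qed.

(** A maximum would be at least -D^54, hence at least [- search_range x + 1]: if the search ends at
    its initial value, the feasible set is empty. *)
Lemma above_empty : above (- search_range x + 1) -> feas = set0.
Proof.
move=> h; apply/seteqP; split=> // W fW; exfalso.
have [V [fV _]] := max_feasible (ex_intro _ W fW).
have := h V fV; rewrite ler_norml -rmorphXn /= -rmorphN => lt /andP[ge _].
have := le_lt_trans ge lt; rewrite ltr_int.
by have := den_pow_lt; set y := _ ^+ 54; lia.
Qed.

Lemma pos_inj (i r : 'I_n1) (l c : 'I_n2) : (pos i l == pos r c) = (i == r) && (l == c).
Proof.
apply/eqP/andP => [e|[/eqP-> /eqP->//]].
have e1 : (i : nat) = r.
  by have := congr1 (fun p => p %/ n2)%N e; rewrite /pos !divnMDl // !divn_small ?addn0.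
split; apply/eqP; apply: val_inj => //=.
by move: e; rewrite /pos e1 => /addnI.
Qed.

Lemma answer_solution (i i' : 'I_n1) (l l' : 'I_n2) z s s' :
  written s 4 s' -> 0 < z.2 ->
  [/\ s 12%N 0%N = e11 z.1, s 12%N 1%N = e12 z.1, s 12%N 2%N = e21 z.1,
      s 12%N 3%N = e22 z.1 & s 12%N 4%N = z.2] ->
  [/\ s 12%N 5%N = (pos i l)%:Z, s 12%N 6%N = (pos i l')%:Z,
      s 12%N 7%N = (pos i' l)%:Z & s 12%N 8%N = (pos i' l')%:Z] ->
  mx_ratr R (answer n1 n2 s') = solution i i' l l' z.
Proof.
move=> [_ h10 h11] z0 [v0 v1 v2 v3 v4] [p0 p1 p2 p3].
have zn : z.2%:~R != 0 :> R by rewrite intr_eq0; lia.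
apply/matrixP => r c; rewrite !mxE -/(pos r c) h10 h11 fmorph_div /= !ratr_int.
have pE (i1 : 'I_n1) (l1 : 'I_n2) :
    (`|(pos i1 l1)%:Z|%N == pos r c) = (r == i1) && (c == l1).
  by rewrite /= pos_inj eq_sym [l1 == c]eq_sym.
case: ifPn => [_|/existsPn ne].
  rewrite !big_ord_recl big_ord0 /= v0 v1 v2 v3 v4 p0 p1 p2 p3 !pE.
  by do 4!case: (_ && _); rewrite ?addr0 ?add0r ?intrD /=; field.
have := ne 0; have := ne 1; have := ne 2%:R; have := ne 3%:R.
rewrite /= p0 p1 p2 p3 !pE => /negPf -> /negPf -> /negPf -> /negPf ->.
(* At positions never written the answer is 0 / 0, which is 0 as required. *)
by rewrite invr0 mulr0 !mulr0 !addr0.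
Qed.

End Semantics.

(** * The polynomial bound on the running time *)

Section Polynomials.
Local Notation size x := (input_size (encode_instance x)).

(** The input size is positive, so monomials bound all polynomials and a sum of exponents serves as
    a common exponent. *)
Definition poly_bounded (f : instance -> nat) :=
  exists c d, forall x, (f x <= c * size x ^ d)%N.

Lemma poly_cst k : poly_bounded (fun=> k).
Proof. by exists k, 0%N => x; rewrite muln1. Qed.

Lemma poly_size : poly_bounded (fun x => size x).
Proof. by exists 1%N, 1%N => x; rewrite mul1n. Qed.

Lemma poly_dims : poly_bounded (fun x => nrows x * ncols x)%N.
Proof. by exists 1%N, 1%N => x; rewrite mul1n; case: (dims_size x). Qed.

Lemma polyD f g : poly_bounded f -> poly_bounded g -> poly_bounded (fun x => f x + g x)%N.
Proof.
move=> [c [d h]] [c' [d' h']]; exists (c + c')%N, (d + d')%N => x.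
have z0 : (0 < size x)%N by case: (dims_size x) => _ [].
rewrite mulnDl; apply: leq_add.
  by apply: leq_trans (h x) _; rewrite leq_mul2l leq_pexp2l ?leq_addr ?orbT.
by apply: leq_trans (h' x) _; rewrite leq_mul2l leq_pexp2l ?leq_addl ?orbT.
Qed.

Lemma polyM f g : poly_bounded f -> poly_bounded g -> poly_bounded (fun x => f x * g x)%N.
Proof.
move=> [c [d h]] [c' [d' h']]; exists (c * c')%N, (d + d')%N => x.
by rewrite expnD mulnACA leq_mul.
Qed.

Lemma polyS f : poly_bounded f -> poly_bounded (fun x => (f x).+1).
Proof.
move=> h; have [c [d hf]] := polyD h (poly_cst 1).
by exists c, d => x; rewrite -addn1.
Qed.

(** The output reads both the search registers and the recorded values, so its registers are charged
    with the sum of the two bit bounds, plus two bits for additions. *)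
Definition total_time x := (main_time x + ctime output * (record_deg * reg_bits x + reg_bits x + 2))%N.

Lemma poly_time : poly_bounded total_time.
Proof.
have pB : poly_bounded reg_bits.
  exact: polyD (polyM (poly_cst 110) poly_size) (poly_cst 60).
have pc k : poly_bounded (fun x => k * reg_bits x)%N by apply: polyM pB; exact: poly_cst.
have pN := poly_dims; have pNN := polyM pN pN.
have pden : poly_bounded den_time.
  apply: polyD (pc _) _; apply: polyD; apply: polyM (pc _) => //; exact: polyS.
have psweep : poly_bounded sweep_time.
  apply: polyD (pc _) _; apply: polyD; apply: polyM (pc _) => //; exact: polyS.
have psearch : poly_bounded search_time.
  apply: polyD; first by apply: polyM (pc _); do 2 apply: polyS.
  by apply: polyM; [apply: polyS|apply: polyD psweep (pc _)].
apply: polyD; first exact: polyD pden (polyD (pc _) (polyD (pc _) psearch)).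
apply: polyM (poly_cst _) _; apply: polyD (poly_cst 2); exact: polyD (pc _) pB.
Qed.

End Polynomials.

Section Correctness.
Variables (R : realType) (x : instance).
Local Notation D := (D x).
Hypothesis vx : valid_instance R x.

Let D0 : 0 < D%:~R :> R. Proof. by rewrite ltr0z; have := D_ge2 x; lia. Qed.

(** The accuracy is among the data multiplied into [D]: its denominator divides [D] and its
    numerator is at least 1. *)
Lemma accuracy : D%:~R^-1 <= ratr (acc_of x) :> R.
Proof.
have [/dvdzP[k DE] _] := @scalar_data x 2 isT.
rewrite /scalar_of /= in DE.
rewrite -[X in ratr X](divq_num_den) fmorph_div /= !ratr_int.
rewrite -[X in X <= _]mul1r ler_pdivrMr // mulrAC ler_pdivlMr ?ltr0z //.
have a0 : 1 <= numq (acc_of x) by case: vx => _ _; rewrite -numq_gt0.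
rewrite mul1r -intrM ler_int.
have gen (u d w : int) : 0 < d -> 2 <= u * d -> 1 <= w -> d <= w * (u * d).
  move=> d0 h w0; have u0 : 1 <= u by nia.
  have h1 : d <= u * d by nia.
  by nia.
by rewrite DE; apply: (gen k _ _ (denq_gt0 _) _ a0); rewrite -DE D_ge2.
Qed.

Lemma run_solver : run solver (load (encode_instance x)) (optimized R x) (total_time x).
Proof.
have [n10 n20 eps0 _] := vx.
apply: (run_seq (run_main n10 n20 (@above_mono R x) (above_complete vx)
  (@above_sound R x vx) (above_range vx))) => s [[[hs hD h3 hb] _ st _ _] hJ].
case: st => [[st0 J0]|[st1 [i [i' [l [l' [z [zin zk v p wb]]]]]]]].
  apply: run_weaken (_ : run _ _ (eq s) (ctime output * (record_deg * reg_bits x + reg_bits x + 2))) _ _ => //.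
    have B2 : (0 < record_deg * reg_bits x + reg_bits x + 2)%N by rewrite addnC.
    have bs : bnd low (record_deg * reg_bits x + reg_bits x + 2) s.
      move=> a k la; apply: leq_trans (hb a k la) _; rewrite leq_exp2l //; lia.
    apply: (run_ifB B2 bs) => //=; first by rewrite st0.
    by move=> _; apply: (run_skipB B2).
  move=> _ <-; left; split=> //; apply: (above_empty vx).
  by rewrite -J0.
have B1 : (0 < record_deg * reg_bits x + reg_bits x)%N by rewrite addn_gt0 reg_bits_gt0 orbT.
apply: run_weaken (_ : run _ _ (written s 4) (ctime output * (record_deg * reg_bits x + reg_bits x + 2))) _ _ => //.
  apply: run_output => // [a k a13 a10 a11|k|k|]; last by rewrite st1.
  - have [a9|a9] := leqP a 9.
      by apply: leq_trans (hb a k a9) _; rewrite leq_exp2l // leq_addl.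
    have -> : a = 12%N by lia.
    by apply: leq_trans (wb k) _; rewrite leq_exp2l // leq_addr.
  - by case: (h3 k).
  - by case: (h3 k).
move=> s' w; right; split; first by case: w => h _ _; rewrite /status h.
have [fV gV] := solutionP vx zin zk.
have z0 : 0 < z.2 by case: zk.
cbv zeta; rewrite (answer_solution vx w z0 v p).
have e0 : 0 <= ratr (acc_of x) :> R by rewrite ler0q ltW.
split; first by exists (solution R i i' l l' z) => // r c; rewrite subrr normr0.
have [V [fM Vmax _]] := max_feasible vx (ex_intro _ _ fV); exists V => //; split.
  by move=> W /Vmax; rewrite !objectiveE ler_pM2l.
(* The scaled objectives of the answer and of the maximum both lie in the interval from J to J + 1,
   so they differ by at most 1, and the objectives by at most 1/D. *)
have := hJ V fM; have := Vmax _ fV; move: gV.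
rewrite !objectiveE intrD => h1 h2 h4; apply: le_trans accuracy.
rewrite -(ler_pM2l D0) mulfV ?gt_eqF // -[X in X * _](gtr0_norm D0) -normrM mulrBr.
rewrite ler_norml; apply/andP; split; lra.
Qed.

End Correctness.

Theorem theorem2 (R : realType) :
  (forall (n1 n2 : nat) (A1 A2 : 'M[R]_(n1, n2)) (b1 b2 : R),
     (0 < n1)%N -> (0 < n2)%N ->
     bounded_set (rank1_set A1 A2 b1 b2) ->
     socr_mx (conv_hull (rank1_set A1 A2 b1 b2))) /\
  linear_optimization_poly_time R.
Proof.
split=> [m n A1 A2 b1 b2 m0 _ bdU|].
  pose A (k : bool) := if k then A1 else A2.
  pose b (k : bool) := if k then b1 else b2.
  have [M bM] := @bounded_entry_bound R m n A b bdU.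
  exact: socr_hull bM m0.
have [c [d ht]] := poly_time; exists solver, c, d => x vx.
have [s [t [ex tT opt]]] := run_solver vx; exists s, t; split=> //.
by apply: leq_trans tT (leq_trans (ht x) (leq_addr _ _)).
Qed.
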